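(* If $\lambda>\sqrt{2}$, then $\overline{I(T_\lambda)}=\{(x,y,0): x,y\in\mathbb{R}\}$. The constant $\sqrt{2}$ here cannot be replaced by any smaller value; that is, for every $c$ with $0<c<\sqrt2$ there exists $\lambda>c$ such that $\overline{I(T_\lambda)}\neq\{(x,y,0): x,y\in\mathbb{R}\}$.
   Context: Definition of $T:\mathbb{R}^3\to\mathbb{R}^3\cup\{\infty\}$. Put $M(x,y)=\max\{|x|,|y|\}$. On the beam $X=[-\pi/4,\pi/4]^2\times\mathbb{R}$ define $$T(x,y,z)=\left(\frac{x\cos M\sin M}{\sqrt{x^2+y^2}\,(\cos^2M+\sinh^2z)},\ \frac{y\cos M\sin M}{\sqrt{x^2+y^2}\,(\cos^2M+\sinh^2z)},\ \frac{\sinh z\cosh z}{\cos^2M+\sinh^2z}\right),\quad M=M(x,y),$$ where the first two components are taken to be $0$ if $x=y=0$. Extend $T$ to $\mathbb{R}^3$ by reflecting in the planes $x=\frac{\pi}{2}(k+\frac12)$ and $y=\frac{\pi}{2}(l+\frac12)$ ($k,l\in\mathbb{Z}$) in the domain and inverting in the unit sphere, $\mathbf{x}\mapsto\mathbf{x}/\|\mathbf{x}\|^2$ (with $\mathbf 0\mapsto\infty$), in the image. Explicitly: if $|x-k\pi/2|\le\pi/4$ and $|y-l\pi/2|\le\pi/4$ with $k,l\in\mathbb{Z}$, put $\hat x=(-1)^k(x-k\pi/2)$, $\hat y=(-1)^l(y-l\pi/2)$; then $T(x,y,z)=T(\hat x,\hat y,z)$ if $k+l$ is even, and $T(x,y,z)=T(\hat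 x,\hat y,z)/\|T(\hat x,\hat y,z)\|^2$ if $k+l$ is odd, the value being $\infty$ when $T(\hat x,\hat y,z)=\mathbf{0}$. This is well defined and continuous. For $\lambda>0$ put $T_\lambda(\mathbf{x})=\lambda T(\mathbf{x})$ (with $\lambda\cdot\infty=\infty$). The $k$th iterate $T_\lambda^k$ is not defined at points where an earlier iterate takes the value $\infty$. The backward orbit of infinity is $O^-(\infty)=\bigcup_{k=1}^\infty T_\lambda^{-k}(\infty)$, where $T_\lambda^{-k}(\infty)$ is the set of points $\mathbf{x}\in\mathbb{R}^3$ at which $T_\lambda^k$ is defined with $T_\lambda^k(\mathbf{x})=\infty$. The escaping set is $I(T_\lambda)=\{\mathbf{x}\in\mathbb{R}^3\setminus O^-(\infty): T_\lambda^k(\mathbf{x})\to\infty\text{ as }k\to\infty\}$. Closures are taken in $\mathbb{R}^3$. *)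

(* Defs.v *)
From HB Require Import structures.
From mathcomp Require Import all_boot all_order all_algebra.
From mathcomp Require Import all_classical all_reals all_analysis.
From mathcomp Require Import ring lra zify.

Set Implicit Arguments.
Unset Strict Implicit.
Unset Printing Implicit Defensive.

Import Order.TTheory GRing.Theory Num.Theory.
Import numFieldNormedType.Exports.

Local Open Scope classical_set_scope.
Local Open Scope ring_scope.

Notation extended_space R := (one_point_compactification (R * R * R)%type).
Notation infinity := (None : extended_space _) (only parsing).

Definition sinh (R : realType) (t : R) : R := (expR t - expR (- t)) / 2.

Definition cosh (R : realType) (t : R) : R := (expR t + expR (- t)) / 2.

(* The norm that the library puts on R * R * R is the maximum norm. *)
Definition enorm (R : realType) (p : R * R * R) : R :=
  let: (x, y, z) := p in Num.sqrt (x ^+ 2 + y ^+ 2 + z ^+ 2).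

(* If x = y = 0, the first two components are 0 since 0 / 0 = 0. *)
Definition T_beam (R : realType) (p : R * R * R) : R * R * R :=
  let: (x, y, z) := p in
  let M := Num.max `|x| `|y| in
  let D := cos M ^+ 2 + sinh z ^+ 2 in
  (x * cos M * sin M / (Num.sqrt (x ^+ 2 + y ^+ 2) * D),
   y * cos M * sin M / (Num.sqrt (x ^+ 2 + y ^+ 2) * D),
   sinh z * cosh z / D).

Definition inversion (R : realType) (p : R * R * R) : extended_space R :=
  if p == (0, 0, 0) then infinity
  else let: (x, y, z) := p in
    Some (x / enorm p ^+ 2, y / enorm p ^+ 2, z / enorm p ^+ 2).

Definition fold_coord (R : realType) (k : int) (x : R) : R :=
  (-1) ^ k * (x - k%:~R * (pi / 2)).

(* T_cell k l is meaningful on the beam |x - k pi/2| <= pi/4,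
   |y - l pi/2| <= pi/4, which fold_coord maps isometrically onto
   [-pi/4, pi/4]^2 x R. *)
Definition T_cell (R : realType) (k l : int) (p : R * R * R) :
    extended_space R :=
  let: (x, y, z) := p in
  let q := T_beam (fold_coord k x, fold_coord l y, z) in
  if odd `|(k + l)%R|%N then inversion q else Some q.

Definition cell (R : realType) (x : R) : int :=
  Num.floor (x / (pi / 2) + 1 / 2).

(* On the common boundary of several cells the choice made by [cell] is
   irrelevant: see [TE]. *)
Definition T (R : realType) (p : R * R * R) : extended_space R :=
  T_cell (cell p.1.1) (cell p.1.2) p.

Definition Tl (R : realType) (lambda : R) (p : R * R * R) :
    extended_space R :=
  omap (fun q => (lambda * q.1.1, lambda * q.1.2, lambda * q.2)) (T p).

(* [iterate_at f k p w]: the k-th iterate of f is defined at p, with value w. *)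
Fixpoint iterate_at (R : realType) (f : R * R * R -> extended_space R)
    (k : nat) (p : R * R * R) (w : extended_space R) : Prop :=
  if k is j.+1 then exists2 q, iterate_at f j p (Some q) & w = f q
  else w = Some p.

Definition backward_orbit_infinity (R : realType)
    (f : R * R * R -> extended_space R) : set (R * R * R) :=
  \bigcup_(k in [set k | (1 <= k)%N]) [set p | iterate_at f k p infinity].

Definition escaping_set (R : realType)
    (f : R * R * R -> extended_space R) : set (R * R * R) :=
  [set p | ~ backward_orbit_infinity f p /\
    exists2 u : nat -> extended_space R,
      (forall k, iterate_at f k p (u k)) & u @ \oo --> infinity].

Lemma normN1z (R : realType) (k : int) : `|(-1) ^ k| = 1 :> R.
Proof.
by case: k => n; rewrite ?NegzE -?exprz_inv ?invrN1 -exprnP normrX normrN1 expr1n.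
Qed.

Lemma cell_bound (R : realType) (x : R) :
  - (pi / 4) <= x - (cell x)%:~R * (pi / 2) < pi / 4.
Proof.
have pi0 : 0 < pi :> R := pi_gt0 R.
have := floor_itv (x / (pi / 2) + 1 / 2); rewrite -/(cell x) intrD.
move: (cell x)%:~R => c.
have : x = x / (pi / 2) * (pi / 2) by rewrite divfK // gt_eqF // divr_gt0.
move: (x / (pi / 2)) => s -> /andP[c1 c2].
have h1 : 0 <= (s + 1 / 2 - c) * (pi / 2) by apply: mulr_ge0; lra.
have h2 : 0 < (c + 1 - s - 1 / 2) * (pi / 2) by apply: mulr_gt0; lra.
by apply/andP; split; lra.
Qed.

Lemma fold_coordE (R : realType) (k : int) (x : R) :
  `|x - k%:~R * (pi / 2)| <= pi / 4 ->
  fold_coord k x = fold_coord (cell x) x /\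
  (k = cell x \/ `|fold_coord k x| = pi / 4).
Proof.
have pi0 : 0 < pi :> R := pi_gt0 R.
rewrite ler_norml => /andP[k1 k2].
have /andP[c1 c2] := cell_bound x.
have a1 : k <= cell x.
  rewrite -ltzD1 -(ltr_int R) intrD.
  have : (k%:~R - (cell x)%:~R - 1) * (pi / 2) < 0 :> R by nra.
  by rewrite pmulr_llt0 ?divr_gt0 //; lra.
have a2 : cell x <= k + 1.
  rewrite -(ler_int R) intrD.
  have : ((cell x)%:~R - k%:~R - 1) * (pi / 2) <= 0 :> R by nra.
  by rewrite pmulr_lle0 ?divr_gt0 //; lra.
have [->|kx] := eqVneq k (cell x); first by split => //; left.
have e : cell x = k + 1 by lia.
move: c1 c2; rewrite /fold_coord e intrD => c1 c2.
have ek : x - k%:~R * (pi / 2) = pi / 4 by lra.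
have e1 : (-1) ^ (k + 1) = - (-1) ^ k :> R.
  by rewrite exprzDr ?unitrN1 // expr1z mulrN1.
have ek' : x - (k%:~R + 1) * (pi / 2) = - (pi / 4) by lra.
split; first by rewrite e1 ek ek' mulrNN.
right; rewrite ek normrM normN1z mul1r ger0_norm //; lra.
Qed.

Lemma cell_boundW (R : realType) (x : R) :
  `|fold_coord (cell x) x| <= pi / 4.
Proof.
have /andP[c1 /ltW c2] := cell_bound x.
by rewrite /fold_coord normrM normN1z mul1r ler_norml c1.
Qed.

Lemma inversion_norm1 (R : realType) (p : R * R * R) :
  enorm p = 1 -> inversion p = Some p.
Proof.
case: p => [[x y] z] p1; rewrite /inversion p1 expr1n !divr1.
case: eqP => // -[x0 y0 z0]; move: p1; rewrite /enorm x0 y0 z0.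
by rewrite expr0n /= !addr0 sqrtr0 => /eqP; rewrite eq_sym oner_eq0.
Qed.

Lemma enorm_T_beam (R : realType) (x y z : R) :
  Num.max `|x| `|y| = pi / 4 -> enorm (T_beam (x, y, z)) = 1.
Proof.
move=> M; rewrite /T_beam M /enorm.
have pi0 : 0 < pi :> R := pi_gt0 R.
have cs : cos (pi / 4) = sin (pi / 4) :> R.
  have := tan_piquarter R; rewrite /tan => h.
  have [c0|c0] := eqVneq (cos (pi / 4) : R) 0.
    by move: h; rewrite c0 invr0 mulr0 => /eqP; rewrite eq_sym oner_eq0.
  by rewrite -[RHS](divfK c0) h mul1r.
have c2 : cos (pi / 4) ^+ 2 = 1 / 2 :> R.
  by have := cos2Dsin2 (pi / 4 : R); rewrite -cs; lra.
have ch : cosh z ^+ 2 = 1 + sinh z ^+ 2.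
  have := expRxMexpNx_1 z; rewrite /cosh /sinh => h.
  transitivity (expR z * expR (- z) + ((expR z - expR (- z)) / 2) ^+ 2).
    by field.
  by rewrite h.
rewrite -cs.
set s := sinh z in ch *; set C := cosh z in ch *; set c := cos _ in c2 *.
set D := c ^+ 2 + s ^+ 2.
have D0 : 0 < D by rewrite /D c2; have := sqr_ge0 s; lra.
set r2 := x ^+ 2 + y ^+ 2.
have r0 : 0 < r2.
  have xy : 0 < Num.max `|x| `|y| by rewrite M divr_gt0.
  rewrite /r2 -(real_normK (num_real x)) -(real_normK (num_real y)).
  move: xy; rewrite lt_max => /orP[h|h].
    by rewrite ltr_wpDr ?sqr_ge0 // exprn_gt0.
  by rewrite ltr_wpDl ?sqr_ge0 // exprn_gt0.
have rn0 : Num.sqrt r2 != 0 by rewrite gt_eqF // sqrtr_gt0.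
rewrite -[RHS]sqrtr1; congr Num.sqrt.
have -> : (x * c * c / (Num.sqrt r2 * D)) ^+ 2 +
  (y * c * c / (Num.sqrt r2 * D)) ^+ 2 + (s * C / D) ^+ 2 =
  (r2 / Num.sqrt r2 ^+ 2 * (c ^+ 2) ^+ 2 + s ^+ 2 * C ^+ 2) / D ^+ 2.
  by rewrite /r2; field; rewrite rn0 gt_eqF.
rewrite sqr_sqrtr ?ltW // divff ?gt_eqF // ch /D c2.
have := sqr_ge0 s; move=> h.
by field; apply: lt0r_neq0; lra.
Qed.

Lemma TE (R : realType) (k l : int) (x y z : R) :
  `|x - k%:~R * (pi / 2)| <= pi / 4 -> `|y - l%:~R * (pi / 2)| <= pi / 4 ->
  T (x, y, z) = T_cell k l (x, y, z).
Proof.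
move=> /fold_coordE[xk kx] /fold_coordE[yl ly].
rewrite -[LHS]/(T_cell (cell x) (cell y) (x, y, z)) /T_cell -xk -yl.
set p := T_beam _.
have [[-> ->] //|p1] : (k = cell x /\ l = cell y) \/ enorm p = 1; last first.
  by rewrite /= inversion_norm1 // !if_same.
have bx : `|fold_coord k x| <= pi / 4 by rewrite xk cell_boundW.
have bY : `|fold_coord l y| <= pi / 4 by rewrite yl cell_boundW.
case: kx => [kx|kx].
  case: ly => [ly|ly]; first by left.
  by right; apply: enorm_T_beam; rewrite ly; apply/max_idPr.
by right; apply: enorm_T_beam; rewrite kx; apply/max_idPl.
Qed.

(* Main.v *)
Require Import Defs.
From mathcomp Require Import all_boot all_order all_algebra.
From mathcomp Require Import all_classical all_reals all_analysis.
From mathcomp Require Import measurable_realfun.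
From mathcomp Require Import ring lra zify.
Import Order.TTheory GRing.Theory Num.Theory.
Import numFieldNormedType.Exports.
Local Open Scope classical_set_scope.
Local Open Scope ring_scope.

(** Only the plane z = 0 matters. A point above it is raised at each step by at
    least the real map lam * tanh, which repels 0 as lam > 1, so the height
    stays bounded below; but where it is, T is bounded (escaping_planar).

    On the open square quarter = (0, pi/2)^2 of the plane, T_lam becomes the map
    planar_map, which sends (x, y) to a vector in the direction (u, v), where u
    and v are the distances to the nearest vertical and horizontal side, and of
    length lam * tan (amplitude x y). The symmetries of T (reflections, exchange
    of the coordinates, half-turn about the corner of a cell) carry this to the
    other squares of side pi/2.

    If lam < sqrt 2, near the origin the map multiplies the radius on a ray of
    slope t by about lam / sqrt (1 + t^2), which is below 1 on the diagonal. So
    a sector around the diagonal falls into the origin, and the closure of the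
    escaping set is not the whole plane (closure_neq_plane).

    Let now lam > sqrt 2, and let W be the interior of the set of points of the
    plane that do not escape. It is to be shown that W is empty.

    The x-axis carries the expanding map x |-> lam * tan x, and has escaping
    points near infinity on both sides, namely the ends of infinite chains of
    inverse branches. Any interval grows under iteration until it covers a pole,
    whose neighbourhoods cover neighbourhoods of infinity. So escaping points
    are dense in the axis (axis_dense), and by symmetry in all lines on which x
    or y is in (pi/2) Z. Thus W avoids these lines. It is moreover open, has the
    symmetries of T, and is invariant under the map and its inverse branches:
    this is the record gap. The remaining argument uses nothing else about W.

    W avoids the diagonal (gap_diag). On the diagonal the map is s |-> eta * tan
    s near 0, where eta = lam / sqrt 2 > 1, and W consists there of intervals
    that grow until they contain pi/4. The longest one is symmetric about pi/4;
    unless it is all of (0, pi/2), its second image is longer still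
    (diag_gap_full). If it is, the ray of slope 1 inside the disc of radius lam
    lies in W. The set of slopes in [0, 1] with this property is open, by
    compactness, and closed from above, because the points of a limiting ray
    have iterated preimages in the sector above it (ray_gap_closed). So the
    property holds for the slope 0, but the axis avoids W.

    Hence a connected subset of W lies, up to a symmetry, in the triangle 0 < y
    < x < pi/2. Cut the triangle into pieces and each piece into rays from a
    corner: on a ray the map is a multiple of tan or of its inverse, and it
    expands the squares of the radii by at least lam^2 / 2, hence areas too; it
    is also injective on the triangle (area_triangle_preimage). Consequently a
    connected subset of W, which remains after each iteration inside one such
    triangle, is contained in open sets of area at most (2 / lam^2)^n (pi / 2)^2
    for all n (connected_small). A square in W cannot be, so W is empty
    (gap_empty). *)

(** * Elementary facts *)

Lemma continuous_pair {T U V : topologicalType} (f : T -> U) (g : T -> V) (x : T) :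
  {for x, continuous f} -> {for x, continuous g} ->
  {for x, continuous (fun y => (f y, g y))}.
Proof. by move=> cf cg; apply: cvg_pair. Qed.

Lemma continuous_fst {U V : topologicalType} (p : U * V) :
  {for p, continuous (@fst U V)}.
Proof. exact: cvg_fst. Qed.

Lemma continuous_snd {U V : topologicalType} (p : U * V) :
  {for p, continuous (@snd U V)}.
Proof. exact: cvg_snd. Qed.

Lemma exp_unbounded {R : realType} (e d A : R) : 1 < e -> 0 < d ->
  exists n : nat, A < d * e ^+ n.
Proof.
move=> e1 d0; have dn : 0 < d * (e - 1) by rewrite mulr_gt0//; lra.
pose n := (Num.truncn (A / (d * (e - 1)))).+1; exists n.
have hn : A / (d * (e - 1)) < n%:R by exact: truncnS_gt.
rewrite ltr_pdivrMr// in hn; apply: (lt_trans hn).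
rewrite mulrCA ltr_pM2l//.
have : 1 + n%:R * (e - 1) <= e ^+ n.
  elim: (n) => [|k IH]; first by rewrite mul0r addr0 expr0.
  have h1 : 0 <= k%:R * (e - 1) ^+ 2 by rewrite mulr_ge0 ?sqr_ge0.
  have h2 := ler_wpM2l (ltW (lt_trans ltr01 e1)) IH.
  by rewrite exprS -natr1; lra.
lra.
Qed.

Section Trigonometry.
Context {R : realType}.
Implicit Types a b c d x y : R.

Lemma cos_pos x : 0 <= x < pi / 2 -> 0 < cos x.
Proof.
move=> /andP[x0 xp]; apply: cos_gt0_pihalf; rewrite xp andbT.
by rewrite (lt_le_trans _ x0)// oppr_lt0 divr_gt0// pi_gt0.
Qed.

Lemma tan_ge0 x : 0 <= x < pi / 2 -> 0 <= tan x.
Proof.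
move=> xp; have := cos_pos _ xp; case/andP: xp => x0 xp c0.
have := pi_gt0 R => p0.
by rewrite /tan divr_ge0 ?(ltW c0)// sin_ge0_pi// x0/=; lra.
Qed.

Lemma tan_gt0 x : 0 < x < pi / 2 -> 0 < tan x.
Proof.
move=> /andP[x0 xp]; rewrite /tan divr_gt0//.
  by rewrite sin_gt0_pihalf// x0.
by rewrite cos_pos// (ltW x0).
Qed.

Lemma tan_ge_id x : 0 <= x < pi / 2 -> x <= tan x.
Proof.
move=> /andP[x0 xp].
have cx y : y \in `[0, x] -> cos y != 0.
  by move=> /itvP yx; rewrite gt_eqF// cos_pos// yx/= (le_lt_trans _ xp)// yx.
have [z zx||] := @MVT_segment R tan (fun x => (cos x) ^- 2) 0 x x0.
- by apply: is_derive_tan; apply: cx; exact: subset_itvW zx.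
- by apply: continuous_in_subspaceT => z /[!(@mem_setE R)] zx; exact/continuous_tan/cx.
move=> z /itvP zx; rewrite tan0 !subr0 => ->; rewrite ler_peMl//.
have zc : cos z != 0 by rewrite gt_eqF// cos_pos// zx/= (le_lt_trans _ xp)// zx.
by rewrite cos2_tan2// lerDl sqr_ge0.
Qed.

(** The addition formula gives the convexity estimate for the secants of the
    tangent without any differentiation. *)
Lemma tan_secant_ge c d : 0 <= c <= d -> d < pi / 2 ->
  (d - c) * (1 + tan c ^+ 2) <= tan d - tan c.
Proof.
move=> /andP[c0 cd] dp.
have tc : 0 <= tan c by apply: tan_ge0; rewrite c0 (le_lt_trans cd).
have td : 0 <= tan d by apply: tan_ge0; rewrite dp (le_trans c0).
have h0 : 0 <= d - c < pi / 2 by apply/andP; split; lra.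
have h1 := tan_ge_id _ h0.
have cc : cos c != 0 by rewrite gt_eqF// cos_pos// c0 (le_lt_trans cd).
have cdn : cos d != 0 by rewrite gt_eqF// cos_pos// dp (le_trans c0).
have e : tan (d - c) * (1 + tan c * tan d) = tan d - tan c.
  rewrite tanD ?cosN// tanN mulrN opprK [tan d * _]mulrC divfK//.
  by rewrite gt_eqF// ltr_wpDr// mulr_ge0.
rewrite -e ler_pM//; first by case/andP: h0.
  by rewrite addr_ge0// sqr_ge0.
rewrite lerD2l expr2 ler_wpM2l//.
have : 0 <= tan (d - c) * (1 + tan c * tan d).
  by rewrite mulr_ge0 ?tan_ge0// addr_ge0// mulr_ge0.
by rewrite e subr_ge0.
Qed.

Lemma tan_secant_le c d : 0 <= c <= d -> d < pi / 2 ->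
  tan d - tan c <= (d - c) * (1 + tan d ^+ 2).
Proof.
move=> /andP[c0 cd] dp.
have [->|cd'] := eqVneq c d; first by rewrite !subrr mul0r.
have {cd cd'}cd : c < d by rewrite lt_neqAle cd' cd.
have cx y : y \in `[c, d] -> 0 <= y < pi / 2.
  by move=> /itvP yx; rewrite (le_trans c0) ?yx//= (le_lt_trans _ dp)// yx.
have cx' y : y \in `[c, d] -> cos y != 0.
  by move=> /cx yx; rewrite gt_eqF// cos_pos.
have [z zx||] := @MVT_segment R tan (fun x => (cos x) ^- 2) c d (ltW cd).
- by apply: is_derive_tan; apply: cx'; exact: subset_itvW zx.
- by apply: continuous_in_subspaceT => z /[!(@mem_setE R)] zx; exact/continuous_tan/cx'.
move=> z /itvP zx; have zi : z \in `[c, d] by rewrite in_itv/= !zx.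
have zc := cx' _ zi.
rewrite cos2_tan2// => ->; rewrite mulrC ler_wpM2l//; first by rewrite subr_ge0 ltW.
have dz : 0 <= d - z by rewrite subr_ge0 zx.
have /andP[z0 zp] := cx _ zi.
have tz : 0 <= tan z by apply: tan_ge0; rewrite z0.
have := tan_secant_ge z d; rewrite z0/= zx dp => /(_ isT isT) h.
have : 0 <= (d - z) * (1 + tan z ^+ 2) by rewrite mulr_ge0// addr_ge0// sqr_ge0.
move=> h1; have h2 : tan z <= tan d by lra.
by rewrite lerD2l ler_sqr// nnegrE// (le_trans tz).
Qed.

Lemma tan_mono c d : 0 <= c < d -> d < pi / 2 -> tan c < tan d.
Proof.
move=> /andP[c0 cd] dp; have := tan_secant_ge c d.
rewrite c0 (ltW cd)/= => /(_ isT dp) h.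
rewrite -subr_gt0 (lt_le_trans _ h)// mulr_gt0 ?subr_gt0//.
by rewrite ltr_pwDl// sqr_ge0.
Qed.

Lemma tan_monoW c d : 0 <= c <= d -> d < pi / 2 -> tan c <= tan d.
Proof.
move=> /andP[c0]; rewrite le_eqVlt => /predU1P[->//|cd] dp.
by rewrite ltW// tan_mono// c0.
Qed.

Lemma tan_le1 x : 0 <= x <= pi / 4 -> tan x <= 1.
Proof.
move=> /andP[x0 xp]; rewrite -(tan_piquarter R) tan_monoW ?x0//.
by have := pi_gt0 R => p0; lra.
Qed.

(** A chord of the convex tangent: the graph on [0, pi/4] is below it. *)
Lemma tan_chord x : 0 <= x <= pi / 4 -> tan x * (pi / 4) <= x.
Proof.
move=> /andP[x0 xp]; have p0 := pi_gt0 R.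
have p2 : pi / 4 < pi / 2 :> R by lra.
have := tan_secant_ge x (pi / 4); rewrite x0 xp => /(_ isT p2).
rewrite tan_piquarter => h1.
have := tan_secant_le 0 x; rewrite lexx x0 tan0 !subr0 => /(_ isT (le_lt_trans xp p2)).
have : 0 <= tan x by apply: tan_ge0; rewrite x0/= (le_lt_trans xp).
move: (tan x) h1 => t h1 t0 h2.
have h3 := ler_wpM2l x0 h1.
have h4 : (pi / 4 - x) * t <= (pi / 4 - x) * (x * (1 + t ^+ 2)).
  by apply: ler_wpM2l => //; lra.
nra.
Qed.

Lemma tan_pihalfB x : sin x != 0 -> tan (pi / 2 - x) = (tan x)^-1.
Proof.
move=> sx; rewrite /tan -[pi/2 - x]opprB sinN cosN sinBpihalf cosBpihalf.
by rewrite opprK invf_div.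
Qed.

Lemma sin_neq0 x : 0 < x <= pi / 2 -> sin x != 0.
Proof.
move=> /andP[x0 xp]; have p0 := pi_gt0 R.
by rewrite gt_eqF// sin_gt0_pi// x0/=; lra.
Qed.

Lemma tan_pihalfB_itv x : 0 < x < pi / 2 -> tan (pi / 2 - x) = (tan x)^-1.
Proof.
by move=> /andP[x0 xp]; rewrite tan_pihalfB// sin_neq0// x0 ltW.
Qed.

(** The addition formula for tan (pi/4 - x), bounded below by its argument. *)
Lemma tan_quarter_sub x : 0 <= x <= pi / 4 ->
  pi / 4 - (1 - tan x) / (1 + tan x) <= x.
Proof.
move=> /andP[x0 xp]; have p0 := pi_gt0 R.
have h : 0 <= pi / 4 - x < pi / 2 by apply/andP; split; lra.
have := tan_ge_id _ h; have c1 : cos (pi / 4) != 0 :> R.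
  by rewrite gt_eqF// cos_pos//; apply/andP; split; lra.
have c2 : cos (- x) != 0 by rewrite cosN gt_eqF// cos_pos// x0/=; lra.
rewrite tanD// tanN tan_piquarter mul1r opprK; lra.
Qed.

Lemma sin_le_id x : 0 <= x < pi -> sin x <= x.
Proof.
move=> /andP[x0 xp].
have h0 : 0 <= x / 2 < pi / 2 by apply/andP; split; lra.
case/andP: (h0) => h1 h2.
have := tan_secant_le 0 (x / 2); rewrite lexx h1 tan0 !subr0 => /(_ isT h2).
have c0 : 0 < cos (x / 2) by rewrite cos_pos.
rewrite -cos2_tan2 ?gt_eqF// /tan ler_pdivrMr// => h.
have -> : x = x / 2 *+ 2 by lra.
rewrite sin_mulr2n lerMn2r/= mulrC.
have e : x / 2 * cos (x / 2) ^- 2 * cos (x / 2) = x / 2 / cos (x / 2).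
  by field; rewrite gt_eqF.
by rewrite e ler_pdivlMr// in h.
Qed.

(** sin (pi/6) = 1/2 by the triplication formula, and sin x <= x. *)
Lemma pi_ge3 : 3 <= pi :> R.
Proof.
have p0 := pi_gt0 R; pose s : R := sin (pi / 6).
have s0 : 0 < s by apply: sin_gt0_pi; apply/andP; split; lra.
have e : pi / 2 = pi / 6 *+ 2 + pi / 6 :> R by lra.
have := sin_pihalf R; rewrite e sinD sin_mulr2n cos_mulr2n.
rewrite -/s => h.
have := cos2Dsin2 (pi / 6 : R); rewrite -/s; set c := cos _ in h * => cs.
have h1 : 3 * s - 4 * s ^+ 3 = 1.
  have e2 : (c * s *+ 2 * c + (c ^+ 2 *+ 2 - 1) * s) = 4 * c ^+ 2 * s - s by ring.
  by move: h; rewrite e2; have -> : c ^+ 2 = 1 - s ^+ 2; lra.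
have h2 : (s + 1) * (2 * s - 1) ^+ 2 = 0 by lra.
move/eqP: h2; rewrite mulf_eq0 => /orP[/eqP|]; first lra.
rewrite sqrf_eq0 => /eqP h2.
have := @sin_le_id (pi / 6); rewrite -/s => h3.
have : 0 <= (pi : R) / 6 < pi by apply/andP; split; lra.
by move=> /h3; lra.
Qed.

(** x <= tan x at x = pi/16, where the duplication formula applied twice to
    tan (pi/4) = 1 shows that tan (pi/16) < 1/5. *)
Lemma pi_lt_16div5 : pi < 16 / 5 :> R.
Proof.
have p0 := pi_gt0 R; pose t : R := tan (pi / 16).
have t0 : 0 < t by apply: tan_gt0; apply/andP; split; lra.
have c x : 0 < x < pi / 2 -> cos x != 0.
  by move=> /andP[x0 xp]; rewrite gt_eqF// cos_pos// (ltW x0).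
have c16 : cos (pi / 16) != 0 :> R by apply: c; apply/andP; split; lra.
have c8 : cos (pi / 8) != 0 :> R by apply: c; apply/andP; split; lra.
have : pi / 16 <= t by apply: tan_ge_id; apply/andP; split; lra.
suff : t < 1 / 5 by lra.
rewrite ltNge; apply/negP => t5.
have e1 : pi / 4 = pi / 8 *+ 2 :> R by lra.
have e2 : pi / 8 = pi / 16 *+ 2 :> R by lra.
have t1 : t < 1.
  rewrite -(tan_piquarter R) /t; apply: tan_mono; first by apply/andP; split; lra.
  lra.
have u0 : 0 < 1 - t ^+ 2 by nra.
have := tan_piquarter R; rewrite e1 tan_mulr2n// e2 tan_mulr2n// -/t.
set u := t *+ 2 / _.
have hu : u * (1 - t ^+ 2) = 2 * t by rewrite /u divfK ?gt_eqF//; lra.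
have u5 : 5 / 12 <= u.
  have : 0 <= (u - 5 / 12) * (1 - t ^+ 2) by nra.
  by rewrite pmulr_lge0//; lra.
move=> h; have [u1|u1] := eqVneq (1 - u ^+ 2) 0.
  by move: h; rewrite u1 invr0 mulr0 => /esym/eqP; rewrite oner_eq0.
have : u *+ 2 = 1 - u ^+ 2 by rewrite -(divfK u1 (u *+ 2)) h mul1r.
nra.
Qed.

End Trigonometry.

(** * Escaping orbits *)

Section Escaping.
Context {R : realType}.
Implicit Types (f : R * R * R -> extended_space R) (p q : R * R * R).

Lemma iterate_at_inj f k p w w' :
  iterate_at f k p w -> iterate_at f k p w' -> w = w'.
Proof.
elim: k w w' => [|k IH] w w' /=; first by move=> -> ->.
by move=> [q hq ->] [q' hq' ->]; have [->] := IH _ _ hq hq'.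
Qed.

(** An orbit of finite points is the form in which escape is used; the value
    infinity and the filter of its neighbourhoods are eliminated once and for
    all by escaping_setE. *)
Definition escapes f p := exists u : nat -> R * R * R,
  [/\ u 0%N = p, forall k, f (u k) = Some (u k.+1) &
      forall A : R, \forall k \near \oo, A < `|u k| ].

(** The neighbourhoods of infinity are the complements of compact sets, and
    bounded sets lie in compact boxes. *)
Lemma escaping_setE f : escaping_set f = escapes f.
Proof.
apply/seteqP; split=> p.
  move=> [nb [w hw wi]].
  have ws k : exists q, w k = Some q.
    have := hw k; case E: (w k) => [q|]; first by exists q.
    move=> hk; exfalso; apply: nb; exists k => //=.
    by case: k E hk => [|k]//= _.
  have [u hu] := choice ws.
  exists u; split.
  - by have := hw 0%N; rewrite hu /= => -[].
  - move=> k; have := hw k.+1; rewrite !hu /= => -[q hq ->].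
    by have := iterate_at_inj _ _ _ _ _ hq (hw k); rewrite hu => -[->].
  - move=> A; pose K : set (R * R * R) :=
      (`[- A, A]%classic `*` `[- A, A]%classic) `*` `[- A, A]%classic.
    have cK : compact K by do 2?apply: compact_setX; exact: segment_compact.
    have clK : closed K by apply: compact_closed => //; exact: Rhausdorff.
    have : \forall k \near \oo, ((Some @` (~` K)) `|` [set None]) (w k).
      by apply: wi; exists K.
    apply: filterS => k [[q nKq]|]; rewrite hu // => -[<-].
    rewrite ltNge; apply/negP => qA; apply: nKq.
    move: qA; case: q => [[x y] z]; rewrite !prod_normE/= !ge_max => /andP[/andP[]].
    by rewrite !ler_norml /K/= !in_itv/= => -> -> ->.
move=> [u [u0 uS uoo]].
have hit k : iterate_at f k p (Some (u k)).
  by elim: k => [|k IH]/=; [rewrite u0|exists (u k)].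
split.
  move=> [[|k] //= _ [q hq]].
  by have := iterate_at_inj _ _ _ _ _ hq (hit k) => -[->]; rewrite uS.
exists (fun k => Some (u k)) => // V [K [cK clK] KV].
have [A [_ hA]] := compact_bounded cK.
have := uoo (A + 1); apply: filterS => k Ak; apply: KV; left; exists (u k) => //.
have A1 : A < A + 1 by rewrite ltrDl ltr01.
by move=> /(hA _ A1) h; move: Ak; rewrite /= ltNge h.
Qed.

Lemma escapesS f p : escapes f p <-> exists2 q, f p = Some q & escapes f q.
Proof.
split.
  move=> [u [<- uS uoo]]; exists (u 1%N) => //; exists (u \o S); split => //= A.
  by have [N _ hN] := uoo A; exists N => // k Nk; apply: hN; exact: leqW.
move=> [q pq [u [u0 uS uoo]]].
exists (fun k => if k is j.+1 then u j else p); split => //.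
  by case=> [|k] /=; rewrite ?u0.
move=> A; have [N _ hN] := uoo A; exists N.+1 => // -[|k]//= Nk.
exact: hN.
Qed.

Lemma escapes_eq f p p' : f p = f p' -> escapes f p -> escapes f p'.
Proof. by move=> e /escapesS[q pq eq]; apply/escapesS; exists q; rewrite -?e. Qed.

Lemma escapes_sym f (s : R * R * R -> R * R * R) p :
  (forall q, f (s q) = omap s (f q)) -> (forall q, `|s q| = `|q|) ->
  escapes f p -> escapes f (s p).
Proof.
move=> sf sn [u [u0 uS uoo]]; exists (s \o u); split => /=; first by rewrite u0.
  by move=> k; rewrite sf uS.
by move=> A; apply: filterS (uoo A) => k; rewrite sn.
Qed.

End Escaping.

(** * Symmetries of the map *)

Section Symmetries.
Context {R : realType}.
Implicit Types (x y z lam : R) (k l : int).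

Definition neg_x (p : R * R * R) : R * R * R := (- p.1.1, p.1.2, p.2).
Definition neg_z (p : R * R * R) : R * R * R := (p.1.1, p.1.2, - p.2).
Definition swap_xy (p : R * R * R) : R * R * R := (p.1.2, p.1.1, p.2).

Lemma T_beam_neg_x p : T_beam (neg_x p) = neg_x (T_beam p).
Proof. by case: p => [[x y] z]; rewrite /neg_x /= normrN sqrrN !mulNr. Qed.

Lemma T_beam_neg_z p : T_beam (neg_z p) = neg_z (T_beam p).
Proof.
case: p => [[x y] z]; rewrite /neg_z /=.
have -> : sinh (- z) = - sinh z by rewrite /sinh opprK; field.
have -> : cosh (- z) = cosh z by rewrite /cosh opprK addrC.
by rewrite sqrrN !mulNr.
Qed.

Lemma T_beam_swap_xy p : T_beam (swap_xy p) = swap_xy (T_beam p).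
Proof.
by case: p => [[x y] z]; rewrite /swap_xy /= maxC [y ^+ 2 + _]addrC.
Qed.

Lemma enorm_neg_x p : enorm (neg_x p) = enorm p.
Proof. by case: p => [[x y] z]; rewrite /neg_x /= sqrrN. Qed.

Lemma enorm_neg_z p : enorm (neg_z p) = enorm p.
Proof. by case: p => [[x y] z]; rewrite /neg_z /= sqrrN. Qed.

Lemma enorm_swap_xy p : enorm (swap_xy p) = enorm p.
Proof. by case: p => [[x y] z]; rewrite /swap_xy /= [y ^+ 2 + _]addrC. Qed.

(** A linear isometry commutes with the inversion. *)
Lemma inversion_sym (s : R * R * R -> R * R * R) :
  (forall p, enorm (s p) = enorm p) -> (forall p, s p = (0, 0, 0) -> p = (0, 0, 0)) ->
  s (0, 0, 0) = (0, 0, 0) ->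
  (forall x y z e, s (x / e, y / e, z / e) =
     let: (x', y', z') := s (x, y, z) in (x' / e, y' / e, z' / e)) ->
  forall p, inversion (s p) = omap s (inversion p).
Proof.
move=> se s0 s00 sZ [[x y] z]; rewrite /inversion se.
have [E|E] := eqVneq (x, y, z) (0, 0, 0); first by rewrite E s00 eqxx.
have -> : (s (x, y, z) == (0, 0, 0)) = false.
  by apply/negbTE; apply: contra E => /eqP/s0 ->.
by rewrite /= sZ; case: (s _) => [[? ?] ?].
Qed.

Lemma inversion_neg_x p : inversion (neg_x p) = omap neg_x (inversion p).
Proof.
apply: inversion_sym => //; first exact: enorm_neg_x.
- by case=> [[x y] z] [/eqP]; rewrite oppr_eq0 => /eqP -> -> ->.
- by rewrite /neg_x /= oppr0.
- by move=> *; rewrite /neg_x /= mulNr.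
Qed.

Lemma inversion_neg_z p : inversion (neg_z p) = omap neg_z (inversion p).
Proof.
apply: inversion_sym => //; first exact: enorm_neg_z.
- by case=> [[x y] z] [-> -> /eqP]; rewrite oppr_eq0 => /eqP ->.
- by rewrite /neg_z /= oppr0.
- by move=> *; rewrite /neg_z /= mulNr.
Qed.

Lemma inversion_swap_xy p : inversion (swap_xy p) = omap swap_xy (inversion p).
Proof.
apply: inversion_sym => //; first exact: enorm_swap_xy.
by case=> [[x y] z] [-> -> ->].
Qed.

Lemma in_cell x : `|x - (cell x)%:~R * (pi / 2)| <= pi / 4.
Proof. by have /andP[c1 /ltW c2] := cell_bound x; rewrite ler_norml c1. Qed.

Lemma in_cellN x : `|- x - (- cell x)%:~R * (pi / 2)| <= pi / 4.
Proof. by rewrite intrN mulNr -opprD normrN in_cell. Qed.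

Lemma fold_coordN k x : fold_coord (- k) (- x) = - fold_coord k x.
Proof.
rewrite /fold_coord -exprz_inv invrN1 intrN; ring.
Qed.

Lemma T_neg_x p : T (neg_x p) = omap neg_x (T p).
Proof.
case: p => [[x y] z]; rewrite -[neg_x _]/(- x, y, z) (TE _ (in_cellN x) (in_cell y)).
rewrite /T /T_cell fold_coordN.
have -> : odd `|(- cell x + cell y)%R|%N = odd `|(cell x + cell y)%R|%N by lia.
rewrite [T_beam _](T_beam_neg_x (fold_coord (cell x) x, fold_coord (cell y) y, z)).
by rewrite /=; case: ifP => // _; exact: inversion_neg_x.
Qed.

Lemma T_neg_z p : T (neg_z p) = omap neg_z (T p).
Proof.
case: p => [[x y] z]; rewrite -[neg_z _]/(x, y, - z) /T /T_cell.
rewrite [T_beam _](T_beam_neg_z (fold_coord (cell x) x, fold_coord (cell y) y, z)).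
by rewrite /=; case: ifP => // _; exact: inversion_neg_z.
Qed.

Lemma T_swap_xy p : T (swap_xy p) = omap swap_xy (T p).
Proof.
case: p => [[x y] z]; rewrite -[swap_xy _]/(y, x, z) /T /T_cell.
rewrite [T_beam _](T_beam_swap_xy (fold_coord (cell x) x, fold_coord (cell y) y, z)).
by rewrite [in LHS]addrC; case: ifP => // _; exact: inversion_swap_xy.
Qed.

Lemma fold_coord_shift k x : fold_coord (k + 1) (x + pi / 2) = - fold_coord k x.
Proof.
rewrite /fold_coord exprzDr ?unitrN1// expr1z mulrN1 intrD; ring.
Qed.

Lemma in_cell_shift k x : `|x - k%:~R * (pi / 2)| <= pi / 4 ->
  `|x + pi / 2 - (k + 1)%:~R * (pi / 2)| <= pi / 4.
Proof. by have -> : x + pi / 2 - (k + 1)%:~R * (pi / 2) = x - k%:~R * (pi / 2) by rewrite intrD; ring. Qed.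

(** T is invariant under the half-turn about (pi/4, pi/4): it is the product of
    two reflections in sides of cells, which each add an inversion. *)
Lemma T_shift_diag x y z :
  T (x + pi / 2, y + pi / 2, z) = T (- x, - y, z).
Proof.
rewrite (TE _ (in_cellN x) (in_cellN y)).
rewrite (TE _ (in_cell_shift _ _ (in_cell x)) (in_cell_shift _ _ (in_cell y))).
rewrite /T_cell !fold_coordN !fold_coord_shift.
by congr (if _ then _ else _); lia.
Qed.

Lemma T_shift_x x y z : T (x + pi, y, z) = T (x, y, z).
Proof.
have -> : x + pi = x + pi / 2 + pi / 2 by field.
rewrite (TE _ (in_cell_shift _ _ (in_cell_shift _ _ (in_cell x))) (in_cell y)).
rewrite /T /T_cell/= !fold_coord_shift opprK.
by congr (if _ then _ else _); lia.
Qed.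

Definition scale3 lam (q : R * R * R) := (lam * q.1.1, lam * q.1.2, lam * q.2).

Lemma TlE lam p : Tl lam p = omap (scale3 lam) (T p). Proof. by []. Qed.

Lemma Tl_sym lam (s : R * R * R -> R * R * R) :
  (forall p, T (s p) = omap s (T p)) ->
  (forall q, scale3 lam (s q) = s (scale3 lam q)) ->
  forall p, Tl lam (s p) = omap s (Tl lam p).
Proof. by move=> Ts ls p; rewrite !TlE Ts; case: (T p) => //= q; rewrite ls. Qed.

Lemma escapes_neg_x lam p : escapes (Tl lam) p -> escapes (Tl lam) (neg_x p).
Proof.
apply: escapes_sym => [q|[[x y] z]]; last by rewrite !prod_normE/= normrN.
by apply: Tl_sym; [exact: T_neg_x|move=> q'; rewrite /scale3/neg_x/= mulrN].
Qed.

Lemma escapes_neg_z lam p : escapes (Tl lam) p -> escapes (Tl lam) (neg_z p).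
Proof.
apply: escapes_sym => [q|[[x y] z]]; last by rewrite !prod_normE/= normrN.
by apply: Tl_sym; [exact: T_neg_z|move=> q'; rewrite /scale3/neg_z/= mulrN].
Qed.

Lemma escapes_swap_xy lam p : escapes (Tl lam) p -> escapes (Tl lam) (swap_xy p).
Proof.
apply: escapes_sym => [q|[[x y] z]]; last by rewrite !prod_normE/= [Num.max `|y| _]maxC.
by apply: Tl_sym => //; exact: T_swap_xy.
Qed.

End Symmetries.

(** * The map on the plane *)

Section Plane.
Context {R : realType}.
Implicit Types (x y z u v lam : R).

Lemma sinh0 : sinh (0 : R) = 0.
Proof. by rewrite /sinh oppr0 subrr mul0r. Qed.

Lemma T_beam_plane u v : T_beam (u, v, 0) =
  (u * tan (Num.max `|u| `|v|) / Num.sqrt (u ^+ 2 + v ^+ 2),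
   v * tan (Num.max `|u| `|v|) / Num.sqrt (u ^+ 2 + v ^+ 2), 0).
Proof.
rewrite /T_beam sinh0 !mul0r expr0n addr0 /tan.
move: (Num.max _ _) (Num.sqrt _) => M r.
have [c0|c0] := eqVneq (cos M) 0; first by rewrite c0 invr0 !(mulr0, mul0r, invr0).
have [->|r0] := eqVneq r 0; first by rewrite !(mul0r, mulr0, invr0).
by congr (_, _, _); field; rewrite r0 c0.
Qed.

Lemma inversion_plane u v t : t != 0 -> u ^+ 2 + v ^+ 2 != 0 ->
  inversion (u * t / Num.sqrt (u ^+ 2 + v ^+ 2), v * t / Num.sqrt (u ^+ 2 + v ^+ 2), 0)
  = Some (u * t^-1 / Num.sqrt (u ^+ 2 + v ^+ 2),
          v * t^-1 / Num.sqrt (u ^+ 2 + v ^+ 2), 0).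
Proof.
move=> t0 r0; set r := Num.sqrt _.
have u2 : 0 <= u ^+ 2 + v ^+ 2 by rewrite addr_ge0// sqr_ge0.
have rn0 : r != 0 by rewrite sqrtr_eq0 -ltNge lt_neqAle eq_sym r0.
have rE : r ^+ 2 = u ^+ 2 + v ^+ 2 by rewrite sqr_sqrtr.
have e2 : enorm (u * t / r, v * t / r, 0) ^+ 2 = t ^+ 2.
  rewrite /enorm sqr_sqrtr ?addr_ge0 ?sqr_ge0//.
  transitivity ((u ^+ 2 + v ^+ 2) / r ^+ 2 * t ^+ 2); first by field.
  by rewrite -rE divff ?mul1r// expf_neq0.
rewrite /inversion; case: eqP => [[h1 h2]|_]; last first.
  by rewrite e2 mul0r; congr (Some (_, _, _)); field; rewrite rn0 t0.
move: e2; rewrite h1 h2 /enorm !expr0n !addr0 sqrtr0 expr0n/= => /esym/eqP.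
by rewrite sqrf_eq0 (negbTE t0).
Qed.

(** The distance to the nearer end of [0, pi/2]. *)
Definition half_fold x := Num.min x (pi / 2 - x).

(** On the quarter square this is the number N with |T (x, y, 0)| = tan N: on
    the cells of even parity it is the maximum of the two distances, on the
    other ones its difference from pi/2, since the inversion turns tan into
    its inverse. The formula covers all four cells. *)
Definition amplitude x y := Num.min (Num.max x y) (pi / 2 - Num.min x y).

(** The map T_lam on the quarter square, see Tl_quarter. *)
Definition planar_map lam (p : R * R) : R * R :=
  let u := half_fold p.1 in let v := half_fold p.2 in
  let a := lam * tan (amplitude p.1 p.2) / Num.sqrt (u ^+ 2 + v ^+ 2) in
  (a * u, a * v).

Lemma half_fold_lo x : x <= pi / 4 -> half_fold x = x.
Proof. by move=> h; rewrite /half_fold min_l//; lra. Qed.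

Lemma half_fold_hi x : pi / 4 <= x -> half_fold x = pi / 2 - x.
Proof. by move=> h; rewrite /half_fold min_r//; lra. Qed.

Lemma fold_coord0 x : fold_coord 0 x = x.
Proof. by rewrite /fold_coord expr0z mul1r mul0r subr0. Qed.

Lemma fold_coord1 x : fold_coord 1 x = pi / 2 - x.
Proof. by rewrite /fold_coord expr1z mulN1r mul1r opprB. Qed.

Lemma Tl_even lam k l x y u v : `|x - k%:~R * (pi / 2)| <= pi / 4 ->
  `|y - l%:~R * (pi / 2)| <= pi / 4 -> odd `|(k + l)%R|%N = false ->
  fold_coord k x = u -> fold_coord l y = v ->
  Tl lam (x, y, 0) =
  let a := lam * tan (Num.max `|u| `|v|) / Num.sqrt (u ^+ 2 + v ^+ 2) in
  Some (a * u, a * v, 0).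
Proof.
move=> hx hy o ux vy; rewrite TlE (TE _ hx hy) /T_cell o ux vy T_beam_plane /=.
by rewrite /scale3 /= mulr0; congr (Some (_, _, _)); ring.
Qed.

(** At the centres of the odd cells, where u = v = 0, the value is infinite. *)
Lemma Tl_odd lam k l x y u v : `|x - k%:~R * (pi / 2)| <= pi / 4 ->
  `|y - l%:~R * (pi / 2)| <= pi / 4 -> odd `|(k + l)%R|%N ->
  fold_coord k x = u -> fold_coord l y = v -> 0 < Num.max `|u| `|v| ->
  Tl lam (x, y, 0) =
  let a := lam * tan (pi / 2 - Num.max `|u| `|v|) / Num.sqrt (u ^+ 2 + v ^+ 2) in
  Some (a * u, a * v, 0).
Proof.
move=> hx hy o ux vy M0; rewrite TlE (TE _ hx hy) /T_cell o ux vy T_beam_plane.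
have p0 := pi_gt0 R.
have Mp : Num.max `|u| `|v| <= pi / 4.
  by rewrite ge_max -ux -vy !normrM !normN1z !mul1r hx.
rewrite inversion_plane.
- rewrite /= /scale3 /= mulr0 tan_pihalfB_itv; last by rewrite M0/=; lra.
  by congr (Some (_, _, _)); ring.
- by rewrite gt_eqF// tan_gt0// M0/=; lra.
- rewrite paddr_eq0 ?sqr_ge0// !sqrf_eq0; apply/negP => /andP[/eqP u0 /eqP v0].
  by move: M0; rewrite u0 v0 normr0 maxxx ltxx.
Qed.

Definition quarter : set (R * R) :=
  [set p | 0 < p.1 < pi / 2 /\ 0 < p.2 < pi / 2].

Lemma Tl_quarter lam x y : quarter (x, y) ->
  Tl lam (x, y, 0) = Some (planar_map lam (x, y), 0).
Proof.
move=> [/= /andP[x0 xp] /andP[y0 yp]]; have p0 := pi_gt0 R.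
have lo (t : R) : 0 < t -> t <= pi / 4 -> `|t - 0%:~R * (pi / 2)| <= pi / 4.
  by move=> t0 tp; rewrite mul0r subr0 ger0_norm// ltW.
have hi (t : R) : pi / 4 <= t -> t < pi / 2 -> `|t - 1%:~R * (pi / 2)| <= pi / 4.
  by move=> t0 tp; rewrite mul1r ler_norml; apply/andP; split; lra.
rewrite /planar_map /= /amplitude.
have [xq|/ltW xq] := lerP x (pi / 4); have [yq|/ltW yq] := lerP y (pi / 4).
- rewrite (Tl_even lam _ _ _ _ _ _ (lo _ x0 xq) (lo _ y0 yq) _ (fold_coord0 x) (fold_coord0 y))//.
  rewrite !half_fold_lo// !gtr0_norm// [Num.min (Num.max _ _) _]min_l//.
  by rewrite /Num.max /Num.min; case: ifP; lra.
- rewrite (Tl_odd lam _ _ _ _ _ _ (lo _ x0 xq) (hi _ yq yp) _ (fold_coord0 x) (fold_coord1 y))//; last first.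
    by rewrite lt_max normr_gt0 gt_eqF.
  rewrite half_fold_lo// half_fold_hi// !gtr0_norm ?subr_gt0//.
  rewrite [Num.max x y]max_r ?(le_trans xq)// [Num.min x y]min_l ?(le_trans xq)//.
  by rewrite /Num.max /Num.min; case: ifP; case: ifP => *; congr (Some (lam * tan _ / _ * _, lam * tan _ / _ * _, _)); lra.
- rewrite (Tl_odd lam _ _ _ _ _ _ (hi _ xq xp) (lo _ y0 yq) _ (fold_coord1 x) (fold_coord0 y))//; last first.
    by rewrite lt_max !normr_gt0 [y == 0]gt_eqF// orbT.
  rewrite half_fold_hi// half_fold_lo// !gtr0_norm ?subr_gt0//.
  rewrite [Num.max x y]max_l ?(le_trans yq)// [Num.min x y]min_r ?(le_trans yq)//.
  by rewrite /Num.max /Num.min; case: ifP; case: ifP => *; congr (Some (lam * tan _ / _ * _, lam * tan _ / _ * _, _)); lra.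
- rewrite (Tl_even lam _ _ _ _ _ _ (hi _ xq xp) (hi _ yq yp) _ (fold_coord1 x) (fold_coord1 y))//.
  rewrite !half_fold_hi// !gtr0_norm ?subr_gt0//.
  have -> : Num.max (pi / 2 - x) (pi / 2 - y) = pi / 2 - Num.min x y.
    by rewrite /Num.max /Num.min; case: ifP; case: ifP; lra.
  rewrite [Num.min (Num.max _ _) _]min_r//.
  by rewrite /Num.max /Num.min; case: ifP; lra.
Qed.

Lemma planar_map_gt0 lam x y : 0 < lam -> quarter (x, y) ->
  0 < (planar_map lam (x, y)).1 /\ 0 < (planar_map lam (x, y)).2.
Proof.
move=> l0 [/= /andP[x0 xp] /andP[y0 yp]]; have p0 := pi_gt0 R.
have u0 (t : R) : 0 < t -> t < pi / 2 -> 0 < half_fold t.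
  by move=> t0 tp; rewrite /half_fold lt_min t0 subr_gt0.
have a0 : 0 < tan (amplitude x y).
  apply: tan_gt0; rewrite /amplitude lt_min gt_min !lt_max x0/= gt_max xp yp.
  by rewrite subr_gt0 gt_min xp.
have s0 : 0 < Num.sqrt (half_fold x ^+ 2 + half_fold y ^+ 2).
  by rewrite sqrtr_gt0 ltr_wpDr ?sqr_ge0// exprn_gt0// u0.
by rewrite /planar_map /=; split; rewrite mulr_gt0 ?u0// divr_gt0// mulr_gt0.
Qed.

End Plane.

(** * No escape off the plane *)

Section OffPlane.
Context {R : realType}.
Implicit Types (x y z u v c lam : R).

Lemma sinh_gt0 z : 0 < z -> 0 < sinh z.
Proof.
by move=> z0; rewrite /sinh divr_gt0// subr_gt0 ltr_expR; lra.
Qed.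

Lemma cosh_gt0 z : 0 < cosh z.
Proof. by rewrite /cosh divr_gt0// addr_gt0// expR_gt0. Qed.

Lemma cosh2 z : cosh z ^+ 2 = 1 + sinh z ^+ 2.
Proof.
have := expRxMexpNx_1 z; rewrite /cosh /sinh => h.
transitivity (expR z * expR (- z) + ((expR z - expR (- z)) / 2) ^+ 2).
  by field.
by rewrite h.
Qed.

Lemma le_sinh c z : c <= z -> sinh c <= sinh z.
Proof.
move=> cz; have h1 : expR c <= expR z by rewrite ler_expR.
have h2 : expR (- z) <= expR (- c) by rewrite ler_expR lerN2.
by rewrite /sinh; lra.
Qed.

Lemma le_tanh c z : c <= z -> sinh c / cosh c <= sinh z / cosh z.
Proof.
move=> cz; rewrite ler_pdivrMr ?cosh_gt0// mulrAC ler_pdivlMr ?cosh_gt0//.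
have h1 : expR c <= expR z by rewrite ler_expR.
have h2 : expR (- z) <= expR (- c) by rewrite ler_expR lerN2.
rewrite /sinh/cosh.
have := expR_gt0 c; have := expR_gt0 z; have := expR_gt0 (- c); have := expR_gt0 (- z).
move: (expR c) (expR z) (expR (- c)) (expR (- z)) h1 h2 => a b a' b' h1 h2 *.
nra.
Qed.

(** The image under T_beam has last coordinate sinh z * cosh z / D, where
    D = cos^2 M + sinh^2 z <= cosh^2 z, and squared norm at most cosh^2 z / D.
    So with or without the inversion the last coordinate is at least tanh z. *)
Lemma T_upper (p q : R * R * R) : T p = Some q -> 0 < p.2 ->
  sinh p.2 / cosh p.2 <= q.2 /\
  `|q| <= (sinh p.2)^-1 ^+ 2 + 1 + (sinh p.2)^-1.
Proof.
case: p => [[x y] z]; rewrite /T /T_cell /=.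
move: (fold_coord _ x) (fold_coord _ y) => u v.
set M := Num.max _ _ => + z0.
have s0 := sinh_gt0 _ z0; have c0 := cosh_gt0 z; have ch2 := cosh2 z.
move: (sinh z) (cosh z) s0 c0 ch2 => s ch s0 c0 ch2.
have cs := cos2Dsin2 M; set C := cos M in cs *; set S := sin M in cs *.
set r := Num.sqrt _; set D := C ^+ 2 + s ^+ 2.
have sD : s ^+ 2 <= D by rewrite lerDr sqr_ge0.
have D0 : 0 < D by rewrite (lt_le_trans _ sD)// exprn_gt0.
have Dc : D <= ch ^+ 2 by rewrite ch2 lerD2r -cs lerDl sqr_ge0.
have i0 : 0 < s^-1 by rewrite invr_gt0.
have chs : ch / s <= 1 + s^-1.
  have : ch <= 1 + s by rewrite -(@ler_pXn2r _ 2)// ?nnegrE; nra.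
  by rewrite ler_pdivrMr// (_ : (1 + s^-1) * s = 1 + s)//; field; rewrite gt_eqF.
have CS1 : (C * S) ^+ 2 <= 1 by have := sqr_ge0 C; have := sqr_ge0 S; nra.
have r0 : 0 <= r by exact: sqrtr_ge0.
have u2 : 0 <= u ^+ 2 + v ^+ 2 by rewrite addr_ge0// sqr_ge0.
have r2 : r ^+ 2 = u ^+ 2 + v ^+ 2 by rewrite sqr_sqrtr.
set X := u * C * S / (r * D); set Y := v * C * S / (r * D); set Z := s * ch / D.
have Z0 : 0 < Z by rewrite divr_gt0// mulr_gt0.
have XY : X ^+ 2 + Y ^+ 2 <= (C * S / D) ^+ 2.
  have [r00|rn0] := eqVneq r 0.
    by rewrite /X /Y r00 !mul0r invr0 !mulr0 expr0n addr0 sqr_ge0.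
  have -> // : X ^+ 2 + Y ^+ 2 = (C * S / D) ^+ 2.
  transitivity ((u ^+ 2 + v ^+ 2) / r ^+ 2 * (C * S / D) ^+ 2).
    by rewrite /X /Y; field; rewrite rn0 gt_eqF.
  by rewrite -r2 divff ?mul1r// expf_neq0.
have tZ : s / ch <= Z.
  rewrite -subr_ge0 (_ : _ - _ = s * (ch ^+ 2 - D) / (D * ch)).
    by rewrite divr_ge0 ?mulr_ge0 ?subr_ge0 ?(ltW s0) ?(ltW c0) ?(ltW D0).
  by rewrite /Z; field; rewrite !gt_eqF.
have Zs : Z <= 1 + s^-1.
  apply: le_trans chs; rewrite -subr_ge0.
  rewrite (_ : _ - _ = ch * (D - s ^+ 2) / (D * s)).
    by rewrite divr_ge0 ?mulr_ge0 ?subr_ge0 ?(ltW s0) ?(ltW c0) ?(ltW D0).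
  by rewrite /Z; field; rewrite !gt_eqF.
have e2 : X ^+ 2 + Y ^+ 2 + Z ^+ 2 <= ch ^+ 2 / D.
  apply: le_trans (lerD XY (lexx _)) _.
  have -> : (C * S / D) ^+ 2 + Z ^+ 2 = ((C * S) ^+ 2 + (s * ch) ^+ 2) / D ^+ 2.
    by rewrite /Z; field; rewrite gt_eqF.
  rewrite ler_pdivrMr ?exprn_gt0//.
  have -> : ch ^+ 2 / D * D ^+ 2 = ch ^+ 2 * D by field; rewrite gt_eqF.
  rewrite !exprMn ch2 /D; have -> : S ^+ 2 = 1 - C ^+ 2 by lra.
  by have := sqr_ge0 (C ^+ 2); nra.
case: ifP => _; last first.
  move=> [<-] /=; split=> //.
  have b (w : R) : w ^+ 2 <= (C * S / D) ^+ 2 -> `|w| <= s^-1 ^+ 2 + 1 + s^-1.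
    move=> wb; apply: (@le_trans _ _ (s^-1 ^+ 2)); last by lra.
    have : w ^+ 2 <= (s^-1 ^+ 2) ^+ 2.
      apply: (le_trans wb); rewrite expr_div_n ler_pdivrMr ?exprn_gt0//.
      apply: (le_trans CS1); rewrite -exprMn; apply: exprn_ege1.
      by rewrite exprVn mulrC ler_pdivlMr ?exprn_gt0// mul1r.
    by rewrite -(real_normK (num_real w)) ler_sqr ?nnegrE// sqr_ge0.
  have bX : `|X| <= s^-1 ^+ 2 + 1 + s^-1 by apply: b; have := sqr_ge0 Y; lra.
  have bY : `|Y| <= s^-1 ^+ 2 + 1 + s^-1 by apply: b; have := sqr_ge0 X; lra.
  by rewrite !prod_normE/= !ge_max bX bY gtr0_norm//=; have := sqr_ge0 (s^-1); lra.
rewrite /inversion; case: ifP => // _ [<-] /=.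
rewrite /enorm sqr_sqrtr ?addr_ge0 ?sqr_ge0//.
set E := _ + Z ^+ 2 in e2 *.
have ZE : Z ^+ 2 <= E by rewrite lerDr addr_ge0// sqr_ge0.
have E0 : 0 < E by rewrite (lt_le_trans _ ZE)// exprn_gt0.
split.
  rewrite ler_pdivlMr//; apply: (@le_trans _ _ (s / ch * (ch ^+ 2 / D))).
    by rewrite ler_wpM2l// divr_ge0// ltW.
  by rewrite le_eqVlt; apply/orP; left; apply/eqP; rewrite /Z; field; rewrite !gt_eqF.
have b (w : R) : w ^+ 2 <= E -> `|w / E| <= s^-1 ^+ 2 + 1 + s^-1.
  move=> wE; apply: (@le_trans _ _ (ch / s)); last by have := sqr_ge0 (s^-1); lra.
  have h : (w / E) ^+ 2 <= (ch / s) ^+ 2.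
    apply: (@le_trans _ _ E^-1).
      by rewrite expr_div_n expr2 invfM mulrA ler_pdivrMr// mulVf ?gt_eqF// ler_pdivrMr// mul1r.
    have k : 1 <= (ch / s * Z) ^+ 2.
      by apply: exprn_ege1; rewrite mulrAC ler_pdivlMr// mul1r mulrC -ler_pdivrMr.
    rewrite -[leLHS]mul1r ler_pdivrMr// (le_trans k)// exprMn.
    by rewrite ler_wpM2l// sqr_ge0.
  rewrite -(@ler_pXn2r _ 2) ?nnegrE ?divr_ge0 ?(ltW s0) ?(ltW c0)//.
  by rewrite real_normK// num_real.
have X0 := sqr_ge0 X; have Y0 := sqr_ge0 Y; have Z2 := sqr_ge0 Z.
by rewrite !prod_normE/= !ge_max !b// /E; lra.
Qed.

(** The height cannot tend to 0, since a low height is raised at each step by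
    at least the real map lam * tanh, for which 0 is repelling; but at heights
    that are bounded below the map is bounded. *)
Lemma upper_not_escaping lam x y z : 1 < lam -> 0 < z ->
  ~ escapes (Tl lam) (x, y, z).
Proof.
move=> l1 z0 [u [u0 uS uoo]].
pose c := Num.min z (Num.min (lam - 1) 1).
have c0 : 0 < c by rewrite !lt_min z0 ltr01 subr_gt0 l1.
have cz : c <= z by rewrite ge_min lexx.
have cl : c <= lam - 1 by rewrite !ge_min lexx orbT.
have c1 : c <= 1 by rewrite !ge_min lexx !orbT.
have lc : c <= lam * (sinh c / cosh c).
  rewrite mulrA ler_pdivlMr ?cosh_gt0// /sinh /cosh.
  have h1 := expR_ge1Dx c; have h2 := expRxMexpNx_1 c.
  move: (expR c) (expR (- c)) h1 h2 => a b h1 h2.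
  have a0 : 0 < a by lra.
  suff : 0 <= a * (lam * (a - b) - c * (a + b)) by rewrite pmulr_rge0//; lra.
  have -> : a * (lam * (a - b) - c * (a + b)) = a ^+ 2 * (lam - c) - (a * b) * (lam + c) by ring.
  rewrite h2 mul1r.
  have h3 : (1 + c) ^+ 2 <= a ^+ 2 by rewrite ler_sqr ?nnegrE//; lra.
  have h4 : (1 + c) ^+ 2 * (lam - c) <= a ^+ 2 * (lam - c).
    by apply: ler_wpM2r => //; lra.
  have : 0 <= c * (2 * (lam - 1) - 2 * c + c * lam - c ^+ 2).
    by apply: mulr_ge0; [exact: ltW|nra].
  lra.
have step k q : Tl lam (u k) = Some q -> c <= (u k).2 ->
    c <= q.2 /\ `|q| <= lam * ((sinh c)^-1 ^+ 2 + 1 + (sinh c)^-1).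
  rewrite TlE; case E: (T (u k)) => [q'|]//= [<-] cu.
  have [h1 h2] := T_upper _ _ E (lt_le_trans c0 cu); split.
    apply: (le_trans lc); rewrite ler_pM2l; last lra.
    exact: (le_trans (le_tanh _ _ cu)).
  have -> : `|scale3 lam q'| = lam * `|q'|.
    have l0 : 0 <= lam by lra.
    by rewrite /scale3 !prod_normE/= !normrM (ger0_norm l0) !maxr_pMr.
  rewrite ler_pM2l; last lra.
  apply: (le_trans h2).
  have si : (sinh (u k).2)^-1 <= (sinh c)^-1.
    rewrite lef_pV2 ?posrE ?sinh_gt0//; first exact: le_sinh.
    exact: lt_le_trans cu.
  rewrite !lerD// ler_sqr ?nnegrE// invr_ge0 ltW// sinh_gt0//.
  exact: lt_le_trans cu.
have hc k : c <= (u k).2.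
  by elim: k => [|k IH]; [rewrite u0|case: (step k _ (uS k) IH)].
have [N _ hN] := uoo (lam * ((sinh c)^-1 ^+ 2 + 1 + (sinh c)^-1)).
have := hN N.+1; rewrite /= leqnSn => /(_ isT).
by rewrite ltNge => /negP; apply; case: (step N _ (uS N) (hc N)).
Qed.

Lemma escaping_planar lam (p : R * R * R) : 1 < lam -> escapes (Tl lam) p -> p.2 = 0.
Proof.
case: p => [[x y] z] l1 e /=; apply/eqP; rewrite eq_le; apply/andP; split.
  by rewrite leNgt; apply/negP => z0; exact: upper_not_escaping e.
rewrite leNgt; apply/negP => z0.
have := escapes_neg_z _ _ e; apply: upper_not_escaping => //.
by rewrite oppr_gt0.
Qed.

End OffPlane.

(** * An attracting sector below the critical value *)

Section Cone.
Context {R : realType}.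
Implicit Types (x y lam : R).

(** If lam < sqrt 2 the rays near the diagonal are attracted to the origin:
    on the ray of slope t the map multiplies the radius by about
    lam / sqrt (1 + t ^ 2). The slope lam ^ 2 / 2 makes this factor < 1, since
    lam ^ 2 < 1 + lam ^ 4 / 4. *)
Lemma attracting_cone lam : 0 < lam -> lam ^+ 2 < 2 ->
  exists2 m : R, 0 < m & forall x y, 0 < x < m -> 0 < y < m ->
    lam ^+ 2 / 2 * x < y -> lam ^+ 2 / 2 * y < x -> ~ escapes (Tl lam) (x, y, 0).
Proof.
move=> l0 l2; have p0 := pi_gt0 R.
pose t := lam ^+ 2 / 2; pose s := Num.sqrt (1 + t ^+ 2).
have t0 : 0 < t by rewrite divr_gt0// exprn_gt0.
have t1 : t < 1 by rewrite /t; lra.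
have s0 : 0 < s by rewrite sqrtr_gt0 ltr_pwDl// sqr_ge0.
have s2 : s ^+ 2 = 1 + t ^+ 2 by rewrite sqr_sqrtr// addr_ge0// sqr_ge0.
have sl : lam < s.
  rewrite -(@ltr_pXn2r _ 2)// ?nnegrE ?ltW// s2.
  have : 0 < (1 - t) ^+ 2 by rewrite exprn_gt0// subr_gt0.
  by rewrite /t; nra.
pose e := Num.sqrt (s / lam - 1).
have e0 : 0 < e by rewrite sqrtr_gt0 subr_gt0 ltr_pdivlMr// mul1r.
have e2 : e ^+ 2 = s / lam - 1.
  by rewrite sqr_sqrtr// subr_ge0 ler_pdivlMr// mul1r ltW.
pose m := Num.min (pi / 4) (atan e).
have m0 : 0 < m by rewrite lt_min divr_gt0//= -atan0 lt_atan.
exists m => // x y xm ym txy tyx [u [u0 uS uoo]].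
pose inv (p : R * R * R) := [/\ 0 < p.1.1 < m, 0 < p.1.2 < m,
  t * p.1.1 < p.1.2 /\ t * p.1.2 < p.1.1 & p.2 = 0].
have step p q : inv p -> Tl lam p = Some q -> inv q.
  case: p => [[a b] z] [/= /andP[a0 am] /andP[b0 bm] [tab tba] ->].
  have mp : m <= pi / 4 by rewrite ge_min lexx.
  have ap : a <= pi / 4 by rewrite ltW// (lt_le_trans am).
  have bp : b <= pi / 4 by rewrite ltW// (lt_le_trans bm).
  rewrite Tl_quarter; last by split=> /=; apply/andP; split => //; lra.
  rewrite /planar_map /= !half_fold_lo// /amplitude.
  set M := Num.max a b; have -> : Num.min M (pi / 2 - Num.min a b) = M.
    by rewrite min_l// /M /Num.max /Num.min; case: ifP; lra.
  have M0 : 0 < M by rewrite lt_max a0.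
  have Mm : M < m by rewrite gt_max am bm.
  have tM : tan M <= M * (s / lam).
    have := tan_secant_le 0 M; rewrite tan0 !subr0 lexx (ltW M0).
    move=> /(_ isT)/(_ _)/le_trans; apply; first by lra.
    rewrite ler_pM2l//; have -> : s / lam = 1 + e ^+ 2 by rewrite e2; lra.
    rewrite lerD2l ler_sqr ?nnegrE ?(ltW e0)//; last first.
      by rewrite tan_ge0// (ltW M0)/=; lra.
    rewrite -(atanK e) tan_monoW ?(ltW M0) ?atan_ltpi2//=.
    by rewrite (le_trans (ltW Mm))// ge_min lexx orbT.
  have Mab : M = a \/ M = b by rewrite /M /Num.max; case: ifP; [right|left].
  have rM : s * M <= Num.sqrt (a ^+ 2 + b ^+ 2).
    rewrite -(@ler_pXn2r _ 2)// ?nnegrE ?sqrtr_ge0 ?mulr_ge0 ?(ltW s0) ?(ltW M0)//.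
    rewrite sqr_sqrtr ?addr_ge0 ?sqr_ge0// exprMn s2 mulrDl mul1r -exprMn.
    have h (a' b' : R) : 0 < a' -> t * a' < b' -> (t * a') ^+ 2 <= b' ^+ 2.
      move=> a'0 hab; have ta : 0 <= t * a' by rewrite mulr_ge0 ?(ltW t0) ?(ltW a'0).
      by rewrite ler_sqr ?nnegrE ?(le_trans ta) ?(ltW hab).
    by case: Mab => ->; [|rewrite [leRHS]addrC]; rewrite lerD2l h.
  set r := Num.sqrt _ in rM *.
  have r0 : 0 < r by rewrite (lt_le_trans _ rM)// mulr_gt0.
  have A1 : lam * tan M / r <= 1.
    rewrite ler_pdivrMr// mul1r; apply: (le_trans _ rM).
    apply: (@le_trans _ _ (lam * (M * (s / lam)))); first by rewrite ler_pM2l.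
    by rewrite le_eqVlt; apply/orP; left; apply/eqP; field; rewrite gt_eqF.
  have A0 : 0 < lam * tan M / r.
    by rewrite divr_gt0// mulr_gt0// tan_gt0// M0/=; lra.
  move: (lam * tan M / r) A0 A1 => A A0 A1 [<-]; split => //=.
  - by rewrite mulr_gt0//= (le_lt_trans _ am)// ler_piMl// ltW.
  - by rewrite mulr_gt0//= (le_lt_trans _ bm)// ler_piMl// ltW.
  - by split; rewrite mulrCA ltr_pM2l.
have hinv k : inv (u k).
  by elim: k => [|k IH]; [rewrite u0; split|apply: step IH (uS k)].
have [N _ hN] := uoo m; have := hN N (leqnn N); rewrite /= ltNge => /negP; apply.
have [h1 h2 _ h3] := hinv N; move: h1 h2 h3.
case: (u N) => [[a b] z] /= /andP[a0 am] /andP[b0 bm] ->.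
by rewrite !prod_normE/= normr0 !ge_max !gtr0_norm// !ltW.
Qed.

Lemma closure_neq_plane lam : 0 < lam -> lam ^+ 2 < 2 ->
  closure (escaping_set (Tl lam)) <>
  [set (x, y, 0) | x in [set: R] & y in [set: R]].
Proof.
move=> l0 l2 E; have [m m0 hm] := attracting_cone _ l0 l2.
pose t := lam ^+ 2 / 2; pose a := m / 2.
have a0 : 0 < a by rewrite divr_gt0.
have : closure (escaping_set (Tl lam)) (a, a, 0) by rewrite E; exists a => //; exists a.
pose e := Num.min (m / 4) ((1 - t) * a / 4).
have t0 : 0 < t by rewrite divr_gt0// exprn_gt0.
have t1 : t < 1 by rewrite /t; lra.
have e0 : 0 < e by rewrite lt_min; apply/andP; split; [lra|rewrite divr_gt0// mulr_gt0//; lra].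
move=> /(_ (ball (a, a, 0) e) (nbhsx_ballx _ _ e0)) [[[x y] z] [esc]].
have : [set (x, y, 0) | x in [set: R] & y in [set: R]] (x, y, z).
  by rewrite -E; exact: subset_closure.
move=> [x' _ [y' _ [_ _ z0]]]; rewrite -z0 in esc.
rewrite -ball_normE/= !prod_normE/= !gt_max => /andP[/andP[]].
have em : e <= m / 4 by rewrite ge_min lexx.
have et : e <= (1 - t) * a / 4 by rewrite ge_min lexx orbT.
rewrite !ltr_norml => /andP[x1 x2] /andP[y1 y2] _.
move: esc; rewrite escaping_setE; apply: hm.
- by apply/andP; split; rewrite /a in x1 x2 *; lra.
- by apply/andP; split; rewrite /a in y1 y2 *; lra.
- rewrite -/t; nra.
- rewrite -/t; nra.
Qed.

End Cone.

(** * Rays, and the gaps of the escaping set *)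

Section PlanarMap.
Context {R : realType} (lam : R).
Implicit Types (x y u v t : R).

Lemma half_foldC x : half_fold (pi / 2 - x) = half_fold x.
Proof. by rewrite /half_fold minC; congr Num.min; lra. Qed.

Lemma amplitude_center x y : amplitude (pi / 2 - x) (pi / 2 - y) = amplitude x y.
Proof.
rewrite /amplitude minC; congr Num.min.
  by rewrite /Num.max /Num.min; case: ifP; case: ifP; lra.
by rewrite /Num.max /Num.min; case: ifP; case: ifP; lra.
Qed.

(** The larger of the two distances is determined by the length of the image;
    this makes the map invertible up to finitely many choices. *)
Lemma half_fold_amplitude x y :
  half_fold (amplitude x y) = Num.max (half_fold x) (half_fold y).
Proof.
have le (u v : R) : u <= v <= pi / 2 - u -> half_fold u <= half_fold v.
  move=> /andP[uv vu]; rewrite /half_fold le_min !ge_min uv/=.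
  by have -> : u <= pi / 2 - v by lra.
rewrite /amplitude; have [xy|/ltW xy] := leP x y.
  have [h|/ltW h] := leP y (pi / 2 - x).
    by rewrite max_r// le// xy.
  by rewrite half_foldC max_l// -(half_foldC y) le//; apply/andP; split; lra.
have [h|/ltW h] := leP x (pi / 2 - y).
  by rewrite max_l// le// xy.
by rewrite half_foldC max_r// -(half_foldC x) le//; apply/andP; split; lra.
Qed.

Lemma planar_map_center x y : planar_map lam (pi / 2 - x, pi / 2 - y) = planar_map lam (x, y).
Proof. by rewrite /planar_map /= !half_foldC amplitude_center. Qed.

Lemma planar_map_swap x y : planar_map lam (y, x) = ((planar_map lam (x, y)).2, (planar_map lam (x, y)).1).
Proof. by rewrite /planar_map /= /amplitude maxC [Num.min y x]minC [_ ^+ 2 + _]addrC. Qed.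

(** On the ray of slope t the map is ray_scale t * tan, or its analogue with the
    inverse of tan. *)
Definition ray_scale t := lam / Num.sqrt (1 + t ^+ 2).

Lemma sqrt_slope u t : 0 < u ->
  Num.sqrt (u ^+ 2 + (t * u) ^+ 2) = Num.sqrt (1 + t ^+ 2) * u.
Proof.
move=> u0; rewrite exprMn -{1}[u ^+ 2]mul1r -mulrDl sqrtrM ?addr_ge0 ?sqr_ge0//.
by rewrite sqrtr_sqr gtr0_norm.
Qed.

Lemma sqrt1_gt0 t : 0 < Num.sqrt (1 + t ^+ 2).
Proof. by rewrite sqrtr_gt0 ltr_pwDl// sqr_ge0. Qed.

Lemma ray_scale_sq t : ray_scale t ^+ 2 * (1 + t ^+ 2) = lam ^+ 2.
Proof.
have s0 := sqrt1_gt0 t.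
rewrite /ray_scale expr_div_n sqr_sqrtr ?addr_ge0 ?sqr_ge0// divfK// gt_eqF//.
by rewrite ltr_pwDl// sqr_ge0.
Qed.

(** Both images stay on the ray of slope t: the direction is that of the
    distances to the nearest sides. *)
Lemma planar_map_even x t : 0 < x <= pi / 4 -> 0 < t <= 1 ->
  planar_map lam (x, t * x) = (ray_scale t * tan x, t * (ray_scale t * tan x)).
Proof.
move=> /andP[x0 xp] /andP[t0 t1].
have tx : t * x <= x by rewrite ler_piMl// ltW.
have tx0 : 0 < t * x by rewrite mulr_gt0.
rewrite /planar_map /= !half_fold_lo ?(le_trans tx)// /amplitude (max_l tx) (min_r tx).
have h1 : x <= pi / 2 - t * x by lra.
rewrite (min_l h1).
rewrite sqrt_slope// /ray_scale; have s0 := sqrt1_gt0 t.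
by congr (_, _); field; rewrite !gt_eqF.
Qed.

Lemma planar_map_odd u t : 0 < u <= pi / 4 -> 0 < t <= 1 ->
  planar_map lam (pi / 2 - u, t * u) = (ray_scale t / tan u, t * (ray_scale t / tan u)).
Proof.
move=> /andP[u0 up] /andP[t0 t1].
have tu : t * u <= u by rewrite ler_piMl// ltW.
have tu0 : 0 < t * u by rewrite mulr_gt0.
rewrite /planar_map /= half_foldC !half_fold_lo ?(le_trans tu)// /amplitude.
have h1 : t * u <= pi / 2 - u by lra.
have h2 : pi / 2 - u <= pi / 2 - t * u by lra.
rewrite (max_l h1) (min_r h1) (min_l h2).
rewrite tan_pihalfB_itv; last by rewrite u0/=; lra.
have tn : tan u != 0 by rewrite gt_eqF// tan_gt0// u0/=; lra.
rewrite sqrt_slope// /ray_scale; have s0 := sqrt1_gt0 t.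
by congr (_, _); field; rewrite tn !gt_eqF.
Qed.

End PlanarMap.

(** The complement of the closure of the escaping set in the plane has these
    properties, which force it to be empty when lam > sqrt 2. *)
Record gap {R : realType} (lam : R) (W : set (R * R)) : Prop := Gap {
  gap_open : open W;
  gap_swap : forall x y, W (x, y) -> W (y, x);
  gap_neg : forall x y, W (x, y) -> W (- x, y);
  gap_shift : forall x y, W (x, y) -> W (x + pi, y);
  gap_axis : forall y, ~ W (0, y);
  gap_wall : forall y, ~ W (pi / 2, y);
  gap_map : forall p, quarter p -> W p <-> W (planar_map lam p) }.

Section Gap.
Context {R : realType} (lam : R) (W : set (R * R)) (gW : gap lam W).
Implicit Types (x y s t : R) (k l : int).

(** The motion of the line that takes [k pi/2, (k+1) pi/2] to [0, pi/2] and
    preserves the lattice pi Z up to sign. *)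
Definition unfold k x : R :=
  if odd `|k|%N then (k + 1)%:~R * (pi / 2) - x else x - k%:~R * (pi / 2).

Lemma gap_shift_int k x y : W (x, y) -> W (x + k%:~R * pi, y).
Proof.
have step n z : W (z, y) -> W (z + n%:R * pi, y).
  move=> h; elim: n => [|n IH]; first by rewrite mul0r addr0.
  by rewrite -natr1 mulrDl mul1r addrA; exact: (gap_shift _ _ gW).
case: k => n h; first exact: step.
have -> : x + (Negz n)%:~R * pi = - (- x + n.+1%:R * pi).
  by rewrite NegzE mulrNz mulNr opprD opprK.
by apply: (gap_neg _ _ gW); apply: step; apply: (gap_neg _ _ gW).
Qed.

Lemma unfoldK k x : unfold k x =
  if odd `|k|%N then - (x + (- ((k + 1) %/ 2)%Z)%:~R * pi)
  else x + (- (k %/ 2)%Z)%:~R * pi.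
Proof.
rewrite /unfold; case: ifP => o.
  have e : k + 1 = ((k + 1) %/ 2)%Z * 2 by lia.
  by rewrite {1}e intrM intrN; field.
have e : k = (k %/ 2)%Z * 2 by lia.
by rewrite {1}e intrM intrN; field.
Qed.

(** By unfoldK the motion is a translation by a multiple of pi, followed by a
    reflection if k is odd. *)
Lemma gap_unfold_x k x y : W (x, y) <-> W (unfold k x, y).
Proof.
have neg z : W (- z, y) <-> W (z, y).
  by split=> /(gap_neg _ _ gW); rewrite ?opprK.
have shift n z : W (z + n%:~R * pi, y) <-> W (z, y).
  split=> [/(gap_shift_int (- n))|]; last exact: gap_shift_int.
  by rewrite intrN mulNr addrK.
by rewrite unfoldK; case: ifP => _; rewrite ?neg shift.
Qed.

Lemma gap_unfold_y k x y : W (x, y) <-> W (x, unfold k y).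
Proof.
split=> /(gap_swap _ _ gW) h; apply: (gap_swap _ _ gW).
  exact: (gap_unfold_x k y x).1.
exact: (gap_unfold_x k y x).2.
Qed.

Lemma gap_lattice_x k y : ~ W (k%:~R * (pi / 2), y).
Proof.
move=> /(gap_unfold_x k); rewrite /unfold; case: ifP => _.
  have -> : (k + 1)%:~R * (pi / 2) - k%:~R * (pi / 2) = pi / 2 :> R.
    by rewrite intrD; ring.
  exact: (gap_wall _ _ gW).
by rewrite subrr; exact: (gap_axis _ _ gW).
Qed.

Lemma gap_lattice_y k x : ~ W (x, k%:~R * (pi / 2)).
Proof. by move=> /(gap_swap _ _ gW); exact: gap_lattice_x. Qed.

Lemma unfold_itv k x : k%:~R * (pi / 2) < x < (k + 1)%:~R * (pi / 2) ->
  0 < unfold k x < pi / 2.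
Proof.
rewrite intrD => /andP[x1 x2]; rewrite /unfold; case: ifP => _.
  by rewrite intrD; apply/andP; split; lra.
by apply/andP; split; lra.
Qed.

Lemma gap_center x y : quarter (x, y) -> W (x, y) <-> W (pi / 2 - x, pi / 2 - y).
Proof.
move=> q; have q' : quarter (pi / 2 - x, pi / 2 - y).
  by move: q => [/= /andP[? ?] /andP[? ?]]; split=> /=; apply/andP; split; lra.
by rewrite (gap_map _ _ gW _ q) (gap_map _ _ gW _ q') planar_map_center.
Qed.

End Gap.

(** * Gaps on the diagonal *)

Section SecondImage.
Context {R : realType}.
Implicit Types (eta a : R).

(** The tangent has slope at least 1 + tan^2 a on [a, pi/4], and at least
    K = 1 + tan^2 (pi/2 - eta) beyond pi/2 - eta, so the left side would be at
    most 2 (pi/4 - a) only if eta^2 (1 + tan^2 a) K <= 2. But 1 / K is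
    sin^2 eta <= (1 + 2 eta - pi/2) / 2, and (eta * tan a)^2 >= (pi/4)^2. So
    (eta - 1)^2 <= 2 - pi/2 - (pi/4)^2, which is negative. *)
Lemma second_image_long eta a : 1 < eta < pi / 2 -> 0 <= a < pi / 4 ->
  pi / 2 - a <= eta * tan a -> eta * tan a < eta ->
  pi / 2 - 2 * a < eta * tan (pi / 2 - eta * tan a) - eta * tan (pi / 2 - eta).
Proof.
move=> /andP[e1 epi] /andP[a0 apq]; set g := eta * tan a => gpa ge.
have p3 := pi_ge3 (R := R); have e0 : 0 < eta by lra.
rewrite ltNge; apply/negP => h4.
have thg : pi / 2 - g < pi / 2 by lra.
have th0 : 0 <= pi / 2 - eta <= pi / 2 - g by apply/andP; split; lra.
have h3 := tan_secant_ge _ _ th0 thg.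
have a0p : 0 <= a <= pi / 4 by rewrite a0 ltW.
have p42 : pi / 4 < pi / 2 :> R by lra.
have := tan_secant_ge a (pi / 4) a0p p42; rewrite tan_piquarter => h1.
have cth : 0 < cos (pi / 2 - eta) by apply: cos_pos; apply/andP; split; lra.
have secE := cos2_tan2 (lt0r_neq0 cth).
have e2q : sin (2 * eta - pi / 2) <= 2 * eta - pi / 2.
  by apply: sin_le_id; apply/andP; split; lra.
have c2 : 2 * cos (pi / 2 - eta) ^+ 2 <= 1 + 2 * eta - pi / 2.
  have := cos_mulr2n (pi / 2 - eta).
  have -> : (pi / 2 - eta) *+ 2 = - (2 * eta - pi / 2) + pi / 2 by lra.
  by rewrite cosDpihalf sinN opprK; lra.
have q0 : 0 < pi / 4 - a by lra.
have h12 : g ^+ 2 = eta ^+ 2 * tan a ^+ 2 by rewrite /g exprMn.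
have h7 : eta * ((pi / 4 - a) * (1 + tan a ^+ 2)) <= eta - g.
  by rewrite /g -{2}[eta]mulr1 -mulrBr ler_pM2l.
have gq : pi / 4 <= g by lra.
have p34 : 3 / 4 <= pi / 4 :> R by lra.
move: (tan a) h1 h7 h12 => ta h1 h7 h12.
move: h3 secE h4 th0 thg; set T1 := tan (pi / 2 - eta); set T2 := tan (pi / 2 - g).
set K := 1 + T1 ^+ 2 => h3 secE h4 th0 thg.
move: cth c2 secE; set C := cos _ => cth c2 secE.
have C0 : 0 < C ^+ 2 by rewrite exprn_gt0.
have K0 : 0 < K by rewrite -secE invr_gt0.
have KC : K * C ^+ 2 = 1 by rewrite -secE mulVf// gt_eqF.
have h6 : eta * ((eta - g) * K) <= 2 * (pi / 4 - a).
  apply: (@le_trans _ _ (eta * (T2 - T1))); last lra.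
  rewrite ler_pM2l//; apply: le_trans h3.
  by have -> : pi / 2 - g - (pi / 2 - eta) = eta - g by ring.
have h8 : eta * (eta * ((pi / 4 - a) * (1 + ta ^+ 2)) * K) <= 2 * (pi / 4 - a).
  by apply: le_trans h6; rewrite ler_pM2l// ler_pM2r.
have h9 : eta ^+ 2 * (1 + ta ^+ 2) * K <= 2.
  by rewrite -(ler_pM2l q0); clear -h8; lra.
have h10 : eta ^+ 2 * (1 + ta ^+ 2) <= 2 * C ^+ 2.
  have -> : eta ^+ 2 * (1 + ta ^+ 2) = eta ^+ 2 * (1 + ta ^+ 2) * K * C ^+ 2.
    by rewrite -mulrA KC mulr1.
  by rewrite ler_pM2r.
have h11 : (pi / 4) ^+ 2 <= g ^+ 2 by rewrite ler_sqr ?nnegrE//; clear -gq p34; lra.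
have h13 := sqr_ge0 (eta - 1).
have h14 : (3 / 4) ^+ 2 <= (pi / 4 : R) ^+ 2 by rewrite ler_sqr ?nnegrE//; clear -p34; lra.
clear -c2 h10 h11 h12 h13 h14 p3; lra.
Qed.

End SecondImage.

Section Diagonal.
Context {R : realType} (lam : R) (W : set (R * R)) (gW : gap lam W).
Context (lam2 : Num.sqrt 2 < lam).
Implicit Types (x y s t a b : R) (k l : int).

Let eta := lam / Num.sqrt 2.

Lemma eta_gt1 : 1 < eta.
Proof. by rewrite /eta ltr_pdivlMr ?mul1r// sqrtr_gt0. Qed.

Lemma ray_scale_diag : ray_scale lam 1 = eta.
Proof. by rewrite /ray_scale expr1n. Qed.

Definition diag_gap a b := forall s, a < s < b -> W (s, s).

Lemma diag_map s : 0 < s <= pi / 4 -> W (s, s) <-> W (eta * tan s, eta * tan s).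
Proof.
move=> sp; have p0 := pi_gt0 R.
have q : quarter (s, s) by case/andP: sp => s0 sp; split=> /=; apply/andP; split; lra.
rewrite (gap_map _ _ gW _ q); have := planar_map_even lam s 1 sp.
by rewrite ltr01 lexx mul1r ray_scale_diag mul1r => /(_ isT) ->.
Qed.

Lemma diag_center s : 0 < s < pi / 2 -> W (s, s) <-> W (pi / 2 - s, pi / 2 - s).
Proof. by move=> sp; apply: (gap_center _ _ gW). Qed.

Lemma diag_gap_center a b : 0 <= a -> b <= pi / 2 ->
  diag_gap a b -> diag_gap (pi / 2 - b) (pi / 2 - a).
Proof.
move=> a0 bp h s /andP[s1 s2]; apply/diag_center; first by apply/andP; split; lra.
by apply: h; apply/andP; split; lra.
Qed.

(** The points (k pi/2, k pi/2) are not in the gap, so an interval lies between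
    two of them. *)
Lemma diag_gap_fold a b : a < b -> diag_gap a b -> exists a' b',
  [/\ 0 <= a', b' <= pi / 2, b' - a' = b - a & diag_gap a' b'].
Proof.
move=> ab h; have p0 : 0 < pi / 2 :> R by rewrite divr_gt0// pi_gt0.
pose k := Num.floor (a / (pi / 2)).
have /andP[k1 k2] : k%:~R <= a / (pi / 2) < (k + 1)%:~R by exact: floor_itv.
rewrite ler_pdivlMr// in k1; rewrite ltr_pdivrMr// in k2.
have bk : b <= (k + 1)%:~R * (pi / 2).
  rewrite leNgt; apply/negP => kb.
  by apply: (gap_lattice_x _ _ gW (k + 1) ((k + 1)%:~R * (pi / 2))); apply: h; rewrite k2.
have hu s : a < s < b -> W (unfold k s, unfold k s).
  by move=> /h; rewrite (gap_unfold_x _ _ gW k) (gap_unfold_y _ _ gW k).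
rewrite intrD in bk k2; case o : (odd `|k|%N).
  exists ((k + 1)%:~R * (pi / 2) - b), ((k + 1)%:~R * (pi / 2) - a).
  rewrite intrD; split; [lra|lra|lra|] => s /andP[s1 s2].
  have := hu ((k + 1)%:~R * (pi / 2) - s); rewrite /unfold o subKr; apply.
  by rewrite intrD; apply/andP; split; lra.
exists (a - k%:~R * (pi / 2)), (b - k%:~R * (pi / 2)).
split; [lra|lra|lra|] => s /andP[s1 s2].
have := hu (s + k%:~R * (pi / 2)); rewrite /unfold o addrK; apply.
by apply/andP; split; lra.
Qed.

(** The map is increasing on [0, pi/4], so every point of the image interval is
    the image of a point of the interval. *)
Lemma diag_gap_image a b : 0 <= a < b -> b <= pi / 4 ->
  diag_gap a b -> diag_gap (eta * tan a) (eta * tan b).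
Proof.
move=> /andP[a0 ab] bp h s /andP[s1 s2]; have p0 := pi_gt0 R; have e1 := eta_gt1.
have e0 : 0 < eta by lra.
have ta : 0 <= tan a by apply: tan_ge0; apply/andP; split; lra.
pose r := atan (s / eta).
have rE : eta * tan r = s by rewrite atanK mulrC divfK// gt_eqF.
have rp : r < pi / 2 by exact: atan_ltpi2.
have s0 : 0 < s / eta by rewrite divr_gt0// (le_lt_trans _ s1)// mulr_ge0// ltW.
have r0 : 0 < r by rewrite /r -atan0 lt_atan.
have ar : a < r.
  rewrite ltNge; apply/negP => ra.
  have : tan r <= tan a by apply: tan_monoW; [rewrite (ltW r0)|lra].
  by rewrite -(ler_pM2l e0) rE leNgt s1.
have rb : r < b.
  rewrite ltNge; apply/negP => br.
  have : tan b <= tan r by apply: tan_monoW => //; apply/andP; split; lra.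
  by rewrite -(ler_pM2l e0) rE leNgt s2.
by rewrite -rE -diag_map; [apply: h; rewrite ar|apply/andP; split; lra].
Qed.

Lemma diag_gap_grow a b : 0 <= a < b -> b <= pi / 4 -> diag_gap a b ->
  exists a' b', [/\ 0 <= a', b' <= pi / 2, eta * (b - a) <= b' - a' & diag_gap a' b'].
Proof.
move=> a0b bp h; have := diag_gap_image _ _ a0b bp h.
case/andP: a0b => a0 ab; have p0 := pi_gt0 R; have e1 := eta_gt1.
have bp2 : b < pi / 2 by lra.
have := tan_secant_ge a b; rewrite a0 (ltW ab) => /(_ isT bp2) => h1.
have h2 : (b - a) <= tan b - tan a.
  by apply: le_trans h1; rewrite ler_peMr ?subr_ge0 ?(ltW ab)// lerDl sqr_ge0.
have h3 : eta * (b - a) <= eta * tan b - eta * tan a.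
  by rewrite -mulrBr ler_pM2l//; lra.
have h4 : 0 < eta * (b - a) by rewrite mulr_gt0 ?subr_gt0//; lra.
move=> /diag_gap_fold[|a' [b' [a'0 b'p e hg]]]; first lra.
by exists a', b'; split => //; rewrite e.
Qed.

(** An interval of the gap that avoids pi/4 is expanded, so none can be longer
    than the longest one around pi/4. *)
Lemma diag_gap_bound c : 0 <= c <= pi / 4 ->
  (forall a, 0 <= a < c -> ~ diag_gap a (pi / 2 - a)) ->
  forall a b, 0 <= a -> b <= pi / 2 -> diag_gap a b -> b - a <= pi / 2 - 2 * c.
Proof.
move=> /andP[c0 cp] hc a b a0 bp hab; have p0 := pi_gt0 R; have e1 := eta_gt1.
rewrite leNgt; apply/negP => L; set d := b - a in L.
have d0 : 0 < d by lra.
have grow n : exists a' b', [/\ 0 <= a', b' <= pi / 2, d * eta ^+ n <= b' - a' & diag_gap a' b'].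
  elim: n => [|n [a' [b' [a'0 b'p hd h]]]]; first by exists a, b; rewrite expr0 mulr1.
  have dn : d <= d * eta ^+ n by rewrite ler_peMr ?(ltW d0)// exprn_ege1// ltW.
  have step u v : 0 <= u -> v <= pi / 4 -> v - u = b' - a' -> diag_gap u v -> exists a' b',
      [/\ 0 <= a', b' <= pi / 2, d * eta ^+ n.+1 <= b' - a' & diag_gap a' b'].
    move=> u0 vp uv huv; have u0v : 0 <= u < v by apply/andP; split; lra.
    have [a2 [b2 [h1 h2 h3 h4]]] := diag_gap_grow _ _ u0v vp huv.
    exists a2, b2; split => //; apply: le_trans h3.
    by rewrite exprS mulrCA uv ler_pM2l//; lra.
  have [bq|bq] := lerP b' (pi / 4); first exact: (step a' b').
  have [aq|aq] := lerP (pi / 4) a'.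
    apply: (step (pi / 2 - b') (pi / 2 - a')); [lra|lra|lra|].
    exact: diag_gap_center.
  exfalso; pose m := Num.min a' (pi / 2 - b').
  have ma : m <= a' by rewrite ge_min lexx.
  have mb : m <= pi / 2 - b' by rewrite ge_min lexx orbT.
  have m0 : 0 <= m by rewrite le_min a'0 subr_ge0.
  have mE : m = a' \/ m = pi / 2 - b' by rewrite /m /Num.min; case: ifP; [left|right].
  apply: (hc m); first by rewrite m0/=; case: mE => ?; lra.
  move=> s /andP[s1 s2].
  have [sa|sa] := lerP s a'.
    by apply/diag_center; [apply/andP; split; lra|apply: h; apply/andP; split; case: mE => ?; lra].
  have [sb|sb] := lerP b' s; last by apply: h; rewrite sa.
  by apply/diag_center; [apply/andP; split; lra|apply: h; apply/andP; split; case: mE => ?; lra].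
have [n hn] := exp_unbounded eta d (pi / 2) e1 d0.
by have [a' [b' [h1 h2 h3 _]]] := grow n; lra.
Qed.

(** The longest gap interval around pi/4 has some end a. If a > 0, then the
    image of this interval lies above pi/2 - a, and its second image would be
    longer than the interval itself. *)
Lemma diag_gap_full s0 : W (s0, s0) -> eta < pi / 2 /\ diag_gap 0 (pi / 2).
Proof.
move=> Ws0; have p0 := pi_gt0 R; have e1 := eta_gt1; have p3 := pi_ge3 (R := R).
have e0 : 0 < eta by lra.
have oD : open [set s | W (s, s)].
  apply: (@open_comp _ _ (fun s : R => (s, s)) W); last exact: (gap_open _ _ gW).
  by move=> s _; apply: continuous_pair; exact: cvg_id.
have around s : W (s, s) -> exists2 e : R, 0 < e & diag_gap (s - e) (s + e).
  move=> Ws; have /nbhs_ballP[e /= e_gt0 he] := open_nbhs_nbhs (conj oD Ws).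
  exists e => // r /andP[r1 r2]; apply: he.
  by rewrite /ball/= ltr_norml; apply/andP; split; lra.
pose A := [set a | 0 <= a <= pi / 4 /\ diag_gap a (pi / 2 - a)].
have Ap : A (pi / 4).
  by split; [apply/andP; split; lra|move=> s /andP[? ?]; exfalso; lra].
have infA : has_inf A by split; [exists (pi / 4)|exists 0 => a [/andP[]]].
pose a := inf A.
have a0 : 0 <= a by apply: lb_le_inf; [exists (pi / 4)|move=> ? [/andP[]]].
have ap : a <= pi / 4 by apply: ge_inf => //; exact: infA.2.
have ha : diag_gap a (pi / 2 - a).
  move=> s /andP[s1 s2]; pose e := Num.min (s - a) (pi / 2 - a - s).
  have e_gt0 : 0 < e by rewrite lt_min !subr_gt0 s1; apply/andP; split; lra.
  have ea : e <= s - a by rewrite ge_min lexx.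
  have eb : e <= pi / 2 - a - s by rewrite ge_min lexx orbT.
  have [a' [_ h] a'e] := inf_adherent e_gt0 infA.
  by apply: h; rewrite -/a in a'e; apply/andP; split; lra.
have hc a' : 0 <= a' < a -> ~ diag_gap a' (pi / 2 - a').
  move=> /andP[h1 h2] h; have : a <= a'; last by lra.
  by apply: ge_inf; [exact: infA.2|split=> //; apply/andP; split; lra].
have a0p : 0 <= a <= pi / 4 by rewrite a0.
have bound := diag_gap_bound _ a0p hc.
have boundR u v : u < v -> diag_gap u v -> v - u <= pi / 2 - 2 * a.
  move=> uv /(diag_gap_fold _ _ uv)[u' [v' [h1 h2 <- h3]]]; exact: bound.
have apq : a < pi / 4.
  have [e e_gt0 he] := around _ Ws0.
  have h : s0 - e < s0 + e by lra.
  by have := boundR _ _ h he; lra.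
have Wc : W (pi / 4, pi / 4) by apply: ha; apply/andP; split; lra.
have We : W (eta, eta).
  move: Wc; rewrite diag_map ?tan_piquarter ?mulr1//.
  by apply/andP; split; lra.
have a_lt : 0 <= a < pi / 4 by rewrite a0.
have im1 : diag_gap (eta * tan a) eta.
  rewrite -[X in diag_gap _ X]mulr1 -(tan_piquarter R); apply: diag_gap_image => // s /andP[s1 s2].
  by apply: ha; apply/andP; split; lra.
have ta0 : 0 <= tan a by apply: tan_ge0; rewrite a0/=; lra.
have ta1 : tan a < 1.
  rewrite -(tan_piquarter R); apply: tan_mono; [by []|lra].
have im1l : eta - eta * tan a <= pi / 2 - 2 * a by apply: boundR => //; nra.
have epi : eta < pi / 2.
  have tc := tan_chord _ a0p.
  have h1 : pi / 4 - a <= (1 - tan a) * (pi / 4) by lra.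
  have h2 : eta * (pi / 4 - a) <= eta * ((1 - tan a) * (pi / 4)).
    by rewrite ler_pM2l.
  have h3 : (eta - eta * tan a) * (pi / 4) <= (pi / 2 - 2 * a) * (pi / 4).
    by rewrite ler_pM2r//; lra.
  have h4 : 0 <= (pi / 2 - eta) * (pi / 4 - a) by lra.
  have h5 : 0 <= pi / 2 - eta by move: h4; rewrite pmulr_lge0//; lra.
  rewrite lt_neqAle; apply/andP; split; last lra.
  by apply/negP => /eqP E; apply: (gap_wall _ _ gW eta); rewrite -{1}E.
split=> //; have [a00|a_gt0] := eqVneq a 0.
  by move: ha; rewrite a00 subr0.
exfalso; have {a_gt0}a_gt0 : 0 < a by rewrite lt_neqAle eq_sym a_gt0.
have nWa : ~ W (a, a).
  move=> /around[e e_gt0 he].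
  have [m [m0 ma me]] : exists m, [/\ 0 <= m, m < a & a - e < m].
    exists (Num.max 0 (a - e / 2)); split; first by rewrite le_max lexx.
      by rewrite gt_max a_gt0; lra.
    by rewrite lt_max; apply/orP; right; lra.
  apply: (hc m); first by rewrite m0.
  move=> s /andP[s1 s2].
  have [sa|sa] := ltrP s (a + e); first by apply: he; apply/andP; split; lra.
  have [sb|sb] := ltrP s (pi / 2 - a); first by apply: ha; apply/andP; split; lra.
  apply/diag_center; first by apply/andP; split; lra.
  by apply: he; apply/andP; split; lra.
have ha2 : 0 < a <= pi / 4 by rewrite a_gt0.
have nWg : ~ W (eta * tan a, eta * tan a) by rewrite -diag_map.
set g := eta * tan a in im1 im1l nWg.
have tea : a <= tan a by apply: tan_ge_id; rewrite a0/=; lra.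
have ag : a < g by rewrite /g; nra.
have gpa : pi / 2 - a <= g.
  by rewrite leNgt; apply/negP => gpa; apply: nWg; apply: ha; rewrite ag.
have ge : g < eta by rewrite /g; nra.
have g0 : 0 <= g by lra.
have gq : pi / 2 - g <= pi / 4 by lra.
have thi : 0 <= pi / 2 - eta < pi / 2 - g by apply/andP; split; lra.
have im2 := diag_gap_image _ _ thi gq (diag_gap_center _ _ g0 (ltW epi) im1).
have q2 : pi / 2 - g < pi / 2 by lra.
have lt12 : eta * tan (pi / 2 - eta) < eta * tan (pi / 2 - g).
  by rewrite ltr_pM2l//; exact: tan_mono.
have := boundR _ _ lt12 im2; rewrite leNgt => /negP; apply.
apply: second_image_long => //; first by rewrite e1.
Qed.

End Diagonal.

(** * Gaps that contain a sector *)

Section Sector.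
Context {R : realType} (lam : R) (W : set (R * R)) (gW : gap lam W).
Context (lam2 : Num.sqrt 2 < lam).
Implicit Types (x y s t b p q : R).

Let eta := lam / Num.sqrt 2.

Let eta1 : 1 < eta := eta_gt1 lam lam2.

Let lam_sq : lam ^+ 2 = 2 * eta ^+ 2.
Proof.
by rewrite /eta expr_div_n sqr_sqrtr// mulrC divfK.
Qed.

Let lam0 : 0 < lam.
Proof. by apply: le_lt_trans lam2; exact: sqrtr_ge0. Qed.

(** The part of the ray of slope t outside the central cell and inside the disc
    of radius lam: a fundamental domain for the action of the map on the ray. *)
Definition ray_gap t :=
  forall x, pi / 4 <= x -> x ^+ 2 * (1 + t ^+ 2) <= lam ^+ 2 -> W (x, t * x).

Lemma ray_scale_ge_eta t : 0 <= t <= 1 -> eta <= ray_scale lam t.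
Proof.
move=> /andP[t0 t1]; have s0 := sqrt1_gt0 t.
have s2 : 0 < Num.sqrt 2 :> R by rewrite sqrtr_gt0.
rewrite /eta /ray_scale ler_pM2l// lef_pV2 ?posrE//.
by apply: ler_wsqrtr; nra.
Qed.

(** A point closer to the origin is moved outward by the factor eta at least,
    until it enters the segment in ray_gap. *)
Lemma ray_gap_full t : 0 < t <= 1 -> ray_gap t ->
  forall x, 0 < x -> x ^+ 2 * (1 + t ^+ 2) <= lam ^+ 2 -> W (x, t * x).
Proof.
move=> t01 rt; case/andP: (t01) => t0 t1; have p0 := pi_gt0 R; have e1 := eta1.
have em : eta <= ray_scale lam t by apply: ray_scale_ge_eta; rewrite (ltW t0).
have main n : forall x, 0 < x -> pi / 4 <= x * eta ^+ n ->
    x ^+ 2 * (1 + t ^+ 2) <= lam ^+ 2 -> W (x, t * x).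
  elim: n => [|n IH] x x0 xn xl; first by apply: rt => //; rewrite expr0 mulr1 in xn.
  have [xq|xq] := lerP (pi / 4) x; first exact: rt.
  have tx : x <= tan x by apply: tan_ge_id; rewrite (ltW x0)/=; lra.
  have t1x : tan x <= 1 by apply: tan_le1; rewrite (ltW x0) ltW.
  have mt : 0 < ray_scale lam t by lra.
  have q : quarter (x, t * x).
    have h1 : t * x <= x by rewrite ler_piMl// ltW.
    have h2 : 0 < t * x by rewrite mulr_gt0.
    by split=> /=; apply/andP; split; lra.
  apply/(gap_map _ _ gW _ q); rewrite planar_map_even//; last by rewrite x0 ltW.
  apply: IH; first by rewrite mulr_gt0//; lra.
    apply: (le_trans xn); rewrite exprS mulrA ler_pM2r ?exprn_gt0//; last lra.
    by rewrite mulrC ler_pM//; lra.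
  rewrite exprMn mulrAC ray_scale_sq ler_piMr ?sqr_ge0// expr_le1//; lra.
move=> x x0 xl; have [n hn] := exp_unbounded eta x (pi / 4) eta1 x0.
exact: (main n x x0 (ltW hn) xl).
Qed.

(** This makes the second preimage of a point of the ray of slope t steeper than
    t. The hypothesis bounds y below, and the claim reduces to the case
    eta = 1, where it is an inequality between t and pi. *)
Lemma slope_bound t y : 0 <= t < 1 -> 0 < y <= pi / 4 ->
  pi * (1 + t) / (8 * eta) <= tan y -> 2 * t * (pi / 2 - t * y) < eta * (1 + t).
Proof.
have e1 := eta1; move=> /andP[t0 t1] yp ky; have p3 := pi_ge3 (R := R); have p4 := pi_lt_16div5 (R := R).
have p0 := pi_gt0 R; case/andP: (yp) => y0 yp4.
have := tan_quarter_sub y; rewrite (ltW y0) => /(_ yp4).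
set T := tan y in ky *; set k := _ / _ in ky.
have c0 : 0 < pi * (1 + t) by rewrite mulr_gt0//; lra.
have k0 : 0 < k by rewrite /k divr_gt0//; lra.
have D1 : (1 - T) / (1 + T) <= (1 - k) / (1 + k).
  rewrite ler_pdivrMr; last lra.
  by rewrite mulrAC ler_pdivlMr; [nra|lra].
have kE : k * eta = pi * (1 + t) / 8 by rewrite /k; field; rewrite gt_eqF//; lra.
pose K := pi * (1 + t) / 8.
have K0 : 0 < K by rewrite /K; lra.
have D2 : (1 - k) / (1 + k) <= (1 - K) / (1 + K) + (eta - 1) / 2.
  have -> : (1 - k) / (1 + k) = (eta - K) / (eta + K).
    have -> : eta - K = eta * (1 - k) by rewrite /K -kE; ring.
    have -> : eta + K = eta * (1 + k) by rewrite /K -kE; ring.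
    by field; rewrite !gt_eqF//; lra.
  have -> : (eta - K) / (eta + K) = (1 - K) / (1 + K) + (eta - 1) * (2 * K / ((eta + K) * (1 + K))).
    by field; rewrite !gt_eqF//; lra.
  rewrite lerD2l ler_pM2l; last lra.
  rewrite ler_pdivrMr; last by rewrite mulr_gt0//; lra.
  have h1 : (1 + K) * (1 + K) <= (eta + K) * (1 + K) by rewrite ler_pM2r//; lra.
  have h2 := sqr_ge0 (1 - K).
  lra.
move=> yB.
have yL : pi / 4 - (1 - K) / (1 + K) - (eta - 1) / 2 <= y by lra.
have t2 : t ^+ 2 <= t by rewrite expr2 ler_piMl// ltW.
have := ler_wpM2l (sqr_ge0 t) yL.
set D := (1 - K) / (1 + K) => h.
suff main : pi * t < (1 + t) + 2 * t ^+ 2 * (pi / 4 - D).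
  have : 0 <= (eta - 1) * (1 + t - t ^+ 2) by rewrite mulr_ge0; lra.
  lra.
have K1 : 0 < 1 + K by lra.
have DE : D * (1 + K) = 1 - K by rewrite /D divfK// gt_eqF.
have t3 : 0 <= (t - 77 / 100) ^+ 2 * (t + 154 / 100) by rewrite mulr_ge0 ?sqr_ge0//; lra.
have f3 : 0 < 11 - 19 * t + t ^+ 2 / 2 + 21 / 2 * t ^+ 3.
  by have := sqr_ge0 t; lra.
have f4 : 0 < 11 + 1 / 5 - (21 + 11 / 25) * t + (1 + 7 / 25) * t ^+ 2 + (11 + 13 / 25) * t ^+ 3.
  by have := sqr_ge0 (t - 37 / 100); lra.
(* Concave in pi, so positive between 3 and 16/5 if it is at these values. *)
have f : 0 < 8 * (1 + t) - 16 * t ^+ 2 + (1 - 6 * t + 7 * t ^+ 2 + 2 * t ^+ 3) * pi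
    + t * (1 + t) * (t / 2 - 1) * pi ^+ 2.
  have h1 : 0 <= t * (1 + t) * (1 - t / 2) * ((pi - 3) * (16 / 5 - pi)).
    by rewrite !mulr_ge0//; lra.
  have h2 : 0 <= (pi - 3) * (11 + 1 / 5 - (21 + 11 / 25) * t + (1 + 7 / 25) * t ^+ 2 + (11 + 13 / 25) * t ^+ 3).
    by rewrite mulr_ge0//; lra.
  have h3 : 0 < (16 / 5 - pi) * (11 - 19 * t + t ^+ 2 / 2 + 21 / 2 * t ^+ 3).
    by rewrite mulr_gt0//; lra.
  lra.
have : 0 < ((1 + t) + 2 * t ^+ 2 * (pi / 4 - D) - pi * t) * (1 + K).
  have -> : ((1 + t) + 2 * t ^+ 2 * (pi / 4 - D) - pi * t) * (1 + K) =
    ((1 + t) + 2 * t ^+ 2 * (pi / 4) - pi * t) * (1 + K) - 2 * t ^+ 2 * (D * (1 + K)) by ring.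
  rewrite DE /K; lra.
by rewrite pmulr_lgt0//; lra.
Qed.

(** The angle between (1, t) and (1, s) is at most that between (1, t) and
    (1, 1); compare the squares of the cosines. *)
Lemma chord_norm t s : 0 <= t < 1 -> t < s <= 1 ->
  (1 + s ^+ 2) * (1 + t) ^+ 2 <= 2 * (1 + t * s) ^+ 2.
Proof.
move=> /andP[t0 t1] /andP[ts s1].
have h1 : 0 <= (1 - t) * (1 + t ^+ 2) by apply: mulr_ge0; [lra|rewrite addr_ge0// sqr_ge0].
have h2 : 0 <= (1 + 2 * t - t ^+ 2) * (s - t).
  have : t ^+ 2 <= t by rewrite expr2 ler_piMl// ltW.
  by move=> ?; apply: mulr_ge0; lra.
have : 0 <= (1 - s) * ((1 - t) * (1 + t ^+ 2) + (1 + 2 * t - t ^+ 2) * (s - t)).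
  by apply: mulr_ge0; [lra|exact: addr_ge0].
lra.
Qed.

Lemma sector_point t a b : (forall s, t < s <= 1 -> ray_gap s) -> 0 <= t ->
  0 < a -> 0 < b <= a -> t * a < b -> a ^+ 2 + b ^+ 2 <= lam ^+ 2 -> W (a, b).
Proof.
move=> rs t0 a0 /andP[b0 ba] tab ab.
have e : b = b / a * a by rewrite divfK// gt_eqF.
have r1 : t < b / a <= 1 by rewrite ltr_pdivlMr// tab ler_pdivrMr// mul1r.
rewrite e; apply: ray_gap_full => //; last 1 first.
- by rewrite mulrDr mulr1 -exprMn [a * _]mulrC -e.
- by rewrite divr_gt0//=; case/andP: r1.
- exact: rs.
Qed.

(** Let n be the norm of (p, s p). The claim follows from 2 t n < lam (1 + t s),
    which is the hypothesis on p once chord_norm has replaced the norm of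
    (1, s). *)
Lemma preimage_slope t s p b : 0 <= t < 1 -> t < s <= 1 -> 0 < p ->
  2 * t * p < eta * (1 + t) ->
  lam / (Num.sqrt (1 + s ^+ 2) * p) * (pi / 4) <= b ->
  t * (pi / 2 - s * b) < b.
Proof.
move=> t01 ts1 p0 key; have l0 := lam0; have l2 := lam_sq; have e1 := eta1.
have /andP[t0 t1] := t01; have /andP[ts s1] := ts1.
set n := _ * p => bc; have s0 : 0 < s by exact: le_lt_trans ts.
have n0 : 0 < n by rewrite mulr_gt0// sqrt1_gt0.
have h1 : 2 * t * n < lam * (1 + t * s).
  have k1 : 0 <= 2 * t * n by rewrite !mulr_ge0// ltW.
  have k2 : 0 <= lam * (1 + t * s).
    by apply: mulr_ge0; [exact: ltW|rewrite addr_ge0// mulr_ge0// ltW].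
  rewrite -(@ltr_pXn2r _ 2)//.
  have -> : (lam * (1 + t * s)) ^+ 2 = eta ^+ 2 * (2 * (1 + t * s) ^+ 2).
    by rewrite exprMn l2; ring.
  have -> : (2 * t * n) ^+ 2 = (1 + s ^+ 2) * (2 * t * p) ^+ 2.
    have ss2 : Num.sqrt (1 + s ^+ 2) ^+ 2 = 1 + s ^+ 2.
      by rewrite sqr_sqrtr// addr_ge0// sqr_ge0.
    by rewrite -ss2 /n; ring.
  have h2 := chord_norm t s t01 ts1.
  have h3 : (2 * t * p) ^+ 2 < (eta * (1 + t)) ^+ 2.
    have k3 : 0 <= 2 * t * p by rewrite !mulr_ge0// ltW.
    have k4 : 0 <= eta * (1 + t) by apply: le_trans k3 _; exact: ltW.
    by rewrite ltr_sqr ?nnegrE.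
  have h4 : 0 < 1 + s ^+ 2 by rewrite ltr_pwDl// sqr_ge0.
  have h5 : (1 + s ^+ 2) * (2 * t * p) ^+ 2 < (1 + s ^+ 2) * (eta * (1 + t)) ^+ 2.
    by rewrite ltr_pM2l.
  have h6 := ler_wpM2l (sqr_ge0 eta) h2.
  apply: (lt_le_trans h5); apply: le_trans h6.
  by rewrite le_eqVlt; apply/orP; left; apply/eqP; ring.
have h2 : 2 * t < lam / n * (1 + t * s).
  by rewrite -(ltr_pM2r n0) [ltRHS]mulrAC divfK ?gt_eqF.
have h3 : 0 < 1 + t * s by have := mulr_ge0 t0 (ltW s0); lra.
have p4 : 0 < pi / 4 :> R by rewrite divr_gt0// pi_gt0.
have h4 : lam / n * (pi / 4) * (1 + t * s) <= b * (1 + t * s).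
  by apply: ler_wpM2r => //; exact: ltW.
have h5 : 2 * t * (pi / 4) < lam / n * (1 + t * s) * (pi / 4) by rewrite ltr_pM2r.
lra.
Qed.

(** If (p, s p) is in the disc of radius lam, it is in the sector. Otherwise it
    is the image of (pi/2 - b, s b), where tan b = lam / n and n is the norm of
    (p, s p); up to the symmetries of W this is (pi/2 - s b, b). The former is
    in the sector if t is small, and the latter if t is not. *)
Lemma corner_in_gap t s p : (forall s, t < s <= 1 -> ray_gap s) -> 0 <= t < 1 ->
  t < s <= 1 -> 1 <= s * (2 - t) -> 0 < p <= pi / 2 ->
  2 * t * p < eta * (1 + t) -> W (p, s * p).
Proof.
move=> rs t01 ts1 spq /andP[p_gt0 pp] key.
have /andP[t0 t1] := t01; have /andP[ts s1] := ts1.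
have e1 := eta1; have l0 := lam0; have l2 := lam_sq.
have p3 := pi_ge3 (R := R); have p4 := pi_lt_16div5 (R := R); have p0 := pi_gt0 R.
have s0 : 0 < s by exact: le_lt_trans ts.
have q0 : 0 < s * p by rewrite mulr_gt0.
have qp : s * p <= p by rewrite ler_piMl// ltW.
have [n2|n2] := lerP (p ^+ 2 + (s * p) ^+ 2) (lam ^+ 2).
  by apply: (sector_point t) => //; [rewrite q0|rewrite ltr_pM2r].
pose n := Num.sqrt (1 + s ^+ 2) * p.
have n0 : 0 < n by rewrite mulr_gt0// sqrt1_gt0.
have nE : n ^+ 2 = p ^+ 2 + (s * p) ^+ 2.
  by rewrite /n exprMn sqr_sqrtr ?addr_ge0 ?sqr_ge0// mulrDl mul1r -exprMn.
have ln : lam < n by rewrite -(@ltr_pXn2r _ 2) ?nnegrE ?(ltW l0) ?(ltW n0)// nE.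
have [b [tb b0 b4]] : exists b, [/\ tan b = lam / n, 0 < b & b <= pi / 4].
  exists (atan (lam / n)); split; first exact: atanK.
    by rewrite -atan0 lt_atan// divr_gt0.
  by rewrite -atan1 le_atan// ler_pdivrMr// mul1r ltW.
have bc : lam / n * (pi / 4) <= b by rewrite -tb tan_chord// (ltW b0).
have slope := preimage_slope t s p b t01 ts1 p_gt0 key bc.
have b2 : 1 / 2 <= b.
  have lp : 0 <= lam * (pi / 2) by rewrite mulr_ge0// ?divr_ge0// ltW.
  have h : n <= lam * (pi / 2).
    rewrite -(@ler_pXn2r _ 2) ?nnegrE ?(ltW n0)// nE (exprMn _ lam) l2.
    have pp0 : 0 <= pi / 2 :> R by rewrite divr_ge0 ?(ltW p0).
    have h1 : p ^+ 2 <= (pi / 2) ^+ 2 by rewrite ler_sqr ?nnegrE// ltW.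
    have h2 : (s * p) ^+ 2 <= (pi / 2) ^+ 2.
      by rewrite ler_sqr ?nnegrE ?(ltW q0)// (le_trans qp).
    have h3 : 1 <= eta ^+ 2 by rewrite exprn_ege1// ltW.
    have h4 : (pi / 2) ^+ 2 <= eta ^+ 2 * (pi / 2) ^+ 2 by rewrite ler_peMl// sqr_ge0.
    lra.
  apply: le_trans bc; rewrite [leRHS]mulrAC ler_pdivlMr//; lra.
have bs : s * b <= b by rewrite ler_piMl// ltW.
have sb0 : 0 < s * b by rewrite mulr_gt0.
have q1 : quarter (pi / 2 - b, s * b).
  by split=> /=; apply/andP; split; lra.
have eW : W (pi / 2 - b, s * b) <-> W (p, s * p).
  rewrite (gap_map _ _ gW _ q1) planar_map_odd ?b0 ?s0//.
  have -> // : ray_scale lam s / tan b = p.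
  rewrite tb /ray_scale /n; have ss := sqrt1_gt0 s.
  by field; rewrite !gt_eqF.
have h3 : 1 <= eta ^+ 2 by rewrite exprn_ege1// ltW.
apply/eW; have [t5|t5] := lerP (1 / 5) t.
  (* From s >= 1 / (2 - t); this keeps (pi/2 - s b, b) inside the disc. *)
  have s59 : 5 / 9 <= s by nra.
  have WA : W (pi / 2 - s * b, b).
    apply: (sector_point t) => //; [|rewrite b0|].
    - lra.
    - lra.
    have h1 : 5 / 9 * b <= s * b by rewrite ler_pM2r.
    have h2 : (pi / 2 - s * b) ^+ 2 <= (8 / 5 - 5 / 9 * b) ^+ 2.
      by rewrite ler_sqr ?nnegrE; lra.
    have h4 : 0 <= (b - 1 / 2) * (4 / 5 - b).
      by rewrite mulr_ge0//; lra.
    lra.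
  have q2 : quarter (b, pi / 2 - s * b).
    by split=> /=; apply/andP; split; lra.
  by move: (gap_swap _ _ gW _ _ WA); rewrite (gap_center _ _ gW _ _ q2) subKr.
(* This puts (pi/2 - b, s b) above the ray of slope t < 1/5. *)
have s12 : 1 / 2 <= s by nra.
have h1 : 1 / 2 * b <= s * b by rewrite ler_pM2r.
apply: (sector_point t) => //; [|rewrite sb0| |].
- lra.
- lra.
- have : t * (pi / 2 - b) <= 1 / 5 * (pi / 2 - b).
    by apply: ler_wpM2r; [lra|exact: ltW].
  lra.
have h2 : (pi / 2 - b) ^+ 2 <= (11 / 10) ^+ 2.
  by rewrite ler_sqr ?nnegrE; lra.
have h4 : (s * b) ^+ 2 <= (4 / 5) ^+ 2.
  by rewrite ler_sqr ?nnegrE; lra.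
lra.
Qed.

(** A point x (1, t) of the ray of slope t is the image of (y, t y), where
    tan y = x / ray_scale t, so it is enough that (y, t y) is in the gap. Its
    image under the half-turn of the square, with the coordinates exchanged,
    is a point (p, q) near the opposite corner which is steeper than t. If
    t = 0, it is on the wall x = pi/2, which avoids the gap. *)
Lemma ray_gap_closed t : 0 <= t < 1 ->
  (forall s, t < s <= 1 -> ray_gap s) -> 0 < t /\ ray_gap t.
Proof.
move=> t01 rs; case/andP: (t01) => t0 t1; have e1 := eta1; have l0 := lam0.
have p3 := pi_ge3 (R := R); have p0 := pi_gt0 R.
have em : eta <= ray_scale lam t by apply: ray_scale_ge_eta; rewrite // t0 ltW.
have m0 : 0 < ray_scale lam t by lra.
have main x : pi / 4 <= x -> x ^+ 2 * (1 + t ^+ 2) <= lam ^+ 2 ->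
    0 < t /\ W (x, t * x).
  move=> xq xl; have x0 : 0 < x by lra.
  have xm : x <= ray_scale lam t.
    rewrite -(@ler_pXn2r _ 2)// ?nnegrE ?(ltW x0) ?(ltW m0)//.
    by rewrite -(@ler_pM2r _ (1 + t ^+ 2)) ?ray_scale_sq// ltr_pwDl// sqr_ge0.
  have [y [ty y0 y4]] : exists y, [/\ tan y = x / ray_scale lam t, 0 < y & y <= pi / 4].
    exists (atan (x / ray_scale lam t)); split; first exact: atanK.
      by rewrite -atan0 lt_atan// divr_gt0.
    by rewrite -atan1 le_atan// ler_pdivrMr// mul1r.
  have yp : 0 < y <= pi / 4 by rewrite y0.
  have ky : pi * (1 + t) / (8 * eta) <= tan y.
    rewrite ty; apply: (@le_trans _ _ (pi / 4 / ray_scale lam t)); last first.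
      by rewrite ler_pM2r ?invr_gt0.
    rewrite ler_pdivrMr; last by lra.
    rewrite mulrAC ler_pdivlMr//.
    have h1 : ray_scale lam t * (1 + t) <= 2 * eta.
      have k1 : 0 <= ray_scale lam t * (1 + t) by rewrite mulr_ge0 ?(ltW m0) ?addr_ge0.
      have k2 : 0 <= 2 * eta by lra.
      rewrite -(@ler_pXn2r _ 2)// exprMn.
      have h2 : (1 + t) ^+ 2 <= 2 * (1 + t ^+ 2) by have := sqr_ge0 (1 - t); lra.
      have h3 := ler_wpM2l (sqr_ge0 (ray_scale lam t)) h2.
      have h4 := ray_scale_sq lam t; have l2 := lam_sq.
      lra.
    have h2 := ler_wpM2l (ltW p0) h1; lra.
  pose p := pi / 2 - t * y; pose q := pi / 2 - y.
  have key : 2 * t * p < eta * (1 + t) by apply: slope_bound.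
  have ty1 : t * y <= y by rewrite ler_piMl ?(ltW y0)// ltW.
  have ty0 : 0 <= t * y by rewrite mulr_ge0 ?(ltW y0).
  have bounds : [/\ 0 < q, q <= p & p <= pi / 2].
    by rewrite /p /q; split; lra.
  have [q0 qp pp] := bounds; have p_gt0 : 0 < p by exact: lt_le_trans qp.
  have sp : q / p * p = q by rewrite divfK// gt_eqF.
  have s1 : q / p <= 1 by rewrite ler_pdivrMr// mul1r.
  have ts : t < q / p.
    rewrite ltr_pdivlMr// /p /q.
    have : 0 < (1 - t) * (pi / 2 - (1 + t) * y).
      rewrite mulr_gt0//; first by lra.
      by nra.
    by lra.
  have spq : 1 <= q / p * (2 - t).
    have h : p <= q * (2 - t).
      rewrite /p /q; have : 0 <= (1 - t) * (pi / 2 - 2 * y).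
        by rewrite mulr_ge0//; lra.
      by lra.
    by rewrite mulrAC ler_pdivlMr// mul1r.
  have Wpq : W (p, q).
    by rewrite -sp; apply: (corner_in_gap t) => //; rewrite ?ts ?p_gt0.
  have [t00|tn0] := eqVneq t 0.
    by exfalso; apply: (gap_wall _ _ gW q); move: Wpq; rewrite {1}/p t00 mul0r subr0.
  have t_gt0 : 0 < t by rewrite lt_neqAle eq_sym tn0.
  split => //.
  have ty_gt0 : 0 < t * y by rewrite mulr_gt0.
  have q1 : quarter (y, t * y).
    by split=> /=; apply/andP; split; lra.
  have q2 : quarter (t * y, y).
    by split=> /=; apply/andP; split; lra.
  have W1 : W (t * y, y) by apply/(gap_center _ _ gW _ _ q2).
  have := gap_swap _ _ gW _ _ W1; rewrite (gap_map _ _ gW _ q1) planar_map_even//; last first.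
    by rewrite t_gt0 ltW.
  by rewrite ty mulrC divfK// gt_eqF.
split; last by move=> x xq xl; case: (main x xq xl).
have q4 : pi / 4 <= ray_scale lam t by have := pi_lt_16div5 (R := R); lra.
by case: (main _ q4); rewrite // ray_scale_sq.
Qed.

End Sector.

Section DiagonalEmpty.
Context {R : realType} (lam : R) (W : set (R * R)) (gW : gap lam W).
Context (lam2 : Num.sqrt 2 < lam).
Implicit Types (x y s t : R).

(** The full ray in the closed disc is the forward and backward orbit of a
    compact arc, so the slopes of the rays in the gap form an open set. *)
Lemma ray_gap_open t : 0 < t <= 1 -> ray_gap lam W t ->
  \forall s \near t, ray_gap lam W s.
Proof.
move=> t01 rt; have p0 := pi_gt0 R.
have l0 : 0 < lam by apply: le_lt_trans lam2; exact: sqrtr_ge0.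
pose F (xs : R * R) := (xs.1 / Num.sqrt (1 + xs.2 ^+ 2), xs.2 * (xs.1 / Num.sqrt (1 + xs.2 ^+ 2))).
have cF xs : {for xs, continuous F}.
  have c1 : {for xs, continuous (fun xs : R * R => xs.1 / Num.sqrt (1 + xs.2 ^+ 2))}.
    apply: continuousM; first exact: continuous_fst.
    apply: continuousV; first by rewrite gt_eqF// sqrt1_gt0.
    apply: (@continuous_comp _ _ _ (fun xs : R * R => 1 + xs.2 ^+ 2) Num.sqrt); last exact: sqrt_continuous.
    apply: continuousD; first exact: cvg_cst.
    apply: (@continuous_comp _ _ _ snd (fun y : R => y ^+ 2)).
      exact: continuous_snd.
    exact: exprn_continuous.
  by apply: continuous_pair; [exact: c1|apply: continuousM; [exact: continuous_snd|exact: c1]].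
have /compact_near_coveringP cK := @segment_compact R (pi / 4) lam.
have sq s : Num.sqrt (1 + s ^+ 2) ^+ 2 = 1 + s ^+ 2 by rewrite sqr_sqrtr// addr_ge0// sqr_ge0.
have key x : `[pi / 4, lam]%classic x ->
    \forall x' \near x & s \near nbhs t, W (F (x', s)).
  rewrite /= in_itv/= => /andP[x4 xl].
  have Wx : W (F (x, t)).
    apply: (ray_gap_full lam W gW lam2) => //=.
      by rewrite divr_gt0 ?sqrt1_gt0//; lra.
    rewrite expr_div_n sq divfK; last by rewrite gt_eqF// ltr_pwDl// sqr_ge0.
    by rewrite ler_sqr ?nnegrE//; lra.
  exact: cF (open_nbhs_nbhs (conj (gap_open _ _ gW) Wx)).
have h := cK _ (nbhs t) (fun s x => W (F (x, s))) (nbhs_filter t) key.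
apply: filterS h => s hs x x4 xl.
have ss := sqrt1_gt0 s.
have := hs (x * Num.sqrt (1 + s ^+ 2)).
rewrite /F /= mulfK ?gt_eqF//; apply; rewrite in_itv/=; apply/andP; split.
  apply: (le_trans x4); rewrite ler_peMr//; first lra.
  by rewrite -[leLHS]sqrtr1 ler_wsqrtr// lerDl sqr_ge0.
rewrite -(@ler_pXn2r _ 2) ?nnegrE ?(ltW l0)//; first by rewrite exprMn sq.
by rewrite mulr_ge0 ?(ltW ss)//; lra.
Qed.

(** The set of slopes of the rays in the gap would be open and closed in [0, 1]
    but the ray of slope 0 is in the axis. *)
Lemma gap_diag s : ~ W (s, s).
Proof.
move=> Ws; have [epi full] := diag_gap_full lam W gW lam2 s Ws.
have e1 := eta_gt1 lam lam2; set eta := lam / _ in epi e1; have p3 := pi_ge3 (R := R).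
have lam_sq : lam ^+ 2 = 2 * eta ^+ 2.
  by rewrite /eta expr_div_n sqr_sqrtr// mulrC divfK.
pose A := [set t | 0 <= t <= 1 /\ forall t', t <= t' <= 1 -> ray_gap lam W t'].
have A1 : A 1.
  split; first by rewrite ler01 lexx.
  move=> t /andP[t1 t1']; have {t1 t1'}-> : t = 1 by apply/eqP; rewrite eq_le t1'.
  move=> x x4; rewrite expr1n lam_sq mulrC ler_pM2l// mul1r => xe.
  apply: full; apply/andP; split; first lra.
  apply: le_lt_trans epi.
  by rewrite -(@ler_pXn2r _ 2) ?nnegrE//; lra.
have infA : has_inf A by split; [exists 1|exists 0 => t [/andP[]]].
pose t := inf A.
have t0 : 0 <= t by apply: lb_le_inf; [exists 1|move=> ? [/andP[]]].
have t1 : t <= 1 by apply: ge_inf => //; exact: infA.2.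
have above s' : t < s' <= 1 -> ray_gap lam W s'.
  move=> /andP[ts' s'1]; have st : 0 < s' - t by rewrite subr_gt0.
  have [r [_ hr] rs'] := inf_adherent st infA; apply: hr; rewrite s'1 andbT.
  by rewrite -/t in rs'; lra.
have [tp rt] : 0 < t /\ ray_gap lam W t.
  have [t1E|tn1] := eqVneq t 1; first by rewrite t1E; split=> //; apply: A1.2; rewrite lexx.
  by apply: (ray_gap_closed lam W gW lam2) => //; rewrite t0 lt_neqAle tn1.
have tp1 : 0 < t <= 1 by rewrite tp.
have /nbhs_ballP[e /= e0 he] := ray_gap_open t tp1 rt.
pose r := Num.max 0 (t - e / 2).
have r0 : 0 <= r by rewrite le_max lexx.
have rt' : r < t by rewrite gt_max tp; lra.
have re : t - e / 2 <= r by rewrite le_max lexx orbT.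
have : A r.
  split; first by rewrite r0; lra.
  move=> r' /andP[rr' r'1]; have [tr'|r't] := ltrP t r'; first by apply: above; rewrite tr'.
  by apply: he; rewrite /ball/= ltr_norml; apply/andP; split; lra.
by move=> /(ge_inf infA.2); rewrite -/t leNgt rt'.
Qed.

End DiagonalEmpty.

(** * Area in the coordinates (x, y / x) *)

Section Moment.
Context {R : realType}.
Notation mu := (@lebesgue_measure R).
Implicit Types (A D I J O E : set R) (a b c d x K : R).

(** The weight of the area element x dx dt in the coordinates (x, t = y / x). *)
Definition weight x : \bar R := (Num.max x 0)%:E.

Definition moment A : \bar R := (\int[mu]_(x in A) weight x)%E.

Lemma measurable_weight A : measurable_fun A weight.
Proof.
apply/measurable_EFinP; apply: measurable_funTS.
apply: measurable_maxr => //; exact: measurable_cst.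
Qed.

Lemma weight_ge0 x : (0 <= weight x)%E.
Proof. by rewrite /weight lee_fin le_max lexx orbT. Qed.

Lemma moment_ge0 A : (0 <= moment A)%E.
Proof. by apply: integral_ge0 => x _; exact: weight_ge0. Qed.

Lemma le_moment A E : measurable A -> measurable E -> A `<=` E ->
  (moment A <= moment E)%E.
Proof.
move=> mA mE AE; apply: ge0_subset_integral => //.
  exact: measurable_weight.
by move=> x _; exact: weight_ge0.
Qed.

Lemma moment_itv c d : 0 <= c <= d ->
  moment `[c, d] = ((d ^+ 2 - c ^+ 2) / 2)%:E.
Proof.
move=> /andP[c0]; rewrite le_eqVlt => /predU1P[->|cd].
  by rewrite /moment set_itv1 integral_set1 subrr mul0r.
transitivity (\int[mu]_(x in `[c, d]) ((fun x : R => x) x)%:E)%E.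
  apply: eq_integral => x; rewrite inE/= in_itv/= => /andP[cx _].
  by rewrite /weight max_l// (le_trans c0).
have dF (x : R) : is_derive x 1 (fun x : R => x ^+ 2 / 2) x.
  by apply: is_derive_eq; rewrite /GRing.scale/=; field.
have cF : continuous (fun x : R => x ^+ 2 / 2).
  by move=> x; apply: cvgM; [exact: exprn_continuous|exact: cvg_cst].
rewrite (@continuous_FTC2 _ (fun x => x) (fun x => x ^+ 2 / 2))//.
- by rewrite -EFinB mulrBl.
- by apply: continuous_subspaceT => x; exact: cvg_id.
- split; first by move=> x _; exact: ex_derive.
  + exact/cvg_at_right_filter/cF.
  + exact/cvg_at_left_filter/cF.
- by move=> x _; rewrite derive1E derive_val.
Qed.

Lemma moment_oo c d : 0 <= c <= d ->
  moment `]c, d[ = ((d ^+ 2 - c ^+ 2) / 2)%:E.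
Proof.
move=> cd; rewrite -moment_itv// /moment [RHS]integral_itv_bndoo//.
exact: measurable_weight.
Qed.

Lemma moment_bigcup (F : nat -> set R) : (forall i, measurable (F i)) ->
  trivIset setT F -> moment (\bigcup_i F i) = (\sum_(i <oo) moment (F i))%E.
Proof.
move=> mF tF; rewrite /moment ge0_integral_bigcup//.
- exact: measurable_weight.
- by move=> x _; exact: weight_ge0.
Qed.

(** A set in [0, M] lies between its bounds, and these are limits of pairs of
    its points. *)
Lemma moment_le_pairs E M (K : \bar R) : measurable E -> E `<=` `[0, M] -> (0 <= K)%E ->
  (forall c d, E c -> E d -> c < d -> (((d ^+ 2 - c ^+ 2) / 2)%:E <= K)%E) ->
  (moment E <= K)%E.
Proof.
move=> mE EM K0 hK; have [->|/set0P[z Ez]] := eqVneq E set0.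
  by rewrite /moment integral_set0.
case: K K0 hK => [K| |]//; last by move=> *; rewrite leey.
rewrite lee_fin => K0 hK.
have E0 x : E x -> 0 <= x <= M by move=> /EM; rewrite /= in_itv.
have hi : has_inf E by split; [exists z|exists 0 => x /E0/andP[]].
have hs : has_sup E by split; [exists z|exists M => x /E0/andP[]].
have Ei : E `<=` `[inf E, sup E].
  move=> x Ex; rewrite /= in_itv/=; apply/andP; split.
    by apply: ge_inf => //; exact: hi.2.
  by apply: ub_le_sup => //; exact: hs.2.
have i0 : 0 <= inf E by apply: lb_le_inf; [exists z|move=> x /E0/andP[]].
have pqW : inf E <= sup E by have := Ei _ Ez; rewrite /= in_itv/= => /andP[h1 h2]; exact: le_trans h2.
apply: (@le_trans _ _ (moment `[inf E, sup E])); first exact: le_moment.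
rewrite moment_itv ?i0// lee_fin leNgt; apply/negP => KE.
set p := inf E in i0 pqW KE Ei; set q := sup E in pqW KE Ei.
have pq : p < q by rewrite lt_neqAle pqW andbT; apply/negP => /eqP e; move: KE; rewrite e subrr mul0r ltNge K0.
pose g := (q ^+ 2 - p ^+ 2) / 2 - K.
have g0 : 0 < g by rewrite subr_gt0.
pose e := Num.min (g / (2 * (q + 1))) ((q - p) / 4).
have q0 : 0 < q by lra.
have e0 : 0 < e by rewrite lt_min !divr_gt0//; [lra|rewrite mulr_gt0//; lra].
have eg : e * (2 * (q + 1)) <= g by rewrite -ler_pdivlMr ?ge_min ?lexx// mulr_gt0//; lra.
have eq4 : e <= (q - p) / 4 by rewrite ge_min lexx orbT.
have [c Ec ce] := inf_adherent e0 hi; have [d Ed de] := sup_adherent e0 hs.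
rewrite -/p in ce; rewrite -/q in de.
have pc : p <= c by have := Ei _ Ec; rewrite /= in_itv/= => /andP[].
have dq : d <= q by have := Ei _ Ed; rewrite /= in_itv/= => /andP[].
have cd : c < d by lra.
have := hK _ _ Ec Ed cd; rewrite lee_fin => h.
have h1 : q ^+ 2 - d ^+ 2 <= e * (2 * q).
  by rewrite subr_sqr; apply: ler_pM; lra.
have h2 : c ^+ 2 - p ^+ 2 <= e * (2 * q).
  by rewrite subr_sqr; apply: ler_pM; lra.
have : (q ^+ 2 - p ^+ 2) / 2 <= K + e * (2 * q) by lra.
rewrite /g in g0 eg; lra.
Qed.

(** An estimate for pairs of points carries over to the measure of weight x dx,
    although the image of D need not be measured: split the open set O into
    its intervals, on each of which moment_le_pairs applies. *)
Lemma moment_fiber D J O (G : R -> R) M k : is_interval D -> D `<=` `[0, M] ->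
  is_interval J -> J `<=` [set x | 0 <= x] -> 0 <= k ->
  (forall x, D x -> J (G x)) ->
  (forall c d, D c -> D d -> c <= d -> G c <= G d) \/
  (forall c d, D c -> D d -> c <= d -> G d <= G c) ->
  (forall c d, D c -> D d -> c < d -> d ^+ 2 - c ^+ 2 <= k * `|G d ^+ 2 - G c ^+ 2|) ->
  open O -> (moment (D `&` G @^-1` O) <= k%:E * moment (J `&` O))%E.
Proof.
move=> iD DM iJ J0 k0 DJ mono hk oO.
pose I := open_disjoint_itv oO.
have OE : O = \bigcup_i I i by exact: open_disjoint_itv_bigcup.
have iI i : is_interval (I i) by exact: open_disjoint_itv_is_interval.
have tI : trivIset setT I by exact: open_disjoint_itv_trivIset.
have tI' i j : i != j -> I i `&` I j = set0.
  by move=> ij; move/trivIsetP : tI; exact.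
have iE i : is_interval (D `&` G @^-1` I i).
  move=> x y [Dx Ix] [Dy Iy] z xzy; have Dz : D z by exact: iD xzy.
  split => //=; case/andP: xzy => xz zy.
  case: mono => mono; [apply: (iI i _ _ Ix Iy)|apply: (iI i _ _ Iy Ix)];
    by rewrite !mono.
have mE i : measurable (D `&` G @^-1` I i) by exact: is_interval_measurable.
have mJ i : measurable (J `&` I i).
  by apply: measurableI; apply: is_interval_measurable.
have -> : D `&` G @^-1` O = \bigcup_i (D `&` G @^-1` I i).
  by rewrite OE preimage_bigcup setI_bigcupr.
have -> : J `&` O = \bigcup_i (J `&` I i) by rewrite OE setI_bigcupr.
rewrite !moment_bigcup//; first last.
- by apply/trivIsetP => i j _ _ ij; rewrite setIACA -preimage_setI tI'// preimage_set0 setI0.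
- by apply/trivIsetP => i j _ _ ij; rewrite setIACA tI'// setI0.
rewrite -nneseriesZl; last by move=> i _; exact: moment_ge0.
apply: lee_nneseries => [i *|i]; first exact: moment_ge0.
move=> _; apply: (@moment_le_pairs _ M) => //.
- by move=> x [/DM].
- by rewrite mule_ge0// ?lee_fin// moment_ge0.
move=> c d [Dc Ic] [Dd Id] cd.
have sub u v : G u <= G v -> D u -> D v -> I i (G u) -> I i (G v) ->
    ((`|G v ^+ 2 - G u ^+ 2| / 2)%:E <= moment (J `&` I i))%E.
  move=> uv Du Dv Iu Iv; have Gu0 : 0 <= G u by apply: J0; exact: DJ.
  have uv2 : 0 <= G v ^+ 2 - G u ^+ 2 by rewrite subr_ge0 ler_sqr ?nnegrE// (le_trans Gu0).
  rewrite ger0_norm// -moment_oo ?Gu0//; apply: le_moment => // x.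
  rewrite /= in_itv/= => /andP[ux xv]; split.
    by apply: (iJ (G u) (G v)); [exact: DJ|exact: DJ|rewrite !ltW].
  by apply: (iI i (G u) (G v)) => //; rewrite !ltW.
have main : ((`|G d ^+ 2 - G c ^+ 2| / 2)%:E <= moment (J `&` I i))%E.
  have [h|/ltW h] := lerP (G c) (G d); first exact: sub.
  by rewrite distrC; exact: sub.
apply: (@le_trans _ _ (k%:E * (`|G d ^+ 2 - G c ^+ 2| / 2)%:E)%E).
  by rewrite -EFinM lee_fin mulrA ler_pM2r// hk.
by apply: lee_wpmul2l => //; rewrite lee_fin.
Qed.

End Moment.

Section Area.
Context {R : realType}.
Notation mu := (@lebesgue_measure R).
Implicit Types (A B S : set (R * R)) (a b c x y t : R).

Definition area A : \bar R := ((mu \x mu) A)%E.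

(** A countable union of products, as the sigma-algebra of the plane is the
    product one. *)
Lemma open_rectangles A : open A -> A =
  \bigcup_(a : rat) \bigcup_(b : rat) \bigcup_(c : rat) \bigcup_(d : rat)
    [set p | (ratr a < p.1 < ratr b /\ ratr c < p.2 < ratr d) /\
      forall q, ratr a < q.1 < ratr b -> ratr c < q.2 < ratr d -> A q].
Proof.
move=> oA; apply/seteqP; split=> [[x y] Axy|]; last first.
  by move=> p [a _ [b _ [c _ [d _ [[h1 h2] h3]]]]]; exact: h3.
have /nbhs_ballP[e /= e0 he] := open_nbhs_nbhs (conj oA Axy).
have rat_near (u v : R) : u < v -> exists q : rat, u < ratr q < v.
  by move=> /rat_in_itvoo[q]; rewrite in_itv/=; exists q.
have [a ha] := rat_near (x - e) x ltac:(lra).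
have [b hb] := rat_near x (x + e) ltac:(lra).
have [c hc] := rat_near (y - e) y ltac:(lra).
have [d hd] := rat_near y (y + e) ltac:(lra).
exists a => //; exists b => //; exists c => //; exists d => //=.
case/andP: ha => a1 a2; case/andP: hb => b1 b2.
case/andP: hc => c1 c2; case/andP: hd => d1 d2.
split; first by rewrite a2 b1 c2 d1.
move=> [u v] /= /andP[u1 u2] /andP[v1 v2]; apply: he; split => /=;
  by rewrite /ball/= ltr_norml; apply/andP; split; lra.
Qed.

Lemma open_measurable_plane A : open A -> measurable A.
Proof.
move=> /open_rectangles ->.
apply: bigcupT_measurable_rat => a; apply: bigcupT_measurable_rat => b.
apply: bigcupT_measurable_rat => c; apply: bigcupT_measurable_rat => d.
have [h|h] := pselect (forall q : R * R, ratr a < q.1 < ratr b -> ratr c < q.2 < ratr d -> A q).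
  rewrite (_ : [set p | _] = `]ratr a, ratr b[%classic `*` `]ratr c, ratr d[%classic).
    by apply: measurableX; exact: measurable_itv.
  by apply/seteqP; split=> [p [[h1 h2] _]|p [h1 h2]]; move: h1 h2;
    rewrite /= !in_itv/=.
rewrite (_ : [set p | _] = set0)//.
by apply/seteqP; split=> [p [_ /h]|].
Qed.

Lemma area_ge0 A : (0 <= area A)%E. Proof. exact: measure_ge0. Qed.

Lemma le_area A B : measurable A -> measurable B -> A `<=` B -> (area A <= area B)%E.
Proof. by move=> mA mB AB; apply: le_measure => //; rewrite inE. Qed.

Lemma area_rect a b c d : a <= b -> c <= d ->
  area (`]a, b[%classic `*` `]c, d[%classic) = ((b - a) * (d - c))%:E.
Proof.
move=> ab cd.
transitivity (mu `]a, b[%classic * mu `]c, d[%classic)%E.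
  by rewrite /area product_measure1E//; exact: measurable_itv.
rewrite !lebesgue_measure_itv/= !lte_fin EFinM.
by congr (_ * _)%E; case: ltgtP ab cd => // ->; rewrite subrr.
Qed.

Lemma measurable_affine c a : measurable_fun [set: measurableTypeR R]
  ((fun y => c * y + a) : measurableTypeR R -> measurableTypeR R).
Proof. by apply: measurable_funD; [apply: measurable_funM|]. Qed.

(** Uniqueness of the measure that gives intervals their length. *)
Lemma lebesgue_affine c a (X : set R) : c != 0 -> measurable X ->
  (`|c|%:E * mu ((fun y => (c * y + a)%R) @^-1` X) = mu X)%E.
Proof.
move=> c0 mX; have c0' : 0 <= `|c| by exact: normr_ge0.
pose m := measure_function_pushforward__canonical__measure_function_Measure
  (@lebesgue_measure R) (measurable_affine c a).
apply/esym; apply: (@lebesgue_measure_unique R (mscale (NngNum c0') m)) => //.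
move=> _ [[u v] _ <-]; apply/esym.
transitivity (`|c|%:E * mu ((fun y => (c * y + a)%R) @^-1` `]u, v]%classic))%E.
  by [].
have itvE (b1 b2 : bool) (p q : R) :
    mu [set` Interval (BSide b1 p) (BSide b2 q)] = if p < q then (q - p)%:E else 0%E.
  rewrite lebesgue_measure_itv/= lte_fin EFinB.
  by case: ifP.
have [cneg|cpos|] := ltgtP c 0; last by move=> e; rewrite e eqxx in c0.
- have -> : (fun y => c * y + a) @^-1` `]u, v]%classic = `[(v - a) / c, (u - a) / c[%classic.
    apply/seteqP; split=> y; rewrite /= !in_itv/= ler_ndivrMr// ltr_ndivlMr// [c * y]mulrC.
      by move=> /andP[h1 h2]; apply/andP; split; lra.
    by move=> /andP[h1 h2]; apply/andP; split; lra.
  rewrite !itvE ltr_nM2r ?invr_lt0// ltrD2r; case: ifP => uv; last by rewrite mule0.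
  rewrite -EFinM ltr0_norm//; congr EFin => /=; field; exact: ltr0_neq0.
- have -> : (fun y => c * y + a) @^-1` `]u, v]%classic = `](u - a) / c, (v - a) / c]%classic.
    apply/seteqP; split=> y; rewrite /= !in_itv/= ltr_pdivrMr// ler_pdivlMr// [c * y]mulrC.
      by move=> /andP[h1 h2]; apply/andP; split; lra.
    by move=> /andP[h1 h2]; apply/andP; split; lra.
  rewrite !itvE ltr_pM2r ?invr_gt0// ltrD2r; case: ifP => uv; last by rewrite mule0.
  by rewrite -EFinM gtr0_norm//; congr EFin => /=; field; rewrite gt_eqF.
Qed.

Lemma area_sections A : area A = (\int[mu]_x mu (xsection A x))%E.
Proof. by []. Qed.

Lemma area_affine_y c a A : `|c| = 1 -> measurable A ->
  area [set p | A (p.1, c * p.2 + a)] = area A.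
Proof.
move=> c1 mA; have c0 : c != 0 by rewrite -normr_gt0 c1.
rewrite !area_sections; apply: eq_integral => x _.
rewrite -[RHS](@lebesgue_affine c a)//; last exact: measurable_xsection.
rewrite c1 mul1e !xsectionE//.
Qed.

Lemma area_swap A : measurable A -> area [set p | A (p.2, p.1)] = area A.
Proof.
move=> mA; transitivity (\int[mu]_x mu (ysection A x))%E.
  by rewrite area_sections; apply: eq_integral => x _; rewrite xsectionE ysectionE.
have := indic_fubini_tonelli mu mu mA.
rewrite indic_fubini_tonelli_FE// indic_fubini_tonelli_GE// => <- //.
Qed.

End Area.

Section Polar.
Context {R : realType}.
Notation mu := (@lebesgue_measure R).
Implicit Types (A B S : set (R * R)) (a b c k x y t : R).

Definition slope_section A t : set R := [set x | A (x, t * x)].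

Let h A (p : measurableTypeR R * measurableTypeR R) : \bar R :=
  (Num.max p.1 0 * \1_A (p.1, p.2 * p.1))%:E.

Let h_ge0 A p : (0 <= h A p)%E.
Proof. by rewrite lee_fin mulr_ge0// le_max lexx orbT. Qed.

Let measurable_h A : measurable A -> measurable_fun setT (h A).
Proof.
move=> mA; apply/measurable_EFinP; apply: measurable_funM.
  by apply: measurable_maxr => //; exact: measurable_fst.
have h1 : measurable_fun [set: measurableTypeR R * measurableTypeR R] (\1_A : _ -> R).
  exact: measurable_indic.
have h2 : measurable_fun [set: measurableTypeR R * measurableTypeR R]
    (fun p => ((p.1, p.2 * p.1) : measurableTypeR R * measurableTypeR R)).
  apply: measurable_fun_pair; first exact: measurable_fst.
  by apply: measurable_funM; [exact: measurable_snd|exact: measurable_fst].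
exact: (measurableT_comp h1 h2).
Qed.

Let moment_h A t : moment (slope_section A t) = (\int[mu]_x h A (x, t))%E.
Proof.
rewrite /moment integral_mkcond; apply: eq_integral => x _.
rewrite patchE /h /weight indicE /slope_section.
case: ifPn => xA.
  by move: xA; rewrite inE/= => xA; rewrite mem_set// mulr1.
by move: xA; rewrite notin_setE/= => xA; rewrite memNset// mulr0.
Qed.

(** Tonelli, after the substitution y = t x in the inner integral. *)
Lemma area_polar A : measurable A -> A `<=` [set p | 0 < p.1] ->
  area A = (\int[mu]_t moment (slope_section A t))%E.
Proof.
move=> mA A0.
transitivity (\int[mu]_x \int[mu]_t h A (x, t))%E; last first.
  rewrite (fubini_tonelli (h A)); first last.
  - exact: h_ge0.
  - exact: measurable_h.
  by apply: eq_integral => t _; rewrite moment_h.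
rewrite area_sections; apply: eq_integral => x _.
have [x0|x0] := lerP x 0.
  rewrite (_ : xsection A x = set0).
    by rewrite measure0 integral0_eq// => t _; rewrite /h /= max_r// mul0r.
  apply/seteqP; split=> // y; rewrite xsectionE/= => /A0/=.
  by rewrite ltNge x0.
rewrite -(@lebesgue_affine R x 0) ?gt_eqF//; last exact: measurable_xsection.
have mX : measurable ((fun y => (x * y + 0)%R) @^-1` xsection A x).
  by rewrite -[X in measurable X]setTI; apply: measurable_affine => //; exact: measurable_xsection.
under [RHS]eq_integral.
  move=> t _; rewrite /h /= max_l ?(ltW x0)// EFinM.
  rewrite (_ : \1_A (x, t * x) = \1_((fun y => (x * y + 0)%R) @^-1` xsection A x) t); last first.
    by rewrite !indicE xsectionE; congr ((nat_of_bool _)%:R); apply/idP/idP; rewrite !inE/= addr0 mulrC.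
  over.
rewrite ge0_integralZl_EFin ?ltW//.
  by rewrite integral_indic// setIT gtr0_norm.
by apply/measurable_EFinP; exact: measurable_indic.
Qed.

Lemma area_le_slope A B k : measurable A -> measurable B -> 0 <= k ->
  A `<=` [set p | 0 < p.1] -> B `<=` [set p | 0 < p.1] ->
  (forall t, (moment (slope_section A t) <= k%:E * moment (slope_section B t))%E) ->
  (area A <= k%:E * area B)%E.
Proof.
move=> mA mB k0 A0 B0 AB; rewrite !area_polar//.
have mm X : measurable X -> measurable_fun [set: measurableTypeR R] (fun t => moment (slope_section X t)).
  move=> mX; under eq_fun do rewrite moment_h.
  exact: (measurable_fun_fubini_tonelli_G (h X) (measurable_h X mX)).
rewrite -ge0_integralZl_EFin//; last 2 first.
- by move=> t _; exact: moment_ge0.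
- exact: mm.
apply: ge0_le_integral => //.
- by move=> t _; exact: moment_ge0.
- exact: mm.
- by apply: measurable_funeM; exact: mm.
Qed.

End Polar.

(** * Contraction of area under the inverse branches *)

Section Continuity.
Context {R : realType}.

Lemma open_ltf {T : topologicalType} (f g : T -> R) :
  continuous f -> continuous g -> open [set p | f p < g p].
Proof.
move=> cf cg; rewrite (_ : [set p | _] = (fun p => g p - f p) @^-1` [set x | 0 < x]).
  apply: open_comp; last exact: open_gt.
  by move=> p _; apply: continuousB; [exact: cg|exact: cf].
by apply/seteqP; split=> p /=; rewrite subr_gt0.
Qed.

Lemma continuous_fst_plane : continuous (fun p : R * R => p.1).
Proof. by move=> p; exact: continuous_fst. Qed.

Lemma continuous_snd_plane : continuous (fun p : R * R => p.2).
Proof. by move=> p; exact: continuous_snd. Qed.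

Lemma open_quarter : open (@quarter R).
Proof.
have c x : continuous (fun _ : R * R => x : R) by move=> ?; exact: cvg_cst.
rewrite (_ : quarter = ([set p : R * R | 0 < p.1] `&` [set p | p.1 < pi / 2]) `&`
  ([set p | 0 < p.2] `&` [set p | p.2 < pi / 2])).
  by do 2?apply: openI; apply: open_ltf => //;
    solve [exact: continuous_fst_plane | exact: continuous_snd_plane].
apply/seteqP; split=> p.
  by move=> [/andP[h1 h2] /andP[h3 h4]].
by move=> [[/= h1 h2] [/= h3 h4]]; split; apply/andP.
Qed.

Lemma continuous_half_fold : continuous (@half_fold R).
Proof.
move=> x; apply: (@continuous_min _ _ (fun x : R => x) (fun x => pi / 2 - x)).
  exact: cvg_id.
by apply: continuousB; [exact: cvg_cst|exact: cvg_id].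
Qed.

Lemma amplitude_itv (p : R * R) : quarter p -> 0 < amplitude p.1 p.2 < pi / 2.
Proof.
move=> [/andP[x0 xp] /andP[y0 yp]].
rewrite /amplitude lt_min gt_min !lt_max x0/= gt_max xp yp/=.
by rewrite subr_gt0 gt_min xp.
Qed.

Lemma half_fold_gt0 (x : R) : 0 < x < pi / 2 -> 0 < half_fold x.
Proof. by move=> /andP[x0 xp]; rewrite /half_fold lt_min x0 subr_gt0. Qed.

Lemma continuous_planar_map (lam : R) p : quarter p -> {for p, continuous (planar_map lam)}.
Proof.
move=> qp; have [q1 q2] := qp.
have cu : {for p, continuous (fun p : R * R => half_fold p.1)}.
  by apply: (@continuous_comp _ _ _ fst (@half_fold R)); [exact: continuous_fst|exact: continuous_half_fold].
have cv : {for p, continuous (fun p : R * R => half_fold p.2)}.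
  by apply: (@continuous_comp _ _ _ snd (@half_fold R)); [exact: continuous_snd|exact: continuous_half_fold].
have cN : {for p, continuous (fun p : R * R => amplitude p.1 p.2)}.
  apply: (@continuous_min _ _ (fun p : R * R => Num.max p.1 p.2) (fun p : R * R => pi / 2 - Num.min p.1 p.2)).
    by apply: (@continuous_max _ _ (fun p : R * R => p.1) (fun p : R * R => p.2));
      [exact: continuous_fst|exact: continuous_snd].
  apply: continuousB; first exact: cvg_cst.
  by apply: (@continuous_min _ _ (fun p : R * R => p.1) (fun p : R * R => p.2));
      [exact: continuous_fst|exact: continuous_snd].
have ct : {for p, continuous (fun p : R * R => tan (amplitude p.1 p.2))}.
  apply: (@continuous_comp _ _ _ (fun p : R * R => amplitude p.1 p.2) tan) => //.
  have /andP[a0 ap] := amplitude_itv p qp.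
  by apply: continuous_tan; rewrite gt_eqF// cos_pos// (ltW a0).
have sq (g : R * R -> R) : {for p, continuous g} -> {for p, continuous (fun p => g p ^+ 2)}.
  by move=> cg; apply: (@continuous_comp _ _ _ g (fun y : R => y ^+ 2)) => //; exact: exprn_continuous.
have cr : {for p, continuous (fun p : R * R => Num.sqrt (half_fold p.1 ^+ 2 + half_fold p.2 ^+ 2))}.
  apply: (@continuous_comp _ _ _ (fun p : R * R => half_fold p.1 ^+ 2 + half_fold p.2 ^+ 2) Num.sqrt); last exact: sqrt_continuous.
  by apply: continuousD; exact: sq.
have r0 : Num.sqrt (half_fold p.1 ^+ 2 + half_fold p.2 ^+ 2) != 0.
  by rewrite gt_eqF// sqrtr_gt0 ltr_wpDr ?sqr_ge0// exprn_gt0// half_fold_gt0.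
have ca : {for p, continuous (fun p : R * R => lam * tan (amplitude p.1 p.2) /
    Num.sqrt (half_fold p.1 ^+ 2 + half_fold p.2 ^+ 2))}.
  apply: continuousM; last exact: continuousV.
  by apply: continuousM => //; exact: cvg_cst.
by apply: continuous_pair; apply: continuousM.
Qed.

Lemma open_planar_map_preimage (lam : R) S : open S ->
  open (quarter `&` planar_map lam @^-1` S).
Proof.
move=> oS; rewrite openE => p [qp Sp]; apply: filterI.
  exact: open_nbhs_nbhs (conj open_quarter qp).
exact: (continuous_planar_map lam p qp) (open_nbhs_nbhs (conj oS Sp)).
Qed.

End Continuity.

Section Pieces.
Context {R : realType} (lam : R) (lam2 : Num.sqrt 2 < lam).
Implicit Types (S : set (R * R)) (x y t : R).

Let lam0 : 0 < lam.
Proof. by apply: le_lt_trans lam2; exact: sqrtr_ge0. Qed.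

(** The inverse of the least factor ray_scale t ^ 2, at t = 1. *)
Definition area_factor : R := 2 / lam ^+ 2.

Lemma area_factor_itv : 0 < area_factor < 1.
Proof.
have l0 := lam0.
have l2 : 2 < lam ^+ 2.
  have : Num.sqrt 2 ^+ 2 < lam ^+ 2 by rewrite ltr_sqr ?nnegrE ?sqrtr_ge0// ltW.
  by rewrite sqr_sqrtr.
by rewrite /area_factor divr_gt0 ?exprn_gt0//= ltr_pdivrMr ?exprn_gt0// mul1r.
Qed.

Lemma area_factor_ray_scale t : 0 <= t <= 1 -> 1 <= area_factor * ray_scale lam t ^+ 2.
Proof.
move=> /andP[t0 t1]; have l0 := lam0.
have h : 0 < 1 + t ^+ 2 by rewrite ltr_pwDl// sqr_ge0.
have -> : ray_scale lam t ^+ 2 = lam ^+ 2 / (1 + t ^+ 2) by rewrite -(ray_scale_sq lam t) mulfK// gt_eqF.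
rewrite /area_factor mulrA divfK ?gt_eqF ?exprn_gt0// ler_pdivlMr// mul1r.
by have : t ^+ 2 <= 1; [rewrite expr_le1|lra].
Qed.

Lemma slope_preimage_open S t : open S -> open [set x | S (x, t * x)].
Proof.
move=> oS; apply: (@open_comp _ _ (fun x : R => (x, t * x)) S) => // x _.
apply: continuous_pair; first exact: cvg_id.
by apply: continuousM; [exact: cvg_cst|exact: cvg_id].
Qed.

(** Up to the reflection that exchanges its two acute corners, the triangle below
    the diagonal consists of even_piece and, in the coordinates centred at
    (pi/2, 0), of odd_piece. The circle of radius lam separates their images. *)
Definition even_piece S := [set p : R * R | 0 < p.2 < p.1 /\ p.1 <= pi / 4 /\ S (planar_map lam p)].
Definition even_image S := [set p : R * R | 0 < p.2 < p.1 /\ p.1 ^+ 2 + p.2 ^+ 2 <= lam ^+ 2 /\ S p].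
Definition odd_piece S := [set p : R * R | 0 < p.2 <= p.1 /\ p.1 < pi / 4 /\ S (planar_map lam (pi / 2 - p.1, p.2))].
Definition odd_image S := [set p : R * R | 0 < p.2 <= p.1 /\ lam ^+ 2 < p.1 ^+ 2 + p.2 ^+ 2 /\ S p].

Lemma ray_scale_gt0 t : 0 < ray_scale lam t.
Proof. by rewrite /ray_scale divr_gt0 ?lam0// sqrt1_gt0. Qed.

Lemma in_disc t x : 0 < x -> (x ^+ 2 + (t * x) ^+ 2 <= lam ^+ 2) = (x <= ray_scale lam t).
Proof.
move=> x0; have m0 := ray_scale_gt0 t.
rewrite -(ray_scale_sq lam t) exprMn -{1}[x ^+ 2]mul1r -mulrDl [leLHS]mulrC.
rewrite ler_pM2r; last by rewrite ltr_pwDl// sqr_ge0.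
by rewrite ler_sqr ?nnegrE// ltW.
Qed.

(** On the ray of slope t the map is x |-> ray_scale t * tan x, and
    d^2 - c^2 <= tan^2 d - tan^2 c. *)
Lemma moment_even S t : open S ->
  (moment (slope_section (even_piece S) t) <=
   area_factor%:E * moment (slope_section (even_image S) t))%E.
Proof.
move=> oS; have p0 := pi_gt0 R; have /andP[k0 k1] := area_factor_itv.
have m0 := ray_scale_gt0 t.
have [/andP[t0 t1]|tn] := boolP (0 < t < 1); last first.
  rewrite (_ : slope_section _ _ = set0).
    rewrite /moment integral_set0; apply: mule_ge0; last exact: moment_ge0.
    by rewrite lee_fin ltW.
  apply/seteqP; split=> // x [/= /andP[h1 h2] _].
  have x0 : 0 < x by lra.
  case/negP: tn; rewrite -(pmulr_lgt0 _ x0) h1/= -(ltr_pM2r x0) mul1r h2 //.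
pose D := `]0, pi / 4]%classic : set R; pose J := `]0, ray_scale lam t]%classic : set R.
pose O := [set x | S (x, t * x)].
have -> : slope_section (even_piece S) t = D `&` (fun x => ray_scale lam t * tan x) @^-1` O.
  apply/seteqP; split=> x; rewrite /slope_section /even_piece /D /O /= in_itv/=.
    move=> [/andP[h1 h2] [h3]]; have x0 : 0 < x by lra.
    by rewrite planar_map_even ?x0 ?h3 ?t0 ?(ltW t1).
  move=> [/andP[x0 x4]]; rewrite -planar_map_even ?x0 ?t0 ?(ltW t1)// => h.
  by split; [rewrite mulr_gt0//= gtr_pMl|].
have -> : slope_section (even_image S) t = J `&` O.
  apply/seteqP; split=> x; rewrite /slope_section /even_image /J /O /= in_itv/=.
    move=> [/andP[h1 h2] [h3 h4]]; have x0 : 0 < x by lra.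
    by rewrite x0 -in_disc.
  move=> [/andP[x0 xm] h]; split; first by rewrite mulr_gt0//= gtr_pMl.
  by rewrite in_disc.
have tb x : D x -> [/\ 0 <= x, x <= pi / 4, x < pi / 2 & 0 < x].
  by rewrite /D /= in_itv/= => /andP[? ?]; split; lra.
apply: (@moment_fiber R D J O _ (pi / 4)) => //.
- exact: interval_is_interval.
- by move=> x /tb[? ? ? ?]; rewrite /= in_itv/=; apply/andP.
- exact: interval_is_interval.
- by move=> x; rewrite /J /= in_itv/= => /andP[/ltW].
- exact: ltW.
- move=> x /tb[h1 h2 h3 h4]; rewrite /J /= in_itv/= mulr_gt0 ?tan_gt0 ?h4//=.
  by rewrite ger_pMr// tan_le1// h1.
- left=> c d /tb[h1 h2 h3 h4] /tb[h5 h6 h7 h8] cd.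
  by rewrite ler_pM2l// tan_monoW// h1.
- move=> c d /tb[h1 h2 h3 h4] /tb[h5 h6 h7 h8] cd.
  have t01 : 0 <= t <= 1 by rewrite !ltW.
  have km := area_factor_ray_scale t t01.
  have cdp : 0 <= c <= d by rewrite h1 ltW.
  have sec : d - c <= tan d - tan c.
    apply: le_trans (tan_secant_ge c d cdp h7).
    by rewrite ler_peMr ?subr_ge0 ?(ltW cd)// lerDl sqr_ge0.
  have tc : c <= tan c by apply: tan_ge_id; rewrite h1.
  have td : d <= tan d by apply: tan_ge_id; rewrite h5.
  have h : d ^+ 2 - c ^+ 2 <= tan d ^+ 2 - tan c ^+ 2.
    by rewrite !subr_sqr; apply: ler_pM; lra.
  have h' : 0 <= tan d ^+ 2 - tan c ^+ 2.
    by apply: le_trans h; rewrite subr_ge0 ler_sqr ?nnegrE// ltW.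
  have hm : 0 <= ray_scale lam t ^+ 2 * (tan d ^+ 2 - tan c ^+ 2).
    by apply: mulr_ge0 => //; exact: sqr_ge0.
  have -> : (ray_scale lam t * tan d) ^+ 2 - (ray_scale lam t * tan c) ^+ 2 =
    ray_scale lam t ^+ 2 * (tan d ^+ 2 - tan c ^+ 2) by ring.
  rewrite (ger0_norm hm).
  by rewrite mulrA (le_trans h)// ler_peMl.
- exact: slope_preimage_open.
Qed.

(** As moment_even, with the inverse of tan, whose secants are steeper than
    those of tan on (0, pi/4) because tan is below 1 there. *)
Lemma moment_odd S t : open S ->
  (moment (slope_section (odd_piece S) t) <=
   area_factor%:E * moment (slope_section (odd_image S) t))%E.
Proof.
move=> oS; have p0 := pi_gt0 R; have /andP[k0 k1] := area_factor_itv.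
have p4 := pi_lt_16div5 (R := R).
have m0 := ray_scale_gt0 t.
have [/andP[t0 t1]|tn] := boolP (0 < t <= 1); last first.
  rewrite (_ : slope_section _ _ = set0).
    rewrite /moment integral_set0; apply: mule_ge0; last exact: moment_ge0.
    by rewrite lee_fin ltW.
  apply/seteqP; split=> // x [/= /andP[h1 h2] _].
  have x0 : 0 < x by lra.
  case/negP: tn; rewrite -(pmulr_lgt0 _ x0) h1/= -(ler_pM2r x0) mul1r h2 //.
pose D := `]0, pi / 4[%classic : set R; pose J := `]ray_scale lam t, +oo[%classic : set R.
pose O := [set x | S (x, t * x)].
have -> : slope_section (odd_piece S) t = D `&` (fun x => ray_scale lam t / tan x) @^-1` O.
  apply/seteqP; split=> x; rewrite /slope_section /odd_piece /D /O /= in_itv/=.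
    move=> [/andP[h1 h2] [h3]]; have x0 : 0 < x by lra.
    by rewrite planar_map_odd ?x0 ?h3 ?t0 ?(ltW h3).
  move=> [/andP[x0 x4]]; rewrite -planar_map_odd ?x0 ?t0 ?(ltW x4)// => h.
  by split; [rewrite mulr_gt0//= ler_piMl// ltW|].
have -> : slope_section (odd_image S) t = J `&` O.
  apply/seteqP; split=> x; rewrite /slope_section /odd_image /J /O /= in_itv/= andbT.
    move=> [/andP[h1 h2] [h3 h4]]; have x0 : 0 < x by lra.
    by split => //; rewrite ltNge -in_disc// -ltNge.
  move=> [xm h]; have x0 : 0 < x by exact: lt_trans xm.
  split; first by rewrite mulr_gt0//= ler_piMl// ltW.
  by rewrite ltNge in_disc// -ltNge.
have tb x : D x -> [/\ 0 <= x, x < pi / 4, x < pi / 2 & 0 < x].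
  by rewrite /D /= in_itv/= => /andP[? ?]; split; lra.
have tt x : D x -> [/\ 0 < tan x, tan x < 1 & x <= tan x].
  move=> /tb[h1 h2 h3 h4]; split; first by rewrite tan_gt0// h4.
    by rewrite -(tan_piquarter R) tan_mono ?h1//; lra.
  by rewrite tan_ge_id// h1.
apply: (@moment_fiber R D J O _ (pi / 4)) => //.
- exact: interval_is_interval.
- by move=> x /tb[? ? ? ?]; rewrite /= in_itv/=; apply/andP; split => //; exact: ltW.
- exact: interval_is_interval.
- by move=> x; rewrite /J /= in_itv/= andbT => /(lt_trans m0)/ltW.
- exact: ltW.
- move=> x /tt[h1 h2 _]; rewrite /J /= in_itv/= andbT.
  by rewrite ltr_pdivlMr// gtr_pMr.
- right=> c d Dc Dd cd; have [h1 h2 h3 h4] := tb c Dc; have [h5 h6 h7 h8] := tb d Dd.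
  have [tc0 _ _] := tt c Dc; have [td0 _ _] := tt d Dd.
  by rewrite ler_pM2l// lef_pV2 ?posrE// tan_monoW// h1.
- move=> c d Dc Dd cd; have [h1 h2 h3 h4] := tb c Dc; have [h5 h6 h7 h8] := tb d Dd.
  have [tc0 tc1 tcc] := tt c Dc; have [td0 td1 tdd] := tt d Dd.
  have t01 : 0 <= t <= 1 by rewrite t1 ltW.
  have km := area_factor_ray_scale t t01.
  have cdp : 0 <= c <= d by rewrite h1 ltW.
  have sec : d - c <= tan d - tan c.
    apply: le_trans (tan_secant_ge c d cdp h7).
    by rewrite ler_peMr ?subr_ge0 ?(ltW cd)// lerDl sqr_ge0.
  have ic : 1 <= (tan c)^-1 by rewrite invf_ge1// ltW.
  have id : 1 <= (tan d)^-1 by rewrite invf_ge1// ltW.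
  have icd : d - c <= (tan c)^-1 - (tan d)^-1.
    apply: (le_trans sec).
    have -> : (tan c)^-1 - (tan d)^-1 = (tan d - tan c) * ((tan c)^-1 * (tan d)^-1).
      by field; rewrite !gt_eqF.
    by rewrite ler_peMr ?mulr_ege1// subr_ge0; lra.
  have h : d ^+ 2 - c ^+ 2 <= (tan c)^-1 ^+ 2 - (tan d)^-1 ^+ 2.
    by rewrite !subr_sqr; apply: ler_pM; lra.
  have h' : 0 <= (tan c)^-1 ^+ 2 - (tan d)^-1 ^+ 2.
    by apply: le_trans h; rewrite subr_ge0 ler_sqr ?nnegrE// ltW.
  have hm : 0 <= ray_scale lam t ^+ 2 * ((tan c)^-1 ^+ 2 - (tan d)^-1 ^+ 2).
    by apply: mulr_ge0 => //; exact: sqr_ge0.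
  rewrite distrC.
  have -> : (ray_scale lam t / tan c) ^+ 2 - (ray_scale lam t / tan d) ^+ 2 =
    ray_scale lam t ^+ 2 * ((tan c)^-1 ^+ 2 - (tan d)^-1 ^+ 2) by ring.
  rewrite (ger0_norm hm).
  by rewrite mulrA (le_trans h)// ler_peMl.
- exact: slope_preimage_open.
Qed.

End Pieces.

Section Isometries.
Context {R : realType}.
Implicit Types (A B S : set (R * R)).

Lemma measurable_flip A : measurable A -> measurable [set p | A (p.2, p.1)].
Proof.
move=> mA.
have mf : measurable_fun [set: measurableTypeR R * measurableTypeR R]
   (fun p => (p.2, p.1)).
  by apply: measurable_fun_pair; [exact: measurable_snd|exact: measurable_fst].
by have := mf measurableT _ mA; rewrite setTI.
Qed.

Lemma measurable_affine_y (c a : R) A : measurable A ->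
  measurable [set p | A (p.1, c * p.2 + a)].
Proof.
move=> mA.
have mf : measurable_fun [set: measurableTypeR R * measurableTypeR R]
   (fun p => (p.1, c * p.2 + a) : measurableTypeR R * measurableTypeR R).
  apply: measurable_fun_pair; first exact: measurable_fst.
  by apply: (measurableT_comp (measurable_affine c a)); exact: measurable_snd.
by have := mf measurableT _ mA; rewrite setTI.
Qed.

Lemma measurable_affine_x (c a : R) A : measurable A ->
  measurable [set p | A (c * p.1 + a, p.2)].
Proof.
by move=> mA; have := measurable_flip _ (measurable_affine_y c a _ (measurable_flip _ mA)).
Qed.

Lemma area_affine_x c a A : `|c| = 1 -> measurable A ->
  area [set p | A (c * p.1 + a, p.2)] = area A.
Proof.
move=> c1 mA; have mF := measurable_flip _ mA.
have mG := measurable_affine_y c a _ mF.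
exact: (etrans (area_swap _ mG) (etrans (area_affine_y c a _ c1 mF) (area_swap _ mA))).
Qed.

Lemma area_flip_affine c a A : `|c| = 1 -> measurable A ->
  area [set p | A (p.2, c * p.1 + a)] = area A.
Proof.
move=> c1 mA; have mG := measurable_affine_y c a _ mA.
exact: (etrans (area_swap _ mG) (area_affine_y c a _ c1 mA)).
Qed.

Lemma area_setU A B : measurable A -> measurable B ->
  (area (A `|` B) <= area A + area B)%E.
Proof. by move=> mA mB; exact: measureU2. Qed.

Lemma area_disjoint A B : measurable A -> measurable B -> A `&` B = set0 ->
  area (A `|` B) = (area A + area B)%E.
Proof. by move=> mA mB AB; exact: measureU. Qed.

Lemma disjoint_sets A B : (forall p, A p -> B p -> False) -> A `&` B = set0.
Proof. by move=> AB; apply/seteqP; split=> // p [] /AB. Qed.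

Lemma sum4_le (k a1 a2 a3 a4 b1 b2 b3 b4 : \bar R) :
  (0 <= b1)%E -> (0 <= b2)%E -> (0 <= b3)%E -> (0 <= b4)%E ->
  (a1 <= k * b1)%E -> (a2 <= k * b2)%E -> (a3 <= k * b3)%E -> (a4 <= k * b4)%E ->
  ((a1 + a2) + (a3 + a4) <= k * ((b1 + b2) + (b3 + b4)))%E.
Proof.
move=> b10 b20 b30 b40 h1 h2 h3 h4.
rewrite ge0_muleDr ?adde_ge0// ge0_muleDr// ge0_muleDr//.
by apply: leeD; apply: leeD.
Qed.

End Isometries.

Section Triangle.
Context {R : realType} (lam : R) (lam2 : Num.sqrt 2 < lam).
Implicit Types (S : set (R * R)).

Let k : R := area_factor lam.
Let lam0 : 0 < lam.
Proof. by apply: le_lt_trans lam2; exact: sqrtr_ge0. Qed.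

Let mlt (f g : R * R -> R) : continuous f -> continuous g ->
  measurable [set p | f p < g p].
Proof. by move=> cf cg; apply: open_measurable_plane; exact: open_ltf. Qed.
Let cst (c : R) : continuous (fun _ : R * R => c).
Proof. by move=> ?; exact: cvg_cst. Qed.
Let fstc := @continuous_fst_plane R.
Let sndc := @continuous_snd_plane R.

Let sqsum : continuous (fun p : R * R => p.1 ^+ 2 + p.2 ^+ 2).
Proof.
move=> p; suff : {for p, continuous (fun p : R * R => p.1 ^+ 2 + p.2 ^+ 2)} by [].
apply: continuousD.
  by apply: (@continuous_comp _ _ _ fst (fun y : R => y ^+ 2)); [exact: fstc|exact: exprn_continuous].
by apply: (@continuous_comp _ _ _ snd (fun y : R => y ^+ 2)); [exact: sndc|exact: exprn_continuous].
Qed.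

Lemma measurable_even_piece S : open S -> measurable (even_piece lam S).
Proof.
move=> oS; have p0 := pi_gt0 R.
rewrite (_ : even_piece lam S = (([set p | 0 < p.2] `&` [set p | p.2 < p.1]) `&`
   (quarter `&` planar_map lam @^-1` S)) `\` [set p | pi / 4 < p.1]).
  apply: measurableD; last exact: mlt.
  apply: measurableI; first by apply: measurableI; exact: mlt.
  by apply: open_measurable_plane; exact: open_planar_map_preimage.
apply/seteqP; split=> p /=.
  move=> [/andP[h1 h2] [h3 h4]]; split; last by apply/negP; rewrite -leNgt.
  by split=> //; split=> //; split; apply/andP; split; lra.
by move=> [[[h1 h2] [_ h3]] /negP]; rewrite -leNgt => h4; split; [apply/andP|].
Qed.

Lemma measurable_even_image S : open S -> measurable (even_image lam S).
Proof.
move=> oS.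
rewrite (_ : even_image lam S = (([set p | 0 < p.2] `&` [set p | p.2 < p.1]) `&` S)
  `\` [set p | lam ^+ 2 < p.1 ^+ 2 + p.2 ^+ 2]).
  apply: measurableD; last exact: mlt.
  apply: measurableI; first by apply: measurableI; exact: mlt.
  exact: open_measurable_plane.
apply/seteqP; split=> p /=.
  by move=> [/andP[h1 h2] [h3 h4]]; split=> //; apply/negP; rewrite -leNgt.
by move=> [[[h1 h2] h3] /negP]; rewrite -leNgt => h4; split; [apply/andP|].
Qed.

Lemma measurable_odd_piece S : open S -> measurable (odd_piece lam S).
Proof.
move=> oS; have p0 := pi_gt0 R.
rewrite (_ : odd_piece lam S = (([set p | 0 < p.2] `&` [set p | p.1 < pi / 4]) `&`
   [set p | (quarter `&` planar_map lam @^-1` S) ((-1) * p.1 + pi / 2, p.2)]) `\` [set p | p.1 < p.2]).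
  apply: measurableD; last exact: mlt.
  apply: measurableI; first by apply: measurableI; exact: mlt.
  apply: measurable_affine_x.
  by apply: open_measurable_plane; exact: open_planar_map_preimage.
have e (x : R) : -1 * x + pi / 2 = pi / 2 - x by ring.
apply/seteqP; split=> p /=; rewrite e.
  move=> [/andP[h1 h2] [h3 h4]]; split; last by apply/negP; rewrite -leNgt.
  by split=> //; split=> //; split; apply/andP; split; rewrite /=; lra.
by move=> [[[h1 h2] [_ h3]] /negP]; rewrite -leNgt => h4; split; [apply/andP|].
Qed.

Lemma measurable_odd_image S : open S -> measurable (odd_image lam S).
Proof.
move=> oS.
rewrite (_ : odd_image lam S = (([set p | 0 < p.2] `&`
    [set p | lam ^+ 2 < p.1 ^+ 2 + p.2 ^+ 2]) `&` S) `\` [set p | p.1 < p.2]).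
  apply: measurableD; last exact: mlt.
  apply: measurableI; first by apply: measurableI; exact: mlt.
  exact: open_measurable_plane.
apply/seteqP; split=> p /=.
  by move=> [/andP[h1 h2] [h3 h4]]; split=> //; apply/negP; rewrite -leNgt.
by move=> [[[h1 h2] h3] /negP]; rewrite -leNgt => h4; split; [apply/andP|].
Qed.

Lemma area_even S : open S ->
  (area (even_piece lam S) <= k%:E * area (even_image lam S))%E.
Proof.
move=> oS; have /andP[k0 _] := area_factor_itv lam lam2.
apply: area_le_slope.
- exact: measurable_even_piece.
- exact: measurable_even_image.
- exact: ltW.
- by move=> p [/andP[h1 h2] _] /=; lra.
- by move=> p [/andP[h1 h2] _] /=; lra.
- by move=> t; exact: moment_even.
Qed.

Lemma area_odd S : open S ->
  (area (odd_piece lam S) <= k%:E * area (odd_image lam S))%E.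
Proof.
move=> oS; have /andP[k0 _] := area_factor_itv lam lam2.
apply: area_le_slope.
- exact: measurable_odd_piece.
- exact: measurable_odd_image.
- exact: ltW.
- by move=> p [/andP[h1 h2] _] /=; lra.
- by move=> p [/andP[h1 h2] _] /=; lra.
- by move=> t; exact: moment_odd.
Qed.

Definition triangle := [set p : R * R | 0 < p.2 < p.1 /\ p.1 < pi / 2].

Lemma open_flip S : open S -> open [set p | S (p.2, p.1)].
Proof.
move=> oS; apply: (@open_comp _ _ (fun p : R * R => (p.2, p.1)) S) => // p _.
by apply: continuous_pair; [exact: sndc|exact: fstc].
Qed.

Lemma planar_map_odd_below u v : 0 < v < u -> u <= pi / 4 ->
  (planar_map lam (pi / 2 - u, v)).2 < (planar_map lam (pi / 2 - u, v)).1.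
Proof.
move=> /andP[v0 vu] u4; have u0 : 0 < u by exact: lt_trans vu.
have p0 := pi_gt0 R.
have te : v / u * u = v by rewrite divfK// gt_eqF.
have t1 : v / u < 1 by rewrite ltr_pdivrMr// mul1r.
have t0 : 0 < v / u by rewrite divr_gt0.
rewrite -[v]te planar_map_odd ?u0 ?t0 ?u4 ?(ltW t1)//=.
by rewrite gtr_pMl// divr_gt0 ?ray_scale_gt0// tan_gt0// u0/=; lra.
Qed.

(** The triangle is the union of four isometric copies of even_piece or odd_piece;
    their images under the map are disjoint, being separated by the diagonal
    and by the circle of radius lam. *)
Lemma area_triangle_preimage S : open S ->
  (area (triangle `&` planar_map lam @^-1` S) <= k%:E * area S)%E.
Proof.
move=> oS; have p0 := pi_gt0 R; have /andP[k0 _] := area_factor_itv lam lam2.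
pose S1 := [set p | S (p.2, p.1)].
(* The images of both odd pieces would meet in the diagonal, which is left to the first. *)
pose S2 := S1 `&` [set p | p.2 < p.1].
have oS1 : open S1 by exact: open_flip.
have oS2 : open S2 by apply: openI => //; exact: open_ltf.
pose Q1 := even_piece lam S; pose Q2' := even_piece lam S1.
pose Q3' := odd_piece lam S; pose Q4' := odd_piece lam S2.
have mQ1 : measurable Q1 by exact: measurable_even_piece.
have mQ2' : measurable Q2' by exact: measurable_even_piece.
have mQ3' : measurable Q3' by exact: measurable_odd_piece.
have mQ4' : measurable Q4' by exact: measurable_odd_piece.
pose Q2 := [set p | Q2' ((-1) * p.2 + pi / 2, (-1) * p.1 + pi / 2)].
pose Q3 := [set p | Q3' ((-1) * p.1 + pi / 2, p.2)].
pose Q4 := [set p | Q4' (p.2, (-1) * p.1 + pi / 2)].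
have N1 : `|-1| = 1 :> R by rewrite normrN1.
have m4 := measurable_affine_y (-1) (pi / 2) _ mQ4'.
have m2 := measurable_affine_y (-1) (pi / 2) _ mQ2'.
have m2' := measurable_affine_x (-1) (pi / 2) _ m2.
have mQ2 : measurable Q2 by exact: measurable_flip m2'.
have mQ3 : measurable Q3 by exact: measurable_affine_x.
have mQ4 : measurable Q4 by exact: measurable_flip m4.
have a2 : area Q2 = area Q2'.
  exact: (etrans (area_swap _ m2') (etrans (area_affine_x (-1) (pi / 2) _ N1 m2)
    (area_affine_y (-1) (pi / 2) _ N1 mQ2'))).
have a3 : area Q3 = area Q3' by exact: area_affine_x.
have a4 : area Q4 = area Q4' by exact: (area_flip_affine _ (pi / 2) _ N1 mQ4').
pose E1 := even_image lam S; pose E2' := even_image lam S1.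
pose E3 := odd_image lam S; pose E4' := odd_image lam S2.
have mE1 : measurable E1 by exact: measurable_even_image.
have mE2' : measurable E2' by exact: measurable_even_image.
have mE3 : measurable E3 by exact: measurable_odd_image.
have mE4' : measurable E4' by exact: measurable_odd_image.
pose E2 := [set p | E2' (p.2, p.1)]; pose E4 := [set p | E4' (p.2, p.1)].
have mE2 : measurable E2 by exact: measurable_flip.
have mE4 : measurable E4 by exact: measurable_flip.
have b2 : area E2 = area E2' by exact: area_swap.
have b4 : area E4 = area E4' by exact: area_swap.
have e (x : R) : -1 * x + pi / 2 = pi / 2 - x by ring.
have cover : triangle `&` planar_map lam @^-1` S `<=` (Q1 `|` Q2) `|` (Q3 `|` Q4).
  move=> [x y] [[h xp] Sp]; move: h xp => /= h xp.
  have /andP[y0 yx] := h.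
  have [x4|x4] := leP x (pi / 4).
    by left; left; exact: (conj h (conj x4 Sp)).
  have [y4|y4] := leP (pi / 4) y.
    left; right; suff : Q2' (pi / 2 - y, pi / 2 - x) by rewrite /Q2 /= !e.
    have h' : 0 < pi / 2 - x < pi / 2 - y by lra.
    have h2 : pi / 2 - y <= pi / 4 by lra.
    have h3 : S1 (planar_map lam (pi / 2 - y, pi / 2 - x)).
      change (S ((planar_map lam (pi / 2 - y, pi / 2 - x)).2, (planar_map lam (pi / 2 - y, pi / 2 - x)).1)).
      by rewrite -planar_map_swap planar_map_center.
    exact: (conj h' (conj h2 h3)).
  right; have [yc|yc] := leP y (pi / 2 - x).
    left; suff : Q3' (pi / 2 - x, y) by rewrite /Q3 /= !e.
    have h' : 0 < y <= pi / 2 - x by lra.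
    have h2 : pi / 2 - x < pi / 4 by lra.
    have h3 : S (planar_map lam (pi / 2 - (pi / 2 - x), y)) by rewrite subKr.
    exact: (conj h' (conj h2 h3)).
  right; suff : Q4' (y, pi / 2 - x) by rewrite /Q4 /= !e.
  have h' : 0 < pi / 2 - x <= y by lra.
  have h3 : S1 (planar_map lam (pi / 2 - y, pi / 2 - x)).
    change (S ((planar_map lam (pi / 2 - y, pi / 2 - x)).2, (planar_map lam (pi / 2 - y, pi / 2 - x)).1)).
    by rewrite -planar_map_swap planar_map_center.
  have h4 : (planar_map lam (pi / 2 - y, pi / 2 - x)).2 < (planar_map lam (pi / 2 - y, pi / 2 - x)).1.
    by apply: planar_map_odd_below; lra.
  exact: (conj h' (conj y4 (conj h3 h4))).
have mcover : measurable ((Q1 `|` Q2) `|` (Q3 `|` Q4)).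
  by apply: measurableU; apply: measurableU.
have mT : measurable (triangle `&` planar_map lam @^-1` S).
  rewrite (_ : _ `&` _ = ([set p | 0 < p.2] `&` [set p | p.2 < p.1]) `&`
     (quarter `&` planar_map lam @^-1` S)).
    apply: open_measurable_plane; apply: openI; last exact: open_planar_map_preimage.
    by apply: openI; exact: open_ltf.
  apply/seteqP; split=> p.
    move=> [[/andP[h1 h2] h3] h4].
    have q : quarter p by split; apply/andP; split; lra.
    exact: (conj (conj h1 h2) (conj q h4)).
  move=> [[h1 h2] [[/andP[_ h3] _] h4]].
  exact: (conj (conj (introT andP (conj h1 h2)) h3) h4).
apply: (le_trans (le_area _ _ mT mcover cover)).
apply: (@le_trans _ _ ((area Q1 + area Q2) + (area Q3 + area Q4))%E).
  apply: (le_trans (area_setU _ _ _ _)).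
  - exact: measurableU.
  - exact: measurableU.
  - by apply: leeD; exact: area_setU.
rewrite a2 a3 a4.
apply: (@le_trans _ _ (k%:E * ((area E1 + area E2) + (area E3 + area E4)))%E).
  apply: sum4_le; rewrite ?b2 ?b4.
  - exact: area_ge0.
  - exact: area_ge0.
  - exact: area_ge0.
  - exact: area_ge0.
  - exact: area_even.
  - exact: area_even.
  - exact: area_odd.
  - exact: area_odd.
apply: lee_wpmul2l; first by rewrite lee_fin ltW.
have mE12 : measurable (E1 `|` E2) by exact: measurableU.
have mE34 : measurable (E3 `|` E4) by exact: measurableU.
have d12 : E1 `&` E2 = set0.
  by apply: disjoint_sets => p [/andP[_ h1] _] [/andP[_ h2] _]; move: h1 h2 => /=; lra.
have d34 : E3 `&` E4 = set0.
  by apply: disjoint_sets => p [/andP[_ h1] _] [_ [_ [_ h2]]]; move: h1 h2 => /=; lra.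
have in12 p : (E1 `|` E2) p -> p.1 ^+ 2 + p.2 ^+ 2 <= lam ^+ 2.
  by case=> [[_ [h _]]|[_ [h _]]]; [exact: h|rewrite addrC; exact: h].
have out34 p : (E3 `|` E4) p -> lam ^+ 2 < p.1 ^+ 2 + p.2 ^+ 2.
  by case=> [[_ [h _]]|[_ [h _]]]; [exact: h|rewrite addrC; exact: h].
have d : (E1 `|` E2) `&` (E3 `|` E4) = set0.
  apply: disjoint_sets => p /in12 h1 /out34 h2.
  by have := lt_le_trans h2 h1; rewrite ltxx.
rewrite -(area_disjoint _ _ mE1 mE2 d12) -(area_disjoint _ _ mE3 mE4 d34).
rewrite -(area_disjoint _ _ mE12 mE34 d).
apply: le_area; first exact: measurableU.
  exact: open_measurable_plane.
move=> [x y] [[[_ [_ h]]|[_ [_ h]]]|[[_ [_ h]]|[_ [_ [h _]]]]]; exact: h.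
Qed.

End Triangle.

(** * Gaps are empty *)

Section ConnectedPlane.
Context {R : realType}.
Implicit Types (V : set (R * R)) (h : R * R -> R).

Lemma continuous_subf {T : topologicalType} (f g : T -> R) :
  continuous f -> continuous g -> continuous (fun p => f p - g p).
Proof.
move=> cf cg p; suff : {for p, continuous (fun p => f p - g p)} by [].
by apply: continuousB; [exact: cf|exact: cg].
Qed.

Lemma connected_sign V h p q : connected V -> continuous h ->
  (forall p, V p -> h p != 0) -> V p -> V q -> 0 < h p -> 0 < h q.
Proof.
move=> cV ch h0 Vp Vq hp; rewrite ltNge; apply/negP => hq.
have : connected (h @` V).
  by apply: connected_continuous_connected => //; exact: continuous_subspaceT.
move/connected_intervalP => /(_ (h q) (h p)) H.
have [r Vr hr] : (h @` V) 0.
  by apply: H; [exists q|exists p|rewrite hq (ltW hp)].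
by have := h0 r Vr; rewrite hr eqxx.
Qed.

Lemma connected_lattice V h (c : R) : 0 < c -> connected V -> continuous h ->
  (forall p (k : int), V p -> h p != k%:~R * c) ->
  exists k : int, forall p, V p -> k%:~R * c < h p < (k + 1)%:~R * c.
Proof.
move=> c0 cV ch hk.
have [[p Vp]|nV] := pselect (exists p, V p); last first.
  by exists 0 => p Vp; case: nV; exists p.
exists (Num.floor (h p / c)); set k := Num.floor _ => q Vq.
have := floor_itv (h p / c); rewrite -/k => /andP[k1 k2].
rewrite ler_pdivlMr// in k1; rewrite ltr_pdivrMr// in k2.
have k1' : k%:~R * c < h p by rewrite lt_neqAle k1 eq_sym hk.
have cst (b : R) : continuous (fun _ : R * R => b) by move=> ?; exact: cvg_cst.
have c1 : continuous (fun q => h q - k%:~R * c).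
  exact: continuous_subf.
have c2 : continuous (fun q => (k + 1)%:~R * c - h q).
  exact: continuous_subf.
apply/andP; split.
  rewrite -subr_gt0; apply: (connected_sign V _ p q cV c1) => //.
    by move=> r Vr; rewrite subr_eq0 hk.
  by rewrite subr_gt0.
rewrite -subr_gt0; apply: (connected_sign V _ p q cV c2) => //.
  by move=> r Vr; rewrite subr_eq0 eq_sym hk.
by rewrite subr_gt0.
Qed.

(** The union of the horizontal segments, each joined to one vertical segment. *)
Lemma connected_rectangle (a b c d : R) :
  connected (`]a, b[%classic `*` `]c, d[%classic : set (R * R)).
Proof.
set B := _ `*` _.
have [[[x0 y0] [/= hx hy]]|nB] := pselect (exists p, B p); last first.
  rewrite (_ : B = set0); first exact: connected0.
  by apply/seteqP; split=> // p Bp; case: nB; exists p.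
rewrite !in_itv/= in hx hy; case/andP: hx => ax xb; case/andP: hy => cy yd.
pose line y : set (R * R) := (fun x => (x, y)) @` `]a, b[%classic.
pose column : set (R * R) := (fun y => (x0, y)) @` `]c, d[%classic.
have iv (u v : R) : connected (`]u, v[%classic : set R).
  by apply/connected_intervalP; exact: interval_is_interval.
have -> : B = \bigcup_(y in `]c, d[%classic) (line y `|` column).
  apply/seteqP; split=> [[x y] [/= hx hy]|p [y hy [[x hx <-]|[y' hy' <-]]]].
  - by exists y => //; left; exists x.
  - by split.
  - by split => //=; rewrite in_itv/= ax.
apply: bigcup_connected.
  exists (x0, y0) => y hy; right; exists y0 => //=; rewrite in_itv/=; exact/andP.
move=> y hy; apply: connectedU.
- exists (x0, y); split; first by exists x0 => //=; rewrite in_itv/=; exact/andP.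
  by exists y.
- apply: connected_continuous_connected => //; apply: continuous_subspaceT => x.
  by apply: continuous_pair; [exact: cvg_id|exact: cvg_cst].
- apply: connected_continuous_connected => //; apply: continuous_subspaceT => x.
  by apply: continuous_pair; [exact: cvg_cst|exact: cvg_id].
Qed.

End ConnectedPlane.

Section Core.
Context {R : realType} (lam : R) (W : set (R * R)) (gW : gap lam W)
  (lam2 : Num.sqrt 2 < lam).
Implicit Types (V A : set (R * R)) (g : R * R -> R * R).

Definition gap_motion g := [/\ continuous g, forall p, W p -> W (g p) &
  forall A, open A -> area (g @^-1` A) = area A].

Lemma gap_motion_comp f g : gap_motion f -> gap_motion g -> gap_motion (f \o g).
Proof.
move=> [cf Wf af] [cg Wg ag]; split.
- by move=> p; apply: continuous_comp; [exact: cg|exact: cf].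
- by move=> p /Wg/Wf.
- move=> A oA; rewrite -(af A oA) -(ag (f @^-1` A))//.
  by apply: open_comp => // p _; exact: cf.
Qed.

Lemma gap_motion_swap : gap_motion (fun p => (p.2, p.1)).
Proof.
split=> [p|[x y]|A oA].
- by apply: continuous_pair; [exact: continuous_snd|exact: continuous_fst].
- exact: (gap_swap _ _ gW).
- by apply: area_swap; exact: open_measurable_plane.
Qed.

Lemma unfold_affine (k : int) : exists2 c : R, `|c| = 1 & exists a, forall x : R, unfold k x = c * x + a.
Proof.
rewrite /unfold; case: (odd _).
  by exists (-1); [rewrite normrN1|exists ((k + 1)%:~R * (pi / 2)) => x; rewrite intrD; ring].
by exists 1; [rewrite normr1|exists (- (k%:~R * (pi / 2))) => x; ring].
Qed.

Lemma gap_motion_unfold_x k : gap_motion (fun p => (unfold k p.1, p.2)).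
Proof.
have [c c1 [a ua]] := unfold_affine k; split=> [p|[x y]|A oA].
- have -> : (fun p : R * R => (unfold k p.1, p.2)) = (fun p => (c * p.1 + a, p.2)).
    by apply/funext => q; rewrite ua.
  suff : {for p, continuous (fun p : R * R => (c * p.1 + a, p.2))} by [].
  apply: continuous_pair; last exact: continuous_snd.
  apply: (@continuousD _ _ _ (fun p : R * R => c * p.1) (fun=> a)); last exact: cvg_cst.
  by apply: continuousM; [exact: cvg_cst|exact: continuous_fst].
- exact: (gap_unfold_x lam W gW k x y).1.
- have -> : (fun p : R * R => (unfold k p.1, p.2)) @^-1` A = [set p | A (c * p.1 + a, p.2)].
    by apply/funext => p; rewrite /preimage /= ua.
  by apply: area_affine_x => //; exact: open_measurable_plane.
Qed.

Lemma gap_motion_unfold_y k : gap_motion (fun p => (p.1, unfold k p.2)).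
Proof.
exact: (gap_motion_comp _ _ gap_motion_swap
  (gap_motion_comp _ _ (gap_motion_unfold_x k) gap_motion_swap)).
Qed.

Lemma gap_motion_connected g V : gap_motion g -> connected V -> V `<=` W ->
  connected (g @` V) /\ g @` V `<=` W.
Proof.
move=> [cg Wg _] cV VW; split.
  by apply: connected_continuous_connected => //; exact: continuous_subspaceT.
by move=> _ [p /VW/Wg Wp <-].
Qed.

(** W avoids the lattice lines and the diagonals, so the signs that locate a point
    in the tiling by triangles are constant on a connected subset. *)
Lemma fold_to_triangle V : connected V -> V `<=` W ->
  exists2 g, gap_motion g & forall p, V p -> triangle (g p).
Proof.
move=> cV VW; have p2 : 0 < pi / 2 :> R by rewrite divr_gt0// pi_gt0.
have [k hk] : exists k : int, forall p, V p -> k%:~R * (pi / 2) < p.1 < (k + 1)%:~R * (pi / 2).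
  apply: connected_lattice => //; first exact: continuous_fst_plane.
  by move=> [x y] k /VW /= Wp; apply/eqP => e; apply: (gap_lattice_x lam W gW k y); rewrite -e.
have [l hl] : exists k : int, forall p, V p -> k%:~R * (pi / 2) < p.2 < (k + 1)%:~R * (pi / 2).
  apply: connected_lattice => //; first exact: continuous_snd_plane.
  by move=> [x y] l /VW /= Wp; apply/eqP => e; apply: (gap_lattice_y lam W gW l x); rewrite -e.
pose g := fun p : R * R => (unfold k p.1, unfold l p.2).
have mg : gap_motion g.
  exact: (gap_motion_comp _ _ (gap_motion_unfold_x k) (gap_motion_unfold_y l)).
have gq p : V p -> quarter (g p).
  by move=> Vp; split; apply: unfold_itv; [exact: hk|exact: hl].
have [cU UW] := gap_motion_connected g V mg cV VW.
have cd : continuous (fun p : R * R => p.1 - p.2).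
  apply: continuous_subf; [exact: continuous_fst_plane|exact: continuous_snd_plane].
have d0 p : (g @` V) p -> p.1 - p.2 != 0.
  move=> Up; apply/eqP => /eqP; rewrite subr_eq0 => /eqP e.
  move: (UW p Up); case: p Up e => x y _ /= ->; exact: (gap_diag lam W gW lam2).
have [[p [Vp pd]]|np] := pselect (exists p, V p /\ 0 < (g p).1 - (g p).2).
  exists g => // q Vq; have [/andP[q1 q2] /andP[q3 q4]] := gq q Vq.
  have Up : (g @` V) (g p) by exists p.
  have Uq : (g @` V) (g q) by exists q.
  have := connected_sign _ _ _ _ cU cd d0 Up Uq pd.
  by rewrite subr_gt0 => qd; split; [apply/andP|].
exists (fun p => ((g p).2, (g p).1)).
  exact: (gap_motion_comp _ _ gap_motion_swap mg).
move=> q Vq; have [/andP[q1 q2] /andP[q3 q4]] := gq q Vq.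
split => //=; apply/andP; split => //.
have Uq : (g @` V) (g q) by exists q.
have dq := d0 _ Uq; rewrite -subr_lt0 lt_neqAle dq/= leNgt.
by apply/negP => h; apply: np; exists q.
Qed.

Lemma open_triangle : open (@triangle R).
Proof.
have cst (b : R) : continuous (fun _ : R * R => b) by move=> ?; exact: cvg_cst.
rewrite (_ : triangle = ([set p : R * R | 0 < p.2] `&` [set p : R * R | p.2 < p.1]) `&`
  [set p : R * R | p.1 < pi / 2]).
  by apply: openI; [apply: openI|]; apply: open_ltf => //;
    solve [exact: continuous_fst_plane | exact: continuous_snd_plane].
apply/seteqP; split=> p.
  by move=> [/andP[]].
by move=> [[h1 h2] h3]; split; first exact/andP.
Qed.

Lemma triangle_quarter (p : R * R) : triangle p -> quarter p.
Proof. by move=> [/andP[h1 h2] h3]; split; apply/andP; split; lra. Qed.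

Lemma open_triangle_preimage A : open A -> open (triangle `&` planar_map lam @^-1` A).
Proof.
move=> oA; rewrite (_ : _ `&` _ = triangle `&` (quarter `&` planar_map lam @^-1` A)).
  by apply: openI; [exact: open_triangle|exact: open_planar_map_preimage].
apply/seteqP; split=> [p [Tp Ap]|p [Tp [_ Ap]]].
  exact: (conj Tp (conj (triangle_quarter p Tp) Ap)).
exact: (conj Tp Ap).
Qed.

(** The image of V is again connected, so the estimate for it can be pulled back
    through the triangle into which V is folded. *)
Lemma connected_small n V : connected V -> V `<=` W ->
  exists S, [/\ open S, V `<=` S &
    (area S <= (area_factor lam ^+ n * (pi / 2) ^+ 2)%:E)%E].
Proof.
elim: n V => [|n IH] V cV VW.
all: have [g mg gV] := fold_to_triangle V cV VW; have [cg Wg ag] := mg.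
all: have og A : open A -> open (g @^-1` A) by move=> oA; apply: open_comp => // p _; exact: cg.
  exists (g @^-1` triangle); split.
  - by apply: og; exact: open_triangle.
  - by move=> p /gV.
  - have p0 := pi_gt0 R; have p20 : 0 <= pi / 2 :> R by lra.
    rewrite (ag _ open_triangle) expr0 mul1r.
    have -> : ((pi / 2) ^+ 2)%:E = area (`]0, pi / 2[%classic `*` `]0, pi / 2[%classic : set (R * R)).
      by rewrite area_rect// !subr0.
    apply: le_area.
    + by apply: open_measurable_plane; exact: open_triangle.
    + by apply: measurableX; exact: measurable_itv.
    + by move=> p /triangle_quarter[h1 h2]; split; rewrite /= in_itv.
have [cU UW] := gap_motion_connected g V mg cV VW.
have qU p : (g @` V) p -> quarter p by move=> [q /gV Tq <-]; exact: triangle_quarter.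
have [||S [oS US aS]] := IH (planar_map lam @` (g @` V)).
- apply: connected_continuous_connected => //.
  apply: continuous_in_subspaceT => p /set_mem /qU qp; exact: continuous_planar_map.
- by move=> _ [p Up <-]; rewrite -(gap_map _ _ gW p (qU p Up)); exact: UW.
have oT := open_triangle_preimage S oS.
exists (g @^-1` (triangle `&` planar_map lam @^-1` S)); split.
- exact: og.
- move=> p Vp; split; first exact: gV.
  by apply: US; exists (g p) => //; exists p.
- rewrite (ag _ oT); apply: (le_trans (area_triangle_preimage lam lam2 S oS)).
  rewrite exprS -mulrA (EFinM (area_factor lam) (area_factor lam ^+ n * _)); apply: lee_wpmul2l => //.
  by rewrite lee_fin; have /andP[/ltW] := area_factor_itv lam lam2.
Qed.

Theorem gap_empty p : ~ W p.
Proof.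
move=> Wp; have oW := gap_open _ _ gW.
have : nbhs p W by exact: open_nbhs_nbhs.
case: p Wp => x y Wp /nbhs_ballP[e /= e0 eW].
pose B := `]x - e, x + e[%classic `*` `]y - e, y + e[%classic : set (R * R).
have BW : B `<=` W.
  move=> [u v] [/=]; rewrite !in_itv/= => hu hv; apply: eW; split; rewrite /ball /=.
    by rewrite distrC ltr_distl.
  by rewrite distrC ltr_distl.
have aB : area B = ((2 * e) ^+ 2)%:E.
  by rewrite area_rect ?lerD2l; [congr EFin; ring|lra|lra].
have /andP[k0 k1] := area_factor_itv lam lam2; have p0 := pi_gt0 R.
have ki : 1 < (area_factor lam)^-1 by rewrite invf_gt1.
have e20 : 0 < (2 * e) ^+ 2 by rewrite exprn_gt0// mulr_gt0.
have [n hn] := exp_unbounded (area_factor lam)^-1 ((2 * e) ^+ 2) ((pi / 2) ^+ 2) ki e20.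
have [S [oS BS aS]] := connected_small n B (connected_rectangle _ _ _ _) BW.
have mB : measurable B by apply: measurableX; exact: measurable_itv.
have : (area B <= (area_factor lam ^+ n * (pi / 2) ^+ 2)%:E)%E.
  by apply: le_trans aS; apply: le_area => //; exact: open_measurable_plane.
rewrite aB lee_fin leNgt => /negP; apply.
by move: hn; rewrite exprVn ltr_pdivlMr ?exprn_gt0// mulrC.
Qed.

End Core.

(** * Escaping points on the axis *)

Section Axis.
Context {R : realType} (lam : R) (lam1 : 1 < lam).
Implicit Types (x y s t : R) (k : int).

Let lam0 : 0 < lam. Proof. exact: lt_trans lam1. Qed.

Lemma Tl_axis_ge0 x : 0 <= x < pi / 2 -> Tl lam (x, 0, 0) = Some (lam * tan x, 0, 0).
Proof.
move=> /andP[x0 xp]; have p0 := pi_gt0 R.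
have z : `|0 - 0%:~R * (pi / 2)| <= pi / 4 :> R by rewrite mul0r subr0 normr0; lra.
have e (u c : R) : 0 < u -> c / Num.sqrt (u ^+ 2 + 0 ^+ 2) * u = c.
  by move=> u0; rewrite expr0n addr0 sqrtr_sqr gtr0_norm// divfK// gt_eqF.
have [xq|xq] := leP x (pi / 4).
  have hx : `|x - 0%:~R * (pi / 2)| <= pi / 4 by rewrite mul0r subr0 ger0_norm.
  rewrite (Tl_even lam 0 0 _ _ _ _ hx z erefl (fold_coord0 x) (fold_coord0 0)) normr0.
  rewrite max_l// ger0_norm//= mulr0; move: x0; rewrite le_eqVlt => /predU1P[<-|x0].
    by rewrite tan0 !mulr0.
  by rewrite e.
have hx : `|x - 1%:~R * (pi / 2)| <= pi / 4 by rewrite mul1r ler_norml; apply/andP; split; lra.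
have u0 : 0 < pi / 2 - x by lra.
rewrite (Tl_odd lam 1 0 _ _ _ _ hx z erefl (fold_coord1 x) (fold_coord0 0)).
  by rewrite normr0 max_l// (gtr0_norm u0) subKr /= mulr0 e.
by rewrite normr0 max_l// (gtr0_norm u0).
Qed.

Lemma Tl_axis_shift x k : Tl lam (x + k%:~R * pi, 0, 0) = Tl lam (x, 0, 0).
Proof.
have step n y : Tl lam (y + n%:R * pi, 0, 0) = Tl lam (y, 0, 0).
  elim: n => [|n IH]; first by rewrite mul0r addr0.
  by rewrite -natr1 mulrDl mul1r addrA TlE T_shift_x -TlE.
case: k => n; first exact: step.
by rewrite -(step n.+1 (x + _)) NegzE mulrNz mulNr subrK.
Qed.

(** The inverse branches of x |-> lam * tan x. *)
Definition axis_branch k s := k%:~R * pi + atan (s / lam).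

Lemma Tl_axis_branch k s : Tl lam (axis_branch k s, 0, 0) = Some (s, 0, 0).
Proof.
rewrite /axis_branch addrC Tl_axis_shift.
have pos t : 0 <= t -> Tl lam (atan (t / lam), 0, 0) = Some (t, 0, 0).
  move=> t0; have := Tl_axis_ge0 (atan (t / lam)).
  rewrite atanK [lam * _]mulrC divfK ?gt_eqF// => -> //.
  by rewrite atan_ltpi2 andbT -[leLHS](@atan0 R) le_atan// divr_ge0// ltW.
have [s0|s0] := leP 0 s; first exact: pos.
have h := pos (- s); rewrite oppr_ge0 in h; have {}h := h (ltW s0).
have e : Tl lam (neg_x (- atan (s / lam), 0, 0)) = omap neg_x (Tl lam (- atan (s / lam), 0, 0)).
  by apply: Tl_sym; [exact: T_neg_x|move=> q'; rewrite /scale3/neg_x/= mulrN].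
rewrite mulNr atanN in h; move: e; rewrite h /neg_x /= !opprK //.
Qed.

Definition axis_escapes x := escapes (Tl lam) (x, 0, 0).

Lemma axis_escapes_branch k s : axis_escapes (axis_branch k s) <-> axis_escapes s.
Proof.
rewrite /axis_escapes escapesS Tl_axis_branch; split=> [[q [<-]]//|h].
by exists (s, 0, 0).
Qed.

Lemma axis_escapesN x : axis_escapes x -> axis_escapes (- x).
Proof. exact: (escapes_neg_x lam (x, 0, 0)). Qed.

Lemma atan_ge0 s : 0 <= s -> 0 <= atan s.
Proof. by move=> s0; rewrite -(@atan0 R) le_atan. Qed.

Lemma axis_branch_le k s t : s <= t -> axis_branch k s <= axis_branch k t.
Proof. by move=> st; rewrite lerD2l le_atan// ler_pM2r ?invr_gt0. Qed.

Lemma atan_lipschitz s t : s <= t -> atan t - atan s <= t - s.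
Proof.
have pos (u v : R) : 0 <= u <= v -> atan v - atan u <= v - u.
  move=> /andP[u0 uv].
  have a0 := atan_ge0 _ u0.
  have auv : atan u <= atan v by exact: le_atan.
  have h : 0 <= atan u <= atan v by rewrite a0.
  have := tan_secant_ge (atan u) (atan v) h (atan_ltpi2 v); rewrite !atanK.
  by apply: le_trans; rewrite ler_peMr ?subr_ge0// lerDl sqr_ge0.
move=> st; have [s0|s0] := leP 0 s; first by apply: pos; rewrite s0.
have [t0|t0] := leP t 0.
  by have := pos (- t) (- s); rewrite !atanN oppr_ge0 t0 lerN2 st => /(_ isT); lra.
have := pos 0 t; rewrite lexx (ltW t0) atan0 => /(_ isT).
by have := pos 0 (- s); rewrite lexx oppr_ge0 (ltW s0) atan0 atanN => /(_ isT); lra.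
Qed.

(** The chain of preimages of 0 along the branches m, m + 1, ..., m + n - 1. *)
Fixpoint pullback (n m : nat) : R :=
  if n is n'.+1 then axis_branch m (pullback n' m.+1) else 0.

Lemma pullback_bounds n m : 0 <= pullback n m <= m%:R * pi + pi / 2.
Proof.
have p0 := pi_gt0 R.
have mp j : 0 <= j%:R * pi :> R by rewrite mulr_ge0// ltW.
case: n => [|n] /=; first by have := mp m; move=> h; apply/andP; split; lra.
rewrite /axis_branch lerD2l (ltW (atan_ltpi2 _)) andbT.
elim: n m => [|n IH] m /=; first by rewrite mul0r atan0 addr0; exact: mp.
by apply: addr_ge0; [exact: mp|rewrite atan_ge0// divr_ge0 ?IH// ltW].
Qed.

Lemma pullback_mono n m : pullback n m <= pullback n.+1 m.
Proof.
elim: n m => [|n IH] m; first by case/andP: (pullback_bounds 1 m).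
exact: axis_branch_le.
Qed.

(** The limit of these chains lies in the branch m, and is mapped to the limit
    for m + 1; so its orbit runs to infinity. *)
Definition axis_point (m : nat) : R := limn (pullback^~ m).

Lemma cvg_pullback m : pullback^~ m @ \oo --> axis_point m.
Proof.
apply: nondecreasing_is_cvgn.
  by apply/nondecreasing_seqP => n; exact: pullback_mono.
by exists (m%:R * pi + pi / 2) => _ [n _ <-]; case/andP: (pullback_bounds n m).
Qed.

Lemma axis_pointE m : axis_point m = axis_branch m (axis_point m.+1).
Proof.
have h1 : (fun n => pullback n.+1 m) @ \oo --> axis_point m.
  by have := cvg_pullback m; rewrite -(cvg_shiftS (pullback^~ m)).
apply: (cvg_unique _ h1) => //.
have c : {for axis_point m.+1, continuous (axis_branch m)}.
  apply: (@continuousD _ _ _ (fun=> m%:R * pi) (fun s => atan (s / lam))); first exact: cvg_cst.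
  apply: (@continuous_comp _ _ _ (fun s => s / lam) atan); last exact: continuous_atan.
  by apply: continuousM; [exact: cvg_id|exact: cvg_cst].
exact: (continuous_cvg _ c (cvg_pullback m.+1)).
Qed.

Lemma axis_point_ge m : m%:R * pi <= axis_point m.
Proof.
have ge0 j : 0 <= axis_point j.
  apply: limr_ge; first by apply/cvg_ex; exists (axis_point j); exact: cvg_pullback.
  by near=> n; case/andP: (pullback_bounds n j).
rewrite axis_pointE lerDl atan_ge0// divr_ge0//; exact: ltW.
Unshelve. all: end_near. Qed.

Lemma axis_point_escapes m : axis_escapes (axis_point m).
Proof.
exists (fun j => (axis_point (m + j), 0, 0)); split.
- by rewrite addn0.
- by move=> j; rewrite axis_pointE Tl_axis_branch addnS.
- move=> A; near=> j; apply: (@lt_le_trans _ _ (axis_point (m + j))); last first.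
    by rewrite !prod_normE/= !le_max ler_norm.
  apply: lt_le_trans (axis_point_ge _).
  have p3 := pi_ge3 (R := R).
  have h : A < j%:R by near: j; exact: nbhs_infty_gtr.
  have mj : j%:R <= (m + j)%:R :> R by rewrite ler_nat leq_addl.
  have j0 : 0 <= j%:R :> R by [].
  have : (m + j)%:R <= (m + j)%:R * pi :> R by rewrite ler_peMr//; lra.
  lra.
Unshelve. all: end_near. Qed.

(** An interval without escaping points does not meet a pole of the tangent, as
    near a pole there are preimages of escaping points that are arbitrarily
    large. So it lies in one branch, and its image is longer. *)
Lemma axis_dense_step a b : a < b -> (forall x, a <= x <= b -> ~ axis_escapes x) ->
  exists s t, [/\ lam * (b - a) <= t - s, t - s > 0 &
    forall x, s <= x <= t -> ~ axis_escapes x] /\ b - a < pi.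
Proof.
move=> ab free; have p0 := pi_gt0 R.
have l0 := lam0.
(* The interval [(k - 1/2) pi, (k + 1/2) pi) contains a. *)
pose k := Num.floor (a / pi + 1 / 2).
have := floor_itv (a / pi + 1 / 2); rewrite -/k intrD => /andP[k1 k2].
have ae : a = a / pi * pi by rewrite divfK// gt_eqF.
have a1 : k%:~R * pi - pi / 2 <= a.
  have : (k%:~R - 1 / 2) * pi <= a / pi * pi by rewrite ler_pM2r//; lra.
  by rewrite -ae; lra.
have a2 : a < k%:~R * pi + pi / 2.
  have : a / pi * pi < (k%:~R + 1 / 2) * pi by rewrite ltr_pM2r//; lra.
  by rewrite -ae; lra.
set q := k%:~R * pi in a1 a2.
have large (A : R) : exists y, A < y /\ axis_escapes y.
  have h : exists n : nat, A < n%:R by exists (Num.truncn A).+1; exact: truncnS_gt.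
  have [n hn] := h; exists (axis_point n); split; last exact: axis_point_escapes.
  apply: (lt_le_trans hn); apply: le_trans (axis_point_ge n).
  by rewrite ler_peMr//; have := pi_ge3 (R := R); lra.
have inv (d : R) : - (pi / 2) < d < pi / 2 -> atan (lam * tan d / lam) = d.
  by move=> hd; rewrite mulrAC divff ?gt_eqF// mul1r tanK// in_itv.
(* The next pole is a limit of preimages of large escaping points. *)
have nopole : b < q + pi / 2.
  rewrite ltNge; apply/negP => bq.
  pose d := Num.max (a - q) 0.
  have d1 : - (pi / 2) < d < pi / 2 by rewrite /d lt_max gt_max; apply/andP; split; lra.
  have [y [hy ey]] := large (lam * tan d).
  have := (axis_escapes_branch k y).2 ey; apply: free.
  have hd : d <= atan (y / lam).
    by rewrite -{1}(inv d d1) le_atan// ler_pM2r ?invr_gt0// ltW.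
  have := atan_ltpi2 (y / lam); rewrite /axis_branch -/q.
  have : a - q <= d by rewrite /d le_max lexx.
  by move=> h1 h2; apply/andP; split; lra.
have nopole' : q - pi / 2 < a.
  rewrite lt_neqAle a1 andbT; apply/eqP => aq.
  pose d := Num.min (b - q) 0.
  have d1 : - (pi / 2) < d < pi / 2 by rewrite /d lt_min gt_min; apply/andP; split; lra.
  have [y [hy ey]] := large (- (lam * tan d)).
  have := (axis_escapes_branch k (- y)).2 (axis_escapesN _ ey); apply: free.
  have hd : atan (- y / lam) <= d.
    by rewrite -{1}(inv d d1) le_atan// ler_pM2r ?invr_gt0// ltW//; lra.
  have := atan_gtNpi2 (- y / lam); rewrite /axis_branch -/q.
  have : d <= b - q by rewrite /d ge_min lexx.
  by move=> h1 h2; apply/andP; split; lra.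
have ia : - (pi / 2) < a - q < pi / 2 by apply/andP; split; lra.
have ib : - (pi / 2) < b - q < pi / 2 by apply/andP; split; lra.
pose s := lam * tan (a - q); pose t := lam * tan (b - q).
have sa : axis_branch k s = a by rewrite /axis_branch inv// -/q; lra.
have tb : axis_branch k t = b by rewrite /axis_branch inv// -/q; lra.
have ab' : a - q < b - q by lra.
have st : s < t.
  rewrite ltNge; apply/negP => ts.
  by have := axis_branch_le k _ _ ts; rewrite sa tb leNgt ab.
exists s, t; split; last by lra.
split; last 2 first.
- by rewrite subr_gt0.
- move=> x /andP[sx xt] ex; have := (axis_escapes_branch k x).2 ex; apply: free.
  by rewrite -sa -tb !axis_branch_le.
have st' : s / lam <= t / lam by rewrite ler_pM2r ?invr_gt0// ltW.
have := atan_lipschitz _ _ st'.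
rewrite inv// inv// -mulrBl ler_pdivlMr//.
have -> : b - q - (a - q) = b - a by ring.
by rewrite mulrC.
Qed.

Lemma axis_dense a b : a < b -> exists2 x, a <= x <= b & axis_escapes x.
Proof.
move=> ab; apply: contrapT => nx.
have free x : a <= x <= b -> ~ axis_escapes x by move=> hx ex; apply: nx; exists x.
have grow n : exists s t, [/\ (b - a) * lam ^+ n <= t - s, t - s > 0 &
    forall x, s <= x <= t -> ~ axis_escapes x].
  elim: n => [|n [s [t [h1 h2 h3]]]].
    by exists a, b; split => //; rewrite ?expr0 ?mulr1// subr_gt0.
  rewrite subr_gt0 in h2; have [s' [t' [[h4 h5 h6] _]]] := axis_dense_step s t h2 h3.
  exists s', t'; split => //; apply: le_trans h4.
  by rewrite exprSr mulrA mulrC ler_pM2l.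
have ba : 0 < b - a by rewrite subr_gt0.
have [n hn] := exp_unbounded lam (b - a) pi lam1 ba.
have [s [t [h1 h2 h3]]] := grow n; rewrite subr_gt0 in h2.
have [_ [_ [_ h4]]] := axis_dense_step s t h2 h3.
by have := lt_le_trans hn h1; rewrite ltNge (ltW h4).
Qed.

End Axis.

(** * Local inverses of the planar map *)

Section InverseBranches.
Context {R : realType} (lam : R) (lam0 : 0 < lam).
Implicit Types (p z : R * R).

Definition image_amplitude z := atan (Num.sqrt (z.1 ^+ 2 + z.2 ^+ 2) / lam).

(** The distances of a point to the sides of the square, as recovered from its
    image z: their ratio is that of the coordinates, and half_fold_amplitude
    gives the larger one. *)
Definition fold_inverse z : R * R :=
  let m := half_fold (image_amplitude z) / Num.max z.1 z.2 in
  (m * z.1, m * z.2).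

(** The preimage in the cell at the corner (pi/2, 0), for z outside the disc of
    radius lam; fold_inverse is the one in the cell at the origin. *)
Definition east z : R * R := (pi / 2 - (fold_inverse z).1, (fold_inverse z).2).

Definition positive z := 0 < z.1 /\ 0 < z.2.

Lemma max_gt0 z : positive z -> 0 < Num.max z.1 z.2.
Proof. by move=> [z1 _]; rewrite lt_max z1. Qed.

Lemma norm_gt0 z : positive z -> 0 < Num.sqrt (z.1 ^+ 2 + z.2 ^+ 2).
Proof. by move=> [z1 _]; rewrite sqrtr_gt0 ltr_wpDr ?sqr_ge0// exprn_gt0. Qed.

Lemma image_amplitude_itv z : positive z -> 0 < image_amplitude z < pi / 2.
Proof.
move=> /norm_gt0 z0; rewrite /image_amplitude atan_ltpi2 andbT.
by rewrite -(@atan0 R) lt_atan// divr_gt0.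
Qed.

Lemma fold_inverse_bounds z : positive z ->
  [/\ 0 < (fold_inverse z).1, 0 < (fold_inverse z).2 &
    Num.max (fold_inverse z).1 (fold_inverse z).2 = half_fold (image_amplitude z)].
Proof.
move=> pz; have M0 := max_gt0 _ pz; have [z1 z2] := pz.
have h0 := half_fold_gt0 _ (image_amplitude_itv _ pz).
rewrite /fold_inverse /=; split; [by rewrite mulr_gt0// divr_gt0..|].
by rewrite -maxr_pMr ?divfK ?gt_eqF// divr_ge0// ltW.
Qed.

Lemma planar_map_recover p z : positive z ->
  half_fold p.1 = (fold_inverse z).1 -> half_fold p.2 = (fold_inverse z).2 ->
  amplitude p.1 p.2 = image_amplitude z -> planar_map lam p = z.
Proof.
move=> pz h1 h2 ha; have M0 := max_gt0 _ pz; have n0 := norm_gt0 _ pz.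
have m0 := half_fold_gt0 _ (image_amplitude_itv _ pz).
have ht : tan (image_amplitude z) = Num.sqrt (z.1 ^+ 2 + z.2 ^+ 2) / lam by rewrite atanK.
rewrite /planar_map h1 h2 ha ht /fold_inverse /=.
set m := half_fold _ in m0 *; set M := Num.max _ _ in M0 *; set r := Num.sqrt (z.1 ^+ 2 + z.2 ^+ 2) in n0 *.
have c0 : 0 <= m / M by rewrite divr_ge0// ltW.
have -> : Num.sqrt ((m / M * z.1) ^+ 2 + (m / M * z.2) ^+ 2) = m / M * r.
  by rewrite !(exprMn _ (m / M)) -mulrDr sqrtrM ?sqr_ge0// sqrtr_sqr ger0_norm.
rewrite [RHS]surjective_pairing; congr (_, _).
  by field; rewrite !gt_eqF.
by field; rewrite !gt_eqF.
Qed.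

Lemma planar_map_fold_inverse z : positive z -> image_amplitude z <= pi / 4 ->
  quarter (fold_inverse z) /\ planar_map lam (fold_inverse z) = z.
Proof.
move=> pz nz; have p0 := pi_gt0 R.
have [u0 v0 uv] := fold_inverse_bounds _ pz; rewrite half_fold_lo// in uv.
have u4 : (fold_inverse z).1 <= pi / 4 by rewrite (le_trans _ nz)// -uv le_max lexx.
have v4 : (fold_inverse z).2 <= pi / 4 by rewrite (le_trans _ nz)// -uv le_max lexx orbT.
split; first by split; apply/andP; split=> //; lra.
apply: planar_map_recover => //; rewrite ?half_fold_lo// /amplitude uv min_l//.
rewrite (le_trans nz)// lerBrDr; have : Num.min (fold_inverse z).1 (fold_inverse z).2 <= pi / 4.
  by rewrite ge_min u4.
lra.
Qed.

Lemma planar_map_east z : positive z -> pi / 4 <= image_amplitude z ->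
  quarter (east z) /\ planar_map lam (east z) = z.
Proof.
move=> pz nz; have p0 := pi_gt0 R.
have [u0 v0 uv] := fold_inverse_bounds _ pz; rewrite half_fold_hi// in uv.
have /andP[_ n2] := image_amplitude_itv _ pz.
have u4 : (fold_inverse z).1 <= pi / 2 - image_amplitude z by rewrite -uv le_max lexx.
have v4 : (fold_inverse z).2 <= pi / 2 - image_amplitude z by rewrite -uv le_max lexx orbT.
have /andP[n1 _] := image_amplitude_itv _ pz.
have q1 : 0 < pi / 2 - (fold_inverse z).1 < pi / 2 by apply/andP; split; lra.
have q2 : 0 < (fold_inverse z).2 < pi / 2 by apply/andP; split; lra.
split; first exact: (conj q1 q2).
have hu : half_fold (pi / 2 - (fold_inverse z).1) = (fold_inverse z).1.
  by rewrite half_foldC half_fold_lo//; lra.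
have hv : half_fold (fold_inverse z).2 = (fold_inverse z).2.
  by rewrite half_fold_lo//; lra.
apply: (planar_map_recover (east z) z pz hu hv).
suff : amplitude (pi / 2 - (fold_inverse z).1) (fold_inverse z).2 = image_amplitude z by [].
rewrite /amplitude; move: uv u4 v4 nz n2; generalize (image_amplitude z).
move: (fold_inverse z).1 (fold_inverse z).2 => u v n.
by rewrite /Num.max /Num.min; do 3 case: ifP; lra.
Qed.

Lemma image_amplitude_planar_map p : quarter p -> image_amplitude (planar_map lam p) = amplitude p.1 p.2.
Proof.
move=> qp; have /andP[a0 a1] := amplitude_itv p qp.
have t0 : 0 < tan (amplitude p.1 p.2) by rewrite tan_gt0// a0.
have [/half_fold_gt0 u0 /half_fold_gt0 v0] := qp.
rewrite /image_amplitude /planar_map /=; set u := half_fold _ in u0 *; set v := half_fold _ in v0 *.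
set r := Num.sqrt (u ^+ 2 + v ^+ 2).
have r0 : 0 < r by rewrite sqrtr_gt0 ltr_wpDr ?sqr_ge0// exprn_gt0.
set t := tan _ in t0 *; set c := lam * t / r.
have c0 : 0 <= c by apply: ltW; rewrite divr_gt0// mulr_gt0.
have -> : Num.sqrt ((c * u) ^+ 2 + (c * v) ^+ 2) = c * r.
  by rewrite !(exprMn _ c) -mulrDr sqrtrM ?sqr_ge0// sqrtr_sqr ger0_norm.
have -> : c * r / lam = t by rewrite /c; field; rewrite !gt_eqF.
rewrite /t tanK// in_itv/= a1 andbT.
by have := pi_gt0 R; lra.
Qed.

Lemma fold_inverse_planar_map p : quarter p ->
  fold_inverse (planar_map lam p) = (half_fold p.1, half_fold p.2).
Proof.
move=> qp; have /andP[a0 a1] := amplitude_itv p qp.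
have t0 : 0 < tan (amplitude p.1 p.2) by rewrite tan_gt0// a0.
have [/half_fold_gt0 u0 /half_fold_gt0 v0] := qp.
have uvE := half_fold_amplitude p.1 p.2.
rewrite /fold_inverse image_amplitude_planar_map// uvE /planar_map /=.
set u := half_fold _ in u0 *; set v := half_fold _ in v0 *.
set r := Num.sqrt (u ^+ 2 + v ^+ 2).
have r0 : 0 < r by rewrite sqrtr_gt0 ltr_wpDr ?sqr_ge0// exprn_gt0.
set a := lam * _ / r; have a_gt0 : 0 < a by rewrite divr_gt0// mulr_gt0.
rewrite -maxr_pMr ?(ltW a_gt0)//.
have M0 : 0 < Num.max u v by rewrite lt_max u0.
by congr (_, _); field; rewrite !gt_eqF.
Qed.

(** A point has the same image as its half-turn about (pi/4, pi/4), and up to this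
    half-turn it is in the cell at (0, 0) or in that at (pi/2, 0). On the common
    boundary of cells both descriptions are valid. *)
Lemma planar_map_branch p : quarter p -> let z := planar_map lam p in
  (image_amplitude z <= pi / 4 ->
     p = fold_inverse z \/ p = (pi / 2 - (fold_inverse z).1, pi / 2 - (fold_inverse z).2)) /\
  (pi / 4 <= image_amplitude z ->
     p = east z \/ p = (pi / 2 - (east z).1, pi / 2 - (east z).2)).
Proof.
move=> qp z; have hw : fold_inverse z = _ := fold_inverse_planar_map p qp.
have ha : image_amplitude z = _ := image_amplitude_planar_map p qp.
rewrite /east; move: (fold_inverse z) hw => _ ->; rewrite {}ha; clear z.
case: p qp => x y [/= /andP[x0 x1] /andP[y0 y1]].
have pairP (a b c d : R) : a = c -> b = d -> (a, b) = (c, d) by move=> -> ->.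
have [x4|/ltW x4] := leP x (pi / 4); have [y4|/ltW y4] := leP y (pi / 4).
all: rewrite ?(half_fold_lo x x4) ?(half_fold_lo y y4) ?(half_fold_hi x x4) ?(half_fold_hi y y4).
all: rewrite /amplitude /=.
- split=> [_|h]; first by left.
  have [e|e] : x = pi / 4 \/ y = pi / 4.
  + by move: h; rewrite /Num.max /Num.min; do !(case: ifP); lra.
  + by left; apply: pairP; lra.
  + by right; apply: pairP; lra.
- split=> [h|_]; last by right; apply: pairP; lra.
  have [e|e] : x = pi / 4 \/ y = pi / 4.
  + by move: h; rewrite /Num.max /Num.min; do !(case: ifP); lra.
  + by right; apply: pairP; lra.
  + by left; apply: pairP; lra.
- split=> [h|_]; last by left; apply: pairP; lra.
  have [e|e] : x = pi / 4 \/ y = pi / 4.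
  + by move: h; rewrite /Num.max /Num.min; do !(case: ifP); lra.
  + by left; apply: pairP; lra.
  + by right; apply: pairP; lra.
- split=> [_|h]; first by right; apply: pairP; lra.
  have [e|e] : x = pi / 4 \/ y = pi / 4.
  + by move: h; rewrite /Num.max /Num.min; do !(case: ifP); lra.
  + by right; apply: pairP; lra.
  + by left; apply: pairP; lra.
Qed.

Lemma continuous_image_amplitude z : {for z, continuous image_amplitude}.
Proof.
have sq (g : R * R -> R) : {for z, continuous g} -> {for z, continuous (fun p => g p ^+ 2)}.
  by move=> cg; apply: (@continuous_comp _ _ _ g (fun y : R => y ^+ 2)) => //; exact: exprn_continuous.
apply: (@continuous_comp _ _ _ (fun z : R * R => Num.sqrt (z.1 ^+ 2 + z.2 ^+ 2) / lam) atan); last exact: continuous_atan.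
apply: continuousM; last exact: cvg_cst.
apply: (@continuous_comp _ _ _ (fun z : R * R => z.1 ^+ 2 + z.2 ^+ 2) Num.sqrt); last exact: sqrt_continuous.
by apply: continuousD; apply: sq; [exact: continuous_fst|exact: continuous_snd].
Qed.

Lemma continuous_fold_inverse z : positive z -> {for z, continuous fold_inverse}.
Proof.
move=> pz; have c : {for z, continuous (fun z : R * R => half_fold (image_amplitude z) / Num.max z.1 z.2)}.
  apply: continuousM.
    apply: (@continuous_comp _ _ _ image_amplitude (@half_fold R)); last exact: continuous_half_fold.
    exact: continuous_image_amplitude.
  apply: continuousV; first by rewrite gt_eqF// max_gt0.
  by apply: (@continuous_max _ _ (fun p : R * R => p.1) (fun p : R * R => p.2));
      [exact: continuous_fst|exact: continuous_snd].
by apply: continuous_pair; (apply: continuousM; [exact: c|]); [exact: continuous_fst|exact: continuous_snd].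
Qed.

Lemma continuous_east z : positive z -> {for z, continuous east}.
Proof.
move=> pz; have c := continuous_fold_inverse z pz.
have c1 : {for z, continuous (fun z => (fold_inverse z).1)}.
  by apply: (@continuous_comp _ _ _ fold_inverse fst); [exact: c|exact: continuous_fst].
have c2 : {for z, continuous (fun z => (fold_inverse z).2)}.
  by apply: (@continuous_comp _ _ _ fold_inverse snd); [exact: c|exact: continuous_snd].
by apply: continuous_pair; [apply: continuousB; [exact: cvg_cst|exact: c1]|exact: c2].
Qed.

End InverseBranches.

(** * The complement of the escaping set is a gap *)

Section Bridge.
Context {R : realType} (lam : R) (lam1 : 1 < lam).
Implicit Types (p q z : R * R).

Let lam0 : 0 < lam. Proof. exact: lt_trans lam1. Qed.

Definition plane_escapes p := escapes (Tl lam) (p.1, p.2, 0).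

Definition escape_gap : set (R * R) := (~` [set p | plane_escapes p])°.

Lemma escape_gapP p : escape_gap p <-> \forall q \near p, ~ plane_escapes q.
Proof. by []. Qed.

(** The symmetries of the escaping set and the local inverses of the map, where
    continuous, are transferred to its gaps in this form. *)
Lemma gap_transfer (f : R * R -> R * R) p : {for p, continuous f} ->
  (\forall q \near p, plane_escapes q -> plane_escapes (f q)) ->
  escape_gap (f p) -> escape_gap p.
Proof.
move=> cf ef /escape_gapP gf; apply/escape_gapP.
have nf : \forall q \near p, ~ plane_escapes (f q) by exact: cf gf.
by apply: filterS2 ef nf => q h1 h2 /h1.
Qed.

Lemma plane_escapes_swap p : plane_escapes p -> plane_escapes (p.2, p.1).
Proof. by case: p => x y; exact: (escapes_swap_xy lam (x, y, 0)). Qed.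

Lemma plane_escapes_neg p : plane_escapes p -> plane_escapes (- p.1, p.2).
Proof. by case: p => x y; exact: (escapes_neg_x lam (x, y, 0)). Qed.

Lemma plane_escapes_shift p : plane_escapes (p.1 + pi, p.2) <-> plane_escapes p.
Proof.
have e : Tl lam (p.1 + pi, p.2, 0) = Tl lam (p.1, p.2, 0) by rewrite !TlE T_shift_x.
split; apply: escapes_eq; exact: e || exact: (esym e).
Qed.

Lemma plane_escapes_planar_map p : quarter p -> plane_escapes p <-> plane_escapes (planar_map lam p).
Proof.
case: p => x y q; rewrite /plane_escapes escapesS Tl_quarter//; split=> [[r [<-]]//|h].
by exists (planar_map lam (x, y), 0) => //; move: h; rewrite [planar_map lam _]surjective_pairing.
Qed.

Lemma quarter_center p : quarter p -> quarter (pi / 2 - p.1, pi / 2 - p.2).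
Proof. by move=> [/andP[h1 h2] /andP[h3 h4]]; split; apply/andP; split; rewrite /=; lra. Qed.

Lemma plane_escapes_center p : quarter p ->
  plane_escapes p <-> plane_escapes (pi / 2 - p.1, pi / 2 - p.2).
Proof.
move=> qp; rewrite plane_escapes_planar_map// [X in _ <-> X]plane_escapes_planar_map; last exact: quarter_center.
by rewrite planar_map_center; case: p qp.
Qed.

Lemma near_quarter p : quarter p -> \forall q \near p, quarter q.
Proof. by move=> qp; exact: (open_nbhs_nbhs (conj (@open_quarter R) qp)). Qed.

Let continuous_center p : {for p, continuous (fun p : R * R => (pi / 2 - p.1, pi / 2 - p.2))}.
Proof.
by apply: continuous_pair; apply: continuousB;
  solve [exact: cvg_cst | exact: continuous_fst | exact: continuous_snd].
Qed.

Lemma escape_gap_center p : quarter p ->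
  escape_gap (pi / 2 - p.1, pi / 2 - p.2) -> escape_gap p.
Proof.
move=> qp; apply: (gap_transfer (fun p : R * R => (pi / 2 - p.1, pi / 2 - p.2))).
  exact: continuous_center.
by apply: filterS (near_quarter p qp) => q qq /(plane_escapes_center q qq).
Qed.

Lemma positive_planar_map p : quarter p -> positive (planar_map lam p).
Proof. by case: p => x y q; exact: planar_map_gt0. Qed.

Lemma near_positive z : positive z -> \forall w \near z, positive w.
Proof.
move=> pz; have cst (b : R) : continuous (fun _ : R * R => b) by move=> ?; exact: cvg_cst.
have op : open (@positive R).
  rewrite (_ : positive = [set p : R * R | 0 < p.1] `&` [set p : R * R | 0 < p.2]) //.
  by apply: openI; apply: open_ltf => //;
    solve [exact: continuous_fst_plane | exact: continuous_snd_plane].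
exact: (open_nbhs_nbhs (conj op pz)).
Qed.

(** A point w close to the image of p has a preimage close to p or to its half-turn:
    it is fold_inverse w or east w, according to whether w is inside or outside
    the disc of radius lam. Both are needed if the image of p is on the circle,
    where the map folds. *)
Lemma escape_gap_image p : quarter p -> escape_gap p -> escape_gap (planar_map lam p).
Proof.
move=> qp Wp; set z := planar_map lam p.
have pz : positive z by exact: positive_planar_map.
have [B1 B2] := planar_map_branch lam lam0 p qp; rewrite -/z in B1 B2.
have Wb b : quarter b -> p = b \/ p = (pi / 2 - b.1, pi / 2 - b.2) -> escape_gap b.
  by move=> qb [e|e]; [rewrite -e|apply: escape_gap_center => //; rewrite -e].
have low : \forall w \near z, image_amplitude lam w <= pi / 4 -> ~ plane_escapes w.
  have [nz|nz] := leP (image_amplitude lam z) (pi / 4); last first.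
    have : \forall w \near z, pi / 4 < image_amplitude lam w.
      have nb : nbhs (image_amplitude lam z) [set t | pi / 4 < t].
        by apply: open_nbhs_nbhs; split; [exact: open_gt|].
      exact: (continuous_image_amplitude lam z _ nb).
    by apply: filterS => w h; rewrite leNgt h.
  have [qb _] := planar_map_fold_inverse lam lam0 z pz nz.
  have /escape_gapP g := Wb _ qb (B1 nz).
  have := continuous_fold_inverse lam z pz _ g.
  apply: filterS2 (near_positive z pz) => w pw nw hw ew.
  have [qw ww] := planar_map_fold_inverse lam lam0 w pw hw.
  by apply: nw; apply/plane_escapes_planar_map => //; rewrite ww.
have high : \forall w \near z, pi / 4 <= image_amplitude lam w -> ~ plane_escapes w.
  have [nz|nz] := leP (pi / 4) (image_amplitude lam z); last first.
    have : \forall w \near z, image_amplitude lam w < pi / 4.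
      have nb : nbhs (image_amplitude lam z) [set t | t < pi / 4].
        by apply: open_nbhs_nbhs; split; [exact: open_lt|].
      exact: (continuous_image_amplitude lam z _ nb).
    by apply: filterS => w h; rewrite leNgt h.
  have [qb _] := planar_map_east lam lam0 z pz nz.
  have /escape_gapP g := Wb _ qb (B2 nz).
  have := continuous_east lam z pz _ g.
  apply: filterS2 (near_positive z pz) => w pw nw hw ew.
  have [qw ww] := planar_map_east lam lam0 w pw hw.
  by apply: nw; apply/plane_escapes_planar_map => //; rewrite ww.
apply/escape_gapP; apply: filterS2 low high => w hl hh.
by have [/hl|/ltW/hh] := leP (image_amplitude lam w) (pi / 4).
Qed.

(** The cases c = 0 and c = pi/2 are the axis and the wall; the half-turn about
    (pi/4, pi/4) shifts the parameter along the wall by pi/2. *)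
Lemma line_not_in_gap (c y : R) :
  (forall s, axis_escapes lam s -> plane_escapes (c, s + c)) -> ~ escape_gap (c, y).
Proof.
move=> line /escape_gapP /nbhs_ballP[e /= e0 he].
have ab : y - c - e / 2 < y - c + e / 2 by lra.
have [s /andP[s1 s2] es] := axis_dense lam lam1 _ _ ab.
apply: (he (c, s + c)); last exact: line.
split; rewrite /= /ball /=; first by rewrite subrr normr0.
by rewrite ltr_norml; apply/andP; split; lra.
Qed.

Lemma gap_escape_gap : gap lam escape_gap.
Proof.
split.
- exact: open_interior.
- move=> x y; apply: (gap_transfer (fun p => (p.2, p.1)) (y, x)).
    by apply: continuous_pair; [exact: continuous_snd|exact: continuous_fst].
  by apply: filterE => q; exact: plane_escapes_swap.
- move=> x y; rewrite -{1}[x]opprK; apply: (gap_transfer (fun p => (- p.1, p.2)) (- x, y)).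
    apply: continuous_pair; last exact: continuous_snd.
    by apply: continuousN; exact: continuous_fst.
  by apply: filterE => q; exact: plane_escapes_neg.
- move=> x y; have -> : escape_gap (x, y) = escape_gap (x + pi - pi, y) by rewrite addrK.
  apply: (gap_transfer (fun p => (p.1 - pi, p.2)) (x + pi, y)).
    apply: continuous_pair; last exact: continuous_snd.
    by apply: continuousB; [exact: continuous_fst|exact: cvg_cst].
  by apply: filterE => q; rewrite -(plane_escapes_shift (q.1 - pi, q.2)) /= subrK; case: q.
- move=> y; apply: line_not_in_gap => s es; rewrite addr0.
  exact: (plane_escapes_swap (s, 0)).
- move=> y; apply: line_not_in_gap => s es.
  have /axis_escapesN es' := es.
  have : plane_escapes (s + pi / 2, pi / 2).
    apply: escapes_eq es'; rewrite !TlE.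
    by have := T_shift_diag s 0 (0 : R); rewrite add0r oppr0 => ->.
  exact: plane_escapes_swap.
- move=> p qp; split; first exact: escape_gap_image.
  apply: gap_transfer; first exact: continuous_planar_map.
  by apply: filterS (near_quarter p qp) => q qq /(plane_escapes_planar_map q qq).
Qed.

End Bridge.

Theorem theorem2p3 (R : realType) :
  (forall lambda : R, Num.sqrt 2 < lambda ->
     closure (escaping_set (Tl lambda)) =
     [set (x, y, 0) | x in [set: R] & y in [set: R]]) /\
  (forall c : R, 0 < c < Num.sqrt 2 ->
     exists2 lambda : R, c < lambda &
       closure (escaping_set (Tl lambda)) <>
       [set (x, y, 0) | x in [set: R] & y in [set: R]]).
Proof.
split=> [lam lam2|c /andP[c0 c2]]; last first.
  have s2 : Num.sqrt 2 ^+ 2 = 2 :> R by rewrite sqr_sqrtr.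
  exists ((c + Num.sqrt 2) / 2); first lra.
  apply: closure_neq_plane; first lra.
  rewrite -[ltRHS]s2 ltr_sqr ?nnegrE; lra.
have s1 : 1 < Num.sqrt 2 :> R by rewrite -[ltLHS]sqrtr1 ltr_sqrt// ltr1n.
have lam1 : 1 < lam by exact: lt_trans lam2.
rewrite escaping_setE; apply/seteqP; split=> [p cp|_ [x _ [y _ <-]] B nB].
  have : closure [set p : R * R * R | p.2 = 0] p.
    by apply: closure_subset cp => q eq; exact: escaping_planar eq.
  have cl : closed [set p : R * R * R | p.2 = 0].
    apply: (@closed_comp _ _ snd [set 0 : R]); last exact: closed_eq.
    by move=> q _; exact: continuous_snd.
  rewrite -(closure_id _).1//.
  by case: p cp => [[x y] z] _ /= ->; exists x => //; exists y.
apply: contrapT => nB'.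
apply: (gap_empty lam (escape_gap lam) (gap_escape_gap lam lam1) lam2 (x, y)).
apply/escape_gapP.
have c : {for (x, y), continuous (fun p : R * R => (p.1, p.2, 0 : R))}.
  apply: continuous_pair; last exact: cvg_cst.
  by apply: continuous_pair; [exact: continuous_fst|exact: continuous_snd].
have : \forall q \near (x, y), B (q.1, q.2, 0) by exact: c nB.
apply: filterS => q Bq eq; apply: nB'; by exists (q.1, q.2, 0).
Qed.
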